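(* Let $k$ be a commutative field and let $H$ be a residually nilpotent Lie $k$-algebra with an RN-series $\{H_i\}_{i=1}^\infty$ that has a Q-basis $\mathcal C=\bigcup_{i=1}^\infty\mathcal C_i$. Let $K$ be a field (division ring) with $k$ as a central subfield. For any crossed product $K*U(H)$ and any canonical ordering of $\mathcal C$, the ring of series $K((H))$ is a field that contains $K*U(H)$.
   Context: A field means a division ring. Crossed products: let $L$ be a Lie $k$-algebra and $R$ a $k$-algebra. A crossed product $R*U(L)$ is a $k$-algebra $S\supseteq R$ with a $k$-linear embedding $L\to S$, $x\mapsto\bar x$, such that (i) for a totally ordered $k$-basis $\mathcal B$ of $L$ the standard monomials $\bar x_1\cdots\bar x_m$ ($m\ge0$, $x_i\in\mathcal B$, $x_1\le\dots\le x_m$) form a basis of $S$ as left $R$-module; (ii) there are a $k$-linear map $\delta\colon L\to\mathrm{Der}_k(R)$ and a $k$-bilinear antisymmetric map $t\colon L\times L\to R$ with $\bar xa=a\bar x+\delta_x(a)$ and $\bar x\bar y-\bar y\bar x=\overline{[x,y]}+t(x,y)$ for $x,y\in L$, $a\in R$. If $N$ is an ideal of $L$, $R*U(N)$ is the subring generated by $R$ and $\bar N$, and $R*U(L)=(R*U(N))*U(L/N)$ is again a crossed product (embed $L/N$ via a linear complement of $N$ in $L$). Series ring, nilpotent (or hypercentral) case: suppose $L$ has a well-ordered basis $\{u_\gamma\}_{\gamma<\varepsilon}$ such that, with $N_\beta=\mathrm{span}\{u_\gamma\mid\gamma<\beta\}$, $[L,u_\beta]\subseteq N_\beta$ for all $\beta$.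 Define rings $R((N_\beta))$ together with crossed products $R((N_\beta))*U(L/N_\beta)\supseteq R*U(L)$, $\beta\le\varepsilon$, recursively: $R((N_0))=R$; $R((N_{\gamma+1}))=R_\gamma((z_\gamma;\delta_{u_\gamma}))$ where $R_\gamma=R((N_\gamma))$, $z_\gamma=\bar u_\gamma^{-1}$, the elements being Laurent series $\sum_{n\ge l}a_nz_\gamma^n$ ($l\in\mathbb Z$, $a_n\in R_\gamma$), multiplied using $z_\gamma a=\sum_{i\ge1}(-1)^{i-1}\delta_{u_\gamma}^{i-1}(a)z_\gamma^i$; the derivations $\delta_x\colon f\mapsto\bar xf-f\bar x$ of $R_\gamma[\bar u_\gamma;\delta_{u_\gamma}]$ extend termwise to $R((N_{\gamma+1}))$ with $\delta_x(z_\gamma)=-z_\gamma\delta_x(\bar u_\gamma)z_\gamma$, and this gives the crossed product $R((N_{\gamma+1}))*U(L/N_{\gamma+1})$ extending $R_\gamma*U(L/N_\gamma)$; at limit ordinals take unions (direct limits). Put $R((L))=R((N_\varepsilon))$. Series ring, residually nilpotent case: an RN-series of a Lie algebra $H$ is a descending sequence of ideals $H=H_1\supseteq H_2\supseteq\cdots$ with $[H,H_i]\subseteq H_{i+1}$ and $\bigcap_iH_i=0$; $H$ is residually nilpotent if it has one. A Q-basis for it is a basis $\mathcal C=\bigcup_i\mathcal C_i$ of $H$ where $\mathcal C_i\subseteq H_i$ gives a basis of $H_i/H_{i+1}$. A canonical ordering of $\mathcal C$ is obtained by well-ordering each $\mathcal C_i$ and declaring $u<v$ if $u\in\mathcal C_i$,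 $v\in\mathcal C_j$, $i>j$. For $m\ge1$ put $R_m=R*U(H_m)$, view $R*U(H)=R_m*U(H/H_m)$ and form $R_m((H/H_m))$ with the well-ordered basis of $H/H_m$ given by $\bigcup_{i<m}\mathcal C_i$. For $n>m$, $R_m=R_n*U(H_m/H_n)\subseteq R_n((H_m/H_n))$ induces $R_m((H/H_m))\hookrightarrow R_n((H_m/H_n))((H/H_m))=R_n((H/H_n))$; define $R((H))=\varinjlim_mR_m((H/H_m))$. *)

(* Defs.v *)
From HB Require Import structures.
From mathcomp Require Import all_boot all_order all_algebra.
From mathcomp Require Import boolp classical_sets wochoice.

Set Implicit Arguments.
Unset Strict Implicit.
Unset Printing Implicit Defensive.

Import Order.TTheory GRing.Theory Num.Theory.
Local Open Scope classical_set_scope.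
Local Open Scope ring_scope.

Definition division_ring (D : nzRingType) : Prop :=
  forall x : D, x != 0 -> exists y : D, y * x = 1 /\ x * y = 1.

Record lie_bracket (k : fieldType) (L : lmodType k)
    (br : {bilinear L -> L -> L}) : Prop := LieBracket {
  lie_alternating : forall x, br x x = 0;
  lie_jacobi : forall x y z,
    br x (br y z) + br y (br z x) + br z (br x y) = 0
}.

Record lie_ideal (k : fieldType) (L : lmodType k)
    (br : {bilinear L -> L -> L}) (I : set L) : Prop := LieIdeal {
  lie_ideal_submod : submod_closed [in I];
  lie_ideal_br : forall x y, I y -> I (br x y)
}.

(* [B] is a subset of [V] whose elements are pairwise distinct modulo [W] and
   give a basis of [V / W].  For [V = setT] and [W = [set 0]], [B] is a basis
   of [L]. *)
Record basis_mod (k : fieldType) (L : lmodType k) (V W B : set L) : Prop :=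
  BasisMod {
  basis_sub : B `<=` V;
  basis_span : forall x, V x -> exists (s : seq L) (a : L -> k),
    {subset s <= B} /\ W (x - \sum_(b <- s) a b *: b);
  basis_free : forall (s : seq L) (a : L -> k), uniq s -> {subset s <= B} ->
    W (\sum_(b <- s) a b *: b) -> {in s, forall b, a b = 0}
}.

(* Series are numbered from 0: [Hs i] and [C i] stand for $H_{i+1}$ and
   $\mathcal C_{i+1}$. *)
Record rn_series (k : fieldType) (H : lmodType k)
    (br : {bilinear H -> H -> H}) (Hs : nat -> set H) : Prop := RNSeries {
  rn_first : Hs 0%N = setT;
  rn_ideal : forall i, lie_ideal br (Hs i);
  rn_desc : forall i, Hs i.+1 `<=` Hs i;
  rn_central : forall i x y, Hs i y -> Hs i.+1 (br x y);
  rn_cap : \bigcap_i Hs i = [set 0]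
}.

Record q_basis (k : fieldType) (H : lmodType k) (Hs C : nat -> set H) : Prop :=
  QBasis {
  q_basis_total : basis_mod setT [set 0] (\bigcup_i C i);
  q_basis_layer : forall i, basis_mod (Hs i) (Hs i.+1) (C i)
}.

(* [le] is the reflexive order; its values outside [\bigcup_i C i] are
   irrelevant. *)
Record canonical_order (H : eqType) (C : nat -> set H) (le : rel H) : Prop :=
  CanonicalOrder {
  canonical_layer : forall i, wo_chain le [in C i];
  canonical_across : forall i j u v, C i u -> C j v -> i != j ->
    le u v = (j < i)%N
}.

Definition standard_monomial (L : eqType) (B : set L) (le : rel L)
  (w : seq L) : Prop := {subset w <= B} /\ sorted le w.

(* [S] is a crossed product [R * U(L)], with [R] and [L] embedded in [S] by
   [iota] and [bar].  In [cp_mul], bilinearity of [delta] over [k] says both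
   that [delta x] is [k]-linear and that [delta] is linear in [x]. *)
Record crossed_product (k : fieldType) (L : lmodType k)
    (br : {bilinear L -> L -> L}) (R S : algType k)
    (iota : {lrmorphism R -> S}) (bar : {linear L -> S}) : Prop :=
  CrossedProduct {
  cp_iota_inj : injective iota;
  cp_bar_inj : injective bar;
  cp_basis : exists (B : set L) (le : rel L),
    [/\ basis_mod setT [set 0] B,
        {in B & &, transitive le}, {in B &, antisymmetric le},
        {in B &, total le}
      & let mon (w : seq L) := \prod_(x <- w) bar x in
        (forall y : S, exists (ws : seq (seq L)) (r : seq L -> R),
           (forall w, w \in ws -> standard_monomial B le w) /\
           y = \sum_(w <- ws) iota (r w) * mon w) /\
        (forall (ws : seq (seq L)) (r : seq L -> R), uniq ws ->
           (forall w, w \in ws -> standard_monomial B le w) ->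
           \sum_(w <- ws) iota (r w) * mon w = 0 ->
           {in ws, forall w, r w = 0})];
  cp_mul : exists (delta : {bilinear L -> R -> R})
                  (t : {bilinear L -> L -> R}),
    [/\ forall x a b, delta x (a * b) = delta x a * b + a * delta x b,
        forall x y, t x y = - t y x,
        forall x a, bar x * iota a = iota a * bar x + iota (delta x a)
      & forall x y, bar x * bar y - bar y * bar x
                    = bar (br x y) + iota (t x y)]
}.

(* The subring [R * U(N)] of [R * U(L)]. *)
Definition cp_sub (k : fieldType) (L : lmodType k) (R S : algType k)
    (iota : {lrmorphism R -> S}) (bar : {linear L -> S}) (N : set L) : set S :=
  smallest (fun A : set S => subring_closed [in A])
           (range iota `|` bar @` N).

Definition inner_der (T : nzRingType) (x f : T) : T := x * f - f * x.

Definition order_ge (T : nzRingType) (c : T -> int -> T) (f : T) (l : int) :=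
  forall n : int, n < l -> c f n = 0.

(* Inside a ring [T], the subring [A'] is the ring of Laurent series
   [A((z; delta))] in [z = u^-1], where [delta a = u a - a u].  A series
   [f = \sum_(n >= l) a_n z^n] is encoded by its coefficients [c f n = a_n].
   By [laurent_order_mul], products of series can be computed from finite
   truncations, so that the multiplication of [A'] is determined by that of
   [A] and the commutation rule [laurent_commute], which is
   $z a = \sum_{i \ge 1} (-1)^{i-1} \delta^{i-1}(a) z^i$. *)
Record laurent_ring (T : nzRingType) (A A' : set T) (u z : T)
    (c : T -> int -> T) : Prop := LaurentRing {
  laurent_subring : subring_closed [in A'];
  laurent_sub : A `<=` A';
  laurent_inv : [/\ A' u, A' z, u * z = 1 & z * u = 1];
  laurent_der : forall a, A a -> A (inner_der u a);
  laurent_coef : forall f, A' f ->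
    (forall n, A (c f n)) /\ exists l, order_ge c f l;
  laurent_series : forall a : int -> T, (forall n, A (a n)) ->
    (exists l : int, forall n, n < l -> a n = 0) ->
    exists! f, A' f /\ c f =1 a;
  laurent_add : forall f g, A' f -> A' g ->
    forall n, c (f + g) n = c f n + c g n;
  laurent_monomial : forall a (m : nat), A a ->
    (forall n, c (a * z ^+ m) n = if n == m%:Z then a else 0) /\
    (forall n, c (a * u ^+ m) n = if n == - m%:Z then a else 0);
  laurent_commute : forall a, A a ->
    order_ge c (z * a) 1 /\
    (forall i : nat,
       c (z * a) i.+1%:Z = (-1) ^+ i * iter i (inner_der u) a);
  laurent_order_mul : forall f g l m, A' f -> A' g ->
    order_ge c f l -> order_ge c g m -> order_ge c (f * g) (l + m)
}.

(* [F v] is the stage obtained by adjoining the variable attached to [v], that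
   is $R((N_{\gamma+1}))$ for $v = u_\gamma$.  The union over the [v] below
   [u = u_beta], together with the base ring [A], is $R((N_\beta))$ in all
   three cases of the recursion, beta zero, successor or limit, since the
   stages form an increasing chain. *)
Definition stage_below (T : Type) (L : eqType) (A : set T) (B : set L)
    (le : rel L) (F : L -> set T) (u : L) : set T :=
  A `|` \bigcup_(v in [set v | [/\ B v, v != u & le v u]]) F v.

Definition stage_top (T : Type) (L : Type) (A : set T) (B : set L)
  (F : L -> set T) : set T := A `|` \bigcup_(v in B) F v.

(* The tower of stages of the series ring [A((L))], all realized inside one
   ring [T] in which [bar : L -> T] extends the embedding of the Lie algebra;
   [B] is the set of representatives of the well-ordered basis and [c u] gives
   the coefficients with respect to the variable attached to [u].  The
   derivations [delta_x] of the stages are those induced by the elements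
   [bar x].  As [delta_x] is additive and preserves the order of series, it
   acts termwise; its value at the variable is then forced by
   [laurent_inv]. *)
Record series_tower (T : nzRingType) (L : eqType) (A : set T) (B : set L)
    (le : rel L) (bar : L -> T) (F : L -> set T) (c : L -> T -> int -> T) :
    Prop := SeriesTower {
  tower_base : subring_closed [in A];
  tower_base_der : forall x a, A a -> A (inner_der (bar x) a);
  tower_step : forall u, B u -> exists z,
    laurent_ring (stage_below A B le F u) (F u) (bar u) z (c u);
  tower_der : forall x u f, B u -> F u f -> F u (inner_der (bar x) f);
  tower_der_order : forall x u f l, B u -> F u f ->
    order_ge (c u) f l -> order_ge (c u) (inner_der (bar x) f) l
}.

(* [T], with the map [phi : S -> T], is the series ring [R((H))] of the crossed
   product [S = R * U(H)].  Each $R_m((H/H_m))$ is realized as a subring of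
   [T]: its base ring is the image of [R_m = R * U(Hs m)], and its stages are
   the [F m u], for [u] in the [C i] with [i < m].  As the coefficient maps [c]
   do not depend on [m], the inclusions [series_incl] are the coefficientwise
   maps $R_m((H/H_m)) \hookrightarrow R_n((H/H_n))$, and the direct limit is
   the union of these subrings.  Injectivity of [phi] is not required. *)
Record series_data (k : fieldType) (H : lmodType k) (Hs C : nat -> set H)
    (le : rel H) (R S : algType k) (iota : {lrmorphism R -> S})
    (bar : {linear H -> S}) (T : nzRingType) (phi : {rmorphism S -> T})
    (F : nat -> H -> set T) (c : H -> T -> int -> T) : Prop := SeriesData {
  series_towers : forall m,
    series_tower (phi @` cp_sub iota bar (Hs m)) (\bigcup_(i < m) C i) le
      (phi \o bar) (F m) c;
  series_incl : forall m n u, (m <= n)%N -> (\bigcup_(i < m) C i) u ->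
    F m u `<=` F n u;
  series_limit : forall f : T, exists m,
    stage_top (phi @` cp_sub iota bar (Hs m)) (\bigcup_(i < m) C i) (F m) f
}.

Definition is_series_ring (k : fieldType) (H : lmodType k)
    (Hs C : nat -> set H) (le : rel H) (R S : algType k)
    (iota : {lrmorphism R -> S}) (bar : {linear H -> S}) (T : nzRingType)
    (phi : {rmorphism S -> T}) : Prop :=
  exists (F : nat -> H -> set T) (c : H -> T -> int -> T),
    series_data Hs C le iota bar phi F c.

(* Main.v *)
Require Import Defs.
From HB Require Import structures.
From mathcomp Require Import all_boot all_order all_algebra.
From mathcomp Require Import boolp classical_sets wochoice functions.
From mathcomp Require Import zify.
Set Implicit Arguments.
Unset Strict Implicit.
Unset Printing Implicit Defensive.
Import Order.TTheory GRing.Theory Num.Theory.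
Local Open Scope classical_set_scope.
Local Open Scope ring_scope.

(** For [n] large, a nonzero element of $R_m = K * U(H_m)$ is a polynomial over
    [K] in finitely many letters of the Q-basis which are all variables of
    $R_n((H/H_n))$.  Its leading coefficient in the largest of these letters is
    a nonzero polynomial in smaller letters, invertible by induction, and a
    Laurent series with left invertible leading coefficient is left invertible.
    The same argument, along the well-ordering of the variables, inverts every
    series of a stage, at the price of enlarging [n]: this is why the direct
    limit is a division ring although the rings $R_m((H/H_m))$ need not be.

    For existence, $R_m((H/H_m))$ lives on formal series in all the variables,
    that is, on functions of the exponents.  Its product and the action of [H]
    are obtained by Zorn's lemma among the initial segments of the variables;
    one more variable is adjoined by a Laurent series ring, to which derivations
    extend because series are determined by their monomials.  The universal
    property of the crossed product, a consequence of the rewriting of words in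
    standard form, maps [K * U(H)] to each of these rings.  The direct limit is
    the ring of germs at infinity of sequences in the product of the
    $R_n((H/H_n))$: the connecting maps are replaced by the sequences of images
    of the elements of $R_m((H/H_m))$, singled out by induction on the stages. *)

(** * Series and continuous additive maps *)

(** Only left inverses are built: once every nonzero element has one, they are two-sided, and [phi]
    is injective because the image of a nonzero element has a left inverse. The inversion arguments
    use the axioms of [laurent_ring] alone, since they must apply to every realization of the series
    ring; they are used again in the construction, to see that the connecting maps are injective.

    The obstacle in the construction is that a Laurent series ring is formed over a ring type,
    whereas Zorn's lemma compares towers inside one fixed type. Operations are therefore kept as
    functions on formal series, meaningful only on the stages; they are turned into a ring type to
    adjoin a variable, and once more at the end.

    The elements [bar x] are not closed under commutators, because of [t]. The Lie algebra that acts
    on the stages is $H\oplus K$, embedded in the crossed product, so that its axioms come from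
    commutators.

    The rings attached to different levels [n] are chosen independently of each other. Only the maps
    from the crossed product relate them, which is why elements of the limit are tracked as whole
    sequences. *)

Section IntSums.
Variable V : zmodType.

(** A sum over a window of exponents. By [isum_eq] its value does not depend on the window as soon
    as the support is covered, which replaces sums over all integers. *)
Definition isum (F : int -> V) (l : int) (N : nat) := \sum_(k < N) F (l + k%:Z).

Lemma isum_sub F (L : int) (M : nat) (l : int) (N : nat) : L <= l -> l + N%:Z <= L + M%:Z ->
    (forall n : int, n < l -> F n = 0) -> (forall n : int, l + N%:Z <= n -> F n = 0) ->
  isum F L M = isum F l N.
Proof.
move=> Ll lM F0 F1; rewrite /isum.
rewrite -(big_mkord xpredT (fun k => F (L + k%:Z))).
rewrite -(big_mkord xpredT (fun k => F (l + k%:Z))).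
pose a := `|l - L|%N.
rewrite (big_cat_nat (n := a)) /=; [|by []|by rewrite /a; lia].
rewrite (big_cat_nat (m := a) (n := (a + N)%N)) /=; [|by rewrite leq_addr|by rewrite /a; lia].
rewrite big_nat big1 ?add0r; last by move=> k /andP[_ ka]; apply: F0; rewrite /a in ka; lia.
rewrite [X in _ + X]big_nat [X in _ + X]big1 ?addr0; last first.
  by move=> k /andP[ka _]; apply: F1; rewrite /a in ka; lia.
rewrite -{1}(add0n a) big_addn addKn; apply: eq_bigr => k _; congr F; rewrite /a; lia.
Qed.

Lemma isum_eq F (l : int) (N : nat) (l' : int) (N' : nat) :
    (forall n : int, n < l -> F n = 0) -> (forall n : int, l + N%:Z <= n -> F n = 0) ->
    (forall n : int, n < l' -> F n = 0) -> (forall n : int, l' + N'%:Z <= n -> F n = 0) ->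
  isum F l N = isum F l' N'.
Proof.
move=> Fl FN Fl' FN'; pose L := Num.min l l'; pose M := (`|l - L| + N + `|l' - L| + N')%N.
have LL : L <= l by rewrite /L; lia.
have LL' : L <= l' by rewrite /L; lia.
rewrite -(@isum_sub F L M l) //; last by rewrite /M; lia.
by rewrite -(@isum_sub F L M l') //; rewrite /M; lia.
Qed.

End IntSums.

Definition bounded_below (R : zmodType) (f : int -> R) :=
  exists l : int, forall n : int, n < l -> f n = 0.

Definition bounded_below_pred (R : zmodType) : {pred int -> R} :=
  fun f => `[< bounded_below f >].

Lemma bounded_below_zmod_closed (R : zmodType) : zmod_closed (@bounded_below_pred R).
Proof.
split=> [|f g /asboolP[l fl] /asboolP[m gm]]; first by apply/asboolP; exists 0.
apply/asboolP; exists (Num.min l m) => n nlm.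
by have -> : (f - g) n = f n - g n by []; rewrite fl ?gm ?subr0 //; lia.
Qed.
HB.instance Definition _ (R : zmodType) :=
  GRing.isZmodClosed.Build (int -> R) (@bounded_below_pred R)
    (@bounded_below_zmod_closed R).

Record series (R : zmodType) := Series {
  coef :> int -> R; coefP : coef \in @bounded_below_pred R }.
HB.instance Definition _ (R : zmodType) := [isSub for @coef R].
HB.instance Definition _ (R : zmodType) := [Choice of series R by <:].
HB.instance Definition _ (R : zmodType) :=
  [SubChoice_isSubZmodule of series R by <:].

Section Series.
Variable R : zmodType.
Implicit Types f g : series R.

Definition ord_ge f (l : int) := forall n : int, n < l -> f n = 0.

Lemma series_bound f : exists l, ord_ge f l.
Proof. exact/asboolP/(coefP f). Qed.

Lemma seriesP f g : f =1 g -> f = g.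
Proof. by move=> fg; apply/val_inj/funext. Qed.

Lemma series0E n : (0 : series R) n = 0.
Proof. by have := raddf0 (val : series R -> int -> R); move=> /(congr1 (fun h => h n)). Qed.

Lemma seriesDE f g n : (f + g) n = f n + g n.
Proof. by have := raddfD (val : series R -> int -> R) f g; move=> /(congr1 (fun h => h n)). Qed.

Lemma seriesNE f n : (- f) n = - f n.
Proof. by have := raddfN (val : series R -> int -> R) f; move=> /(congr1 (fun h => h n)). Qed.

Lemma seriesBE f g n : (f - g) n = f n - g n.
Proof. by rewrite seriesDE seriesNE. Qed.

Lemma series_sumE I (r : seq I) (F : I -> series R) n :
  (\sum_(i <- r) F i) n = \sum_(i <- r) F i n.
Proof.
elim: r => [|i r IHr]; first by rewrite !big_nil series0E.
by rewrite !big_cons seriesDE IHr.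
Qed.

Lemma ord_geW f (l m : int) : m <= l -> ord_ge f l -> ord_ge f m.
Proof. by move=> ml fl n nm; apply: fl; lia. Qed.

Lemma ord_ge0 l : ord_ge 0 l. Proof. by move=> n _; rewrite series0E. Qed.

Lemma ord_geD f g l : ord_ge f l -> ord_ge g l -> ord_ge (f + g) l.
Proof. by move=> fl gl n nl; rewrite seriesDE fl ?gl ?addr0. Qed.

Lemma ord_geB f g l : ord_ge f l -> ord_ge g l -> ord_ge (f - g) l.
Proof. by move=> fl gl n nl; rewrite seriesBE fl ?gl ?subr0. Qed.

Lemma mon_subproof (n : int) (a : R) :
  (fun m => if m == n then a else 0) \in @bounded_below_pred R.
Proof. by apply/asboolP; exists n => m mn; case: eqP => // e; lia. Qed.
Definition mon n a := Series (mon_subproof n a).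

Lemma monE n a m : mon n a m = if m == n then a else 0. Proof. by []. Qed.

Lemma monB n a b : mon n (a - b) = mon n a - mon n b.
Proof.
by apply: seriesP => m; rewrite seriesBE !monE; case: eqP => _; rewrite ?subr0.
Qed.

Lemma mon0 n : mon n 0 = 0.
Proof. by apply: seriesP => m; rewrite series0E monE; case: eqP. Qed.

Lemma monD n a b : mon n (a + b) = mon n a + mon n b.
Proof.
by apply: seriesP => m; rewrite seriesDE !monE; case: eqP => _; rewrite ?addr0.
Qed.

Lemma ord_ge_mon n a : ord_ge (mon n a) n.
Proof. by move=> m mn; rewrite monE; case: eqP => // e; lia. Qed.

Definition trunc f (l : int) (N : nat) := \sum_(k < N) mon (l + k%:Z) (f (l + k%:Z)).

Lemma truncE f (l : int) (N : nat) (n : int) : trunc f l N n = if l <= n < l + N%:Z then f n else 0.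
Proof.
rewrite series_sumE; case: ifP => [ln|nl].
  have lt : (`|n - l| < N)%N by lia.
  have e : l + `|n - l|%:Z = n by lia.
  rewrite (bigD1 (Ordinal lt)) // monE [l + _]e eqxx big1; first exact: addr0.
  move=> k kn; have {}kn : (k : nat) != `|n - l|%N by []; rewrite monE; case: eqP => // e'; lia.
by rewrite big1 // => k _; rewrite monE; case: eqP => // e; have := ltn_ord k; lia.
Qed.

Lemma ord_ge_trunc f (l : int) (N : nat) : ord_ge f l -> ord_ge (f - trunc f l N) (l + N%:Z).
Proof.
move=> fl n nN; rewrite seriesBE truncE; case: ifP => [_|]; first exact: subrr.
by move=> e; rewrite fl ?subr0 //; lia.
Qed.

End Series.

Section Density.
Variables R R' : zmodType.

(** Additivity, stated with differences, and a uniform form of continuity for the topology of the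
    order: one shift [c] serves all series. *)
Definition continuous_map (F : series R -> series R') (c : int) :=
  (forall f g, F (f - g) = F f - F g) /\
  (forall f l, ord_ge f l -> ord_ge (F f) (l + c)).

Section Additivity.
Variable (F : series R -> series R').
Hypothesis FB : forall f g, F (f - g) = F f - F g.

Lemma sub_map0 : F 0 = 0.
Proof. by rewrite -(subrr 0) FB subrr. Qed.
Lemma sub_mapN f : F (- f) = - F f.
Proof. by rewrite -[in LHS](sub0r f) FB sub_map0 sub0r. Qed.
Lemma sub_mapD f g : F (f + g) = F f + F g.
Proof. by rewrite -{1}(opprK g) FB sub_mapN opprK. Qed.
Lemma sub_map_sum I (r : seq I) (G : I -> series R) :
  F (\sum_(i <- r) G i) = \sum_(i <- r) F (G i).
Proof. exact: (big_morph F sub_mapD sub_map0). Qed.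
End Additivity.

(** For the coefficient of degree [m] of [F f], truncate [f] so far that [F] sends the remainder to
    order above [m]; the truncation is a finite sum of monomials. *)
Lemma density F c : continuous_map F c -> (forall n a, F (mon n a) = 0) ->
  forall f, F f = 0.
Proof.
move=> [FB Fc] F0 f; apply: seriesP => m; rewrite series0E.
have [l fl] := series_bound f; pose N := (absz (m - c - l)%R).+1.
rewrite -(subrK (trunc f l N) f) (sub_mapD FB) seriesDE.
rewrite (Fc _ _ (ord_ge_trunc (N := N) fl)); last by rewrite /N; lia.
by rewrite (sub_map_sum FB) big1 ?series0E ?addr0.
Qed.

Lemma density_eq F G c : continuous_map F c -> continuous_map G c ->
  (forall n a, F (mon n a) = G (mon n a)) -> F =1 G.
Proof.
move=> [FB Fc] [GB Gc] FG f; apply/eqP; rewrite -subr_eq0; apply/eqP.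
apply: (@density (fun f => F f - G f) c) => [|n a]; last by rewrite FG subrr.
split=> [g h|g l gl]; last exact: ord_geB (Fc _ _ gl) (Gc _ _ gl).
by rewrite FB GB !opprD !opprK addrACA.
Qed.

(** The sum of the [phi n (f n)] converges, since only finitely many [n] contribute to a given
    degree. The shift is quantified inside the conclusion, so that one and the same [F] satisfies
    every estimate satisfied by [phi]. *)
Lemma continuous_ext (phi : int -> R -> series R') :
    (forall n a b, phi n (a - b) = phi n a - phi n b) ->
    (exists c : int, forall n a, ord_ge (phi n a) (n + c)) ->
  exists F : series R -> series R',
    [/\ forall f g, F (f - g) = F f - F g,
        forall c : int, (forall n a, ord_ge (phi n a) (n + c)) -> continuous_map F c
      & forall n a, F (mon n a) = phi n a].
Proof.
move=> phiB [c phic].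
have phi0 n : phi n 0 = 0 by rewrite -(subrr 0) phiB subrr.
pose lb f := sval (cid (series_bound (R := R) f)).
have lbP f : ord_ge f (lb f) by rewrite /lb; case: cid.
pose T (f : series R) (m n : int) := phi n (f n) m.
have Tlow f m (l : int) : ord_ge f l -> forall n : int, n < l -> T f m n = 0.
  by move=> fl n nl; rewrite /T fl // phi0 series0E.
have Tup f (m n : int) : m - c < n -> T f m n = 0 by move=> mn; apply: phic; lia.
pose v (f : series R) (m : int) := isum (T f m) (lb f) (absz (m - c - lb f)%R).+1.
(* Terms below the order of [f] vanish, and so do those beyond [m - c]: any window covering this
   interval gives the same coefficient. *)
have vE f (m l : int) (N : nat) : ord_ge f l -> m - c < l + N%:Z -> v f m = isum (T f m) l N.
  move=> fl lN; apply: isum_eq; [exact: Tlow|move=> n ?; apply: Tup; lia|exact: Tlow|].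
  by move=> n ?; apply: Tup; lia.
have vbd f : v f \in @bounded_below_pred R'.
  apply/asboolP; exists (lb f + c) => m mlt.
  by rewrite (vE f m (lb f) 0%N) // /isum ?big_ord0 //; lia.
pose F f := Series (vbd f).
have FB f g : F (f - g) = F f - F g.
  apply: seriesP => m; rewrite seriesBE /=.
  pose l := Num.min (lb f) (lb g); pose N := (absz (m - c - l)%R).+1.
  have fl : ord_ge f l by apply: ord_geW (lbP f); rewrite /l; lia.
  have gl : ord_ge g l by apply: ord_geW (lbP g); rewrite /l; lia.
  rewrite (vE f m l N) ?(vE g m l N) ?(vE (f - g) m l N) ?/N //; try lia.
    by rewrite /isum -sumrB; apply: eq_bigr => k _; rewrite /T seriesBE phiB seriesBE.
  exact: ord_geB.
exists F; split=> // [c' phic'|n a].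
  split=> // f l fl m mlt /=.
  rewrite (vE f m l (absz (m - c - l)%R).+1) //; last by lia.
  rewrite /isum big1 // => k _; apply: phic'; lia.
apply: seriesP => m /=.
rewrite (vE _ m n (absz (m - c - n)%R).+1) //; [|exact: ord_ge_mon|lia].
rewrite /isum big_ord_recl big1 ?addr0; first by rewrite /T monE ?addr0 eqxx.
by move=> k _; rewrite /T monE ifF ?phi0 ?series0E // lift0; lia.
Qed.

End Density.

(** * Twisted Laurent series rings *)

Record derivation (R : nzRingType) := Derivation {
  der :> R -> R;
  derB : forall a b, der (a - b) = der a - der b;
  derM : forall a b, der (a * b) = der a * b + a * der b }.

Section DerivationTheory.
Variables (R : nzRingType) (d : derivation R).

Lemma der0 : d 0 = 0. Proof. by rewrite -(subrr (0 : R)) derB !subrr. Qed.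
Lemma derN a : d (- a) = - d a.
Proof. by rewrite -[in LHS](sub0r a) derB der0 sub0r. Qed.
Lemma derD a b : d (a + b) = d a + d b.
Proof. by rewrite -{1}(opprK b) derB derN opprK. Qed.
Lemma der1 : d 1 = 0.
Proof.
have /eqP := derM d 1 1; rewrite !mulr1 mul1r -[X in X == _]addr0.
by rewrite (inj_eq (addrI _)) => /eqP.
Qed.

End DerivationTheory.

Section LaurentMul.
Variables (R : nzRingType) (d : derivation R).
Implicit Types (f g h : series R) (a b : R).

Lemma scale_subproof a f : (fun n => a * f n) \in @bounded_below_pred R.
Proof.
have [l fl] := series_bound f.
by apply/asboolP; exists l => n nl; rewrite fl ?mulr0.
Qed.
Definition scale a f := Series (scale_subproof a f).
Lemma scaleE a f n : scale a f n = a * f n. Proof. by []. Qed.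

Lemma scaleB a f g : scale a (f - g) = scale a f - scale a g.
Proof. by apply: seriesP => n; rewrite seriesBE !scaleE seriesBE mulrBr. Qed.
Lemma scaleBl a b f : scale (a - b) f = scale a f - scale b f.
Proof. by apply: seriesP => n; rewrite seriesBE !scaleE mulrBl. Qed.
Lemma scaleA a b f : scale a (scale b f) = scale (a * b) f.
Proof. by apply: seriesP => n /=; rewrite mulrA. Qed.
Lemma scale1 f : scale 1 f = f.
Proof. by apply: seriesP => n /=; rewrite mul1r. Qed.
Lemma scale_mon a n b : scale a (mon n b) = mon n (a * b).
Proof. by apply: seriesP => m /=; case: eqP; rewrite ?mulr0. Qed.
Lemma ord_ge_scale a f l : ord_ge f l -> ord_ge (scale a f) l.
Proof. by move=> fl n nl; rewrite scaleE fl ?mulr0. Qed.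

Lemma lmul_var_subproof f :
  (fun n => f (n + 1) + d (f n)) \in @bounded_below_pred R.
Proof.
have [l fl] := series_bound f.
by apply/asboolP; exists (l - 1) => n nl; rewrite !fl ?der0 ?addr0 //; lia.
Qed.
(* left multiplication by $u = z^{-1}$, from $u a = a u + d a$ *)
Definition lmul_var f := Series (lmul_var_subproof f).
Local Notation U := lmul_var.
Lemma lmul_varE f n : U f n = f (n + 1) + d (f n). Proof. by []. Qed.

Lemma lmul_varB f g : U (f - g) = U f - U g.
Proof.
by apply: seriesP => n; rewrite seriesBE !lmul_varE !seriesBE derB opprD addrACA.
Qed.
Lemma ord_ge_lmul_var f l : ord_ge f l -> ord_ge (U f) (l - 1).
Proof. by move=> fl n nl; rewrite lmul_varE !fl ?der0 ?addr0 //; lia. Qed.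
Lemma lmul_var_mon n a : U (mon n a) = mon (n - 1) a + mon n (d a).
Proof.
apply: seriesP => m; rewrite seriesDE lmul_varE !monE; congr (_ + _).
  by have -> : (m + 1 == n) = (m == n - 1) by apply/eqP/eqP; lia.
by case: eqP => _; rewrite ?der0.
Qed.
Lemma lmul_var_scale a f : U (scale a f) = scale a (U f) + scale (d a) f.
Proof.
apply: seriesP => n; rewrite seriesDE !(scaleE, lmul_varE) derM mulrDr -!addrA; congr (_ + _).
by rewrite addrC.
Qed.
(** If [U f = 0] then [f n = - d (f (n - 1))]: starting below the order of [f], each vanishing
    coefficient forces the next one to vanish. *)
Lemma lmul_var_inj f g : U f = U g -> f = g.
Proof.
move=> /eqP; rewrite -subr_eq0 -lmul_varB => /eqP Ufg; apply/eqP.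
rewrite -subr_eq0; apply/eqP; move: (f - g) Ufg => {f g} f Uf.
have [l fl] := series_bound f.
suff fk k : ord_ge f (l + k%:Z).
  by apply: seriesP => n; rewrite series0E (fk (absz (n - l)%R).+1) //; lia.
elim: k => [|k IHk]; first by rewrite addr0.
move=> n nk; have [|nk'] := ltP n (l + k%:Z); first exact: IHk.
have := congr1 (fun h : series R => h (n - 1)) Uf; rewrite series0E lmul_varE subrK.
by rewrite (IHk (n - 1)) ?der0 ?addr0 //; lia.
Qed.

(** The coefficients of $z a z^n$, from the commutation rule $z
    a=\sum_{i\ge1}(-1)^{i-1}\delta^{i-1}(a)z^i$. *)
Lemma inv_var_subproof (n : int) a :
  (fun m : int => if n + 1 <= m then
     (-1) ^+ (absz (m - n - 1)%R) * iter (absz (m - n - 1)%R) d a else 0)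
   \in @bounded_below_pred R.
Proof. by apply/asboolP; exists (n + 1) => m mn; rewrite ifF //; lia. Qed.

(** Left multiplication by $z$ is extended from monomials; by density, that [U] undoes it is checked
    on monomials, where the terms telescope. *)
Lemma lmul_inv_exists : exists Z : series R -> series R,
  continuous_map Z 1 /\ forall f, U (Z f) = f.
Proof.
pose ser n a := Series (inv_var_subproof n a).
have serB n a b : ser n (a - b) = ser n a - ser n b.
  apply: seriesP => m; rewrite seriesBE /ser [LHS]/= [X in _ = X - _]/= [X in _ = _ - X]/=.
  case: ifP => _; rewrite ?subr0 //.
  rewrite -mulrBr; congr (_ * _).
  by elim: (absz _) => //= i ->; rewrite derB.
have sero n a : ord_ge (ser n a) (n + 1) by move=> m mn /=; rewrite ifF //; lia.
have [Z [ZB Zc ZM]] := continuous_ext serB (ex_intro _ 1 sero).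
have {}Zc := Zc 1 sero; exists Z; split=> // f.
apply/eqP; rewrite -subr_eq0; apply/eqP; move: f.
apply: (@density _ _ (fun f => U (Z f) - f) 0) => [|n a].
  split=> [f g|f l fl].
    by rewrite ZB lmul_varB !opprD !opprK addrACA.
  apply: ord_geB; last by rewrite addr0.
  have := ord_ge_lmul_var (Zc.2 _ _ fl); apply: ord_geW; lia.
apply/eqP; rewrite subr_eq0 ZM; apply/eqP/seriesP => m /=.
case: ifP => nm; last first.
  by rewrite ifF ?der0 ?add0r //; [case: eqP => // e; lia|lia].
case: eqP => [->|mn].
  have -> : n + 1 - n - 1 = 0 by lia.
  by rewrite expr0 mul1r ifF ?der0 ?addr0 //; lia.
rewrite ifT; last by lia.
have -> : absz (m + 1 - n - 1)%R = (absz (m - n - 1)%R).+1 by lia.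
rewrite exprS mulN1r mulNr /=; move: (absz _) => i.
rewrite -signr_odd; case: (odd i); rewrite ?(mulN1r, mul1r, expr1, expr0) ?derN.
  by rewrite opprK subrr.
by rewrite addNr.
Qed.

Definition lmul_inv := sval (cid lmul_inv_exists).
Local Notation Z := lmul_inv.

Lemma lmul_inv_continuous : continuous_map Z 1.
Proof. by rewrite /Z; case: cid => ? []. Qed.
Lemma lmul_invK f : U (Z f) = f.
Proof. by rewrite /Z; case: cid => ? []. Qed.
(** Left multiplication by $z^n$; [Negz i] is the exponent $-(i+1)$. *)
Definition lmul_pow (n : int) : series R -> series R :=
  match n with Posz i => iter i Z | Negz i => iter i.+1 U end.

Lemma lmul_powB n f g : lmul_pow n (f - g) = lmul_pow n f - lmul_pow n g.
Proof.
case: n => i; rewrite /lmul_pow.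
  by elim: i => //= i ->; rewrite lmul_inv_continuous.1.
by elim: i.+1 => //= {}i ->; rewrite lmul_varB.
Qed.
Lemma ord_ge_lmul_pow n f l : ord_ge f l -> ord_ge (lmul_pow n f) (l + n).
Proof.
move=> fl; case: n => i; rewrite /lmul_pow.
  elim: i => [|i IHi]; first by rewrite addr0.
  by rewrite iterS; apply: ord_geW (lmul_inv_continuous.2 _ _ IHi); lia.
rewrite NegzE; elim: i.+1 => [|{}i IHi]; first by rewrite addr0.
by rewrite iterS; apply: ord_geW (ord_ge_lmul_var IHi); lia.
Qed.
Lemma lmul_var_pow n f : U (lmul_pow n f) = lmul_pow (n - 1) f.
Proof.
case: n => [[|i]|i]; first by [].
  by rewrite (_ : Posz i.+1 - 1 = i) ?[lmul_pow i.+1 f]iterS ?lmul_invK //; lia.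
by rewrite (_ : Negz i - 1 = Negz i.+1) // !NegzE; lia.
Qed.
Lemma lmul_pow_mon1 n m : lmul_pow n (mon m 1) = mon (m + n) 1.
Proof.
have U1 m' : U (mon m' 1) = mon (m' - 1) 1 by rewrite lmul_var_mon der1 mon0 addr0.
case: n => i; rewrite /lmul_pow.
  elim: i => [|i IHi]; first by rewrite addr0.
  rewrite iterS IHi; apply: lmul_var_inj; rewrite lmul_invK U1; congr mon; lia.
rewrite NegzE; elim: i.+1 => [|{}i IHi]; first by rewrite addr0.
rewrite iterS IHi U1; congr mon; lia.
Qed.

(** For fixed [g], the product is the continuous additive extension of $a z^n\mapsto a(z^n g)$ in
    its left factor. The ring axioms are then checked on left factors that are monomials. *)
Lemma laurent_mul_exists g : exists F : series R -> series R,
  [/\ forall f f', F (f - f') = F f - F f',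
      forall f l m, ord_ge f l -> ord_ge g m -> ord_ge (F f) (l + m)
    & forall n a, F (mon n a) = scale a (lmul_pow n g)].
Proof.
have phiB n a b : scale (a - b) (lmul_pow n g) =
    scale a (lmul_pow n g) - scale b (lmul_pow n g) by rewrite scaleBl.
have phic m : ord_ge g m -> forall n a, ord_ge (scale a (lmul_pow n g)) (n + m).
  by move=> gm n a; rewrite addrC; apply/ord_ge_scale/ord_ge_lmul_pow.
have [c gc] := series_bound g.
have [F [FB Fc FM]] := continuous_ext phiB (ex_intro _ c (phic c gc)).
by exists F; split=> // f l m fl gm; apply: (Fc m (phic m gm)).2.
Qed.

Definition laurent_mul f g := sval (cid (laurent_mul_exists g)) f.
Local Notation "f ** g" := (laurent_mul f g) (at level 40, left associativity).

Lemma laurent_mulBl f f' g : (f - f') ** g = f ** g - f' ** g.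
Proof. by rewrite /laurent_mul; case: cid => ? []. Qed.
Lemma ord_ge_laurent_mul f g l m :
  ord_ge f l -> ord_ge g m -> ord_ge (f ** g) (l + m).
Proof. by rewrite /laurent_mul; case: cid => F [? H ?] /=; apply: H. Qed.
Lemma mon_laurent_mul n a g : mon n a ** g = scale a (lmul_pow n g).
Proof. by rewrite /laurent_mul; case: cid => ? []. Qed.

Lemma laurent_mull_continuous g c :
  ord_ge g c -> continuous_map (fun f => f ** g) c.
Proof.
by split=> [f f'|f l fl]; [exact: laurent_mulBl|exact: ord_ge_laurent_mul].
Qed.
Lemma laurent_mulBr f g g' : f ** (g - g') = f ** g - f ** g'.
Proof.
have [c gc] := series_bound g; have [c' gc'] := series_bound g'.
pose m := Num.min c c'.
have gm : ord_ge g m by apply: ord_geW gc; rewrite /m; lia.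
have gm' : ord_ge g' m by apply: ord_geW gc'; rewrite /m; lia.
move: f; apply: (@density_eq _ _ _ _ m); first exact/laurent_mull_continuous/ord_geB.
  split=> [f f'|f l fl]; last by apply: ord_geB; apply: ord_ge_laurent_mul.
  by rewrite !laurent_mulBl !opprD !opprK addrACA.
by move=> n a; rewrite !mon_laurent_mul lmul_powB scaleB.
Qed.
Lemma laurent_mulr_continuous f c :
  ord_ge f c -> continuous_map (laurent_mul f) c.
Proof.
split=> [g g'|g l gl]; first exact: laurent_mulBr.
by rewrite addrC; apply: ord_ge_laurent_mul.
Qed.
Lemma laurent_mul1 : right_id (mon 0 1) laurent_mul.
Proof.
apply: (@density_eq _ _ _ _ 0); first by apply/laurent_mull_continuous/ord_ge_mon.
  by split=> // f l; rewrite addr0.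
by move=> n a; rewrite mon_laurent_mul lmul_pow_mon1 add0r scale_mon mulr1.
Qed.
Lemma laurent_1mul : left_id (mon 0 1) laurent_mul.
Proof. by move=> f; rewrite mon_laurent_mul scale1. Qed.

Lemma scale_laurent_mul a g h : scale a g ** h = scale a (g ** h).
Proof.
have [c hc] := series_bound h.
have hC := laurent_mull_continuous hc.
move: g; apply: (@density_eq _ _ _ _ c).
- split=> [f g|f l fl]; first by rewrite scaleB laurent_mulBl.
  by apply: hC.2; apply: ord_ge_scale.
- split=> [f g|f l fl]; first by rewrite laurent_mulBl scaleB.
  by apply/ord_ge_scale/hC.2.
- by move=> n b; rewrite scale_mon !mon_laurent_mul scaleA.
Qed.
Lemma lmul_var_laurent_mul g h : U g ** h = U (g ** h).
Proof.
have [c hc] := series_bound h.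
have hC := laurent_mull_continuous hc.
move: g; apply: (@density_eq _ _ _ _ (c - 1)).
- split=> [f g|f l fl]; first by rewrite lmul_varB laurent_mulBl.
  by apply: ord_geW (hC.2 _ _ (ord_ge_lmul_var fl)); lia.
- split=> [f g|f l fl]; first by rewrite laurent_mulBl lmul_varB.
  by apply: ord_geW (ord_ge_lmul_var (hC.2 _ _ fl)); lia.
- move=> n b; rewrite lmul_var_mon (sub_mapD hC.1) !mon_laurent_mul.
  by rewrite lmul_var_scale lmul_var_pow.
Qed.
Lemma lmul_pow_laurent_mul n g h : lmul_pow n g ** h = lmul_pow n (g ** h).
Proof.
case: n => i; rewrite /lmul_pow.
  elim: i => // i IHi; rewrite !iterS -IHi; apply: lmul_var_inj.
  by rewrite -lmul_var_laurent_mul !lmul_invK.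
by elim: i.+1 => // {}i IHi; rewrite !iterS -IHi lmul_var_laurent_mul.
Qed.
(** By density [f] may be taken to be $a z^n$, and left multiplications by [a] and by $z^n$ commute
    with right multiplications. *)
Lemma laurent_mulA : associative laurent_mul.
Proof.
move=> f g h; have [c gc] := series_bound g; have [c' hc] := series_bound h.
have ghc := ord_ge_laurent_mul gc hc.
move: f; apply: (@density_eq _ _ _ _ (c + c')).
- exact: laurent_mull_continuous.
- split=> [f f'|f l fl]; first by rewrite !laurent_mulBl.
  by rewrite addrA; do 2!apply: ord_ge_laurent_mul => //.
- by move=> n a; rewrite !mon_laurent_mul scale_laurent_mul lmul_pow_laurent_mul.
Qed.
Lemma laurent_mulDl : left_distributive laurent_mul +%R.
Proof.
move=> f f' g; rewrite (sub_mapD (F := laurent_mul^~ g)) // => ? ?.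
exact: laurent_mulBl.
Qed.
Lemma laurent_mulDr : right_distributive laurent_mul +%R.
Proof. by move=> f g g'; rewrite (sub_mapD (laurent_mulBr f)). Qed.
Lemma laurent_1neq0 : mon 0 1 != 0 :> series R.
Proof.
apply/eqP => /(congr1 (fun f : series R => f 0)).
by rewrite series0E /=; apply/eqP/oner_neq0.
Qed.

End LaurentMul.

(** A copy of [series R] that records [d], on which the ring structure depends. *)
Definition laurent (R : nzRingType) (d : derivation R) := series R.
HB.instance Definition _ R d := GRing.Zmodule.on (@laurent R d).
HB.instance Definition _ R d :=
  GRing.Zmodule_isNzRing.Build (@laurent R d) (@laurent_mulA R d)
    (@laurent_1mul R d) (@laurent_mul1 R d) (@laurent_mulDl R d)
    (@laurent_mulDr R d) (@laurent_1neq0 R).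

Section LaurentRing.
Variables (R : nzRingType) (d : derivation R).
Local Notation L := (laurent d).
Local Notation mon := (mon (R := R)).
Implicit Types (f g h : L) (a b : R).

Definition lconst a : L := mon 0 a.
Definition lvar : L := mon (-1) 1.

Lemma lconst_mul a f : lconst a * f = scale a f.
Proof. by rewrite [LHS]mon_laurent_mul. Qed.
Lemma lvar_mul f : lvar * f = lmul_var d f.
Proof. by rewrite [LHS]mon_laurent_mul scale1. Qed.
Lemma mon_mul n a m : (mon n a : L) * mon m 1 = mon (m + n) a.
Proof. by rewrite [LHS]mon_laurent_mul lmul_pow_mon1 scale_mon mulr1. Qed.
Lemma lconstM a b : lconst (a * b) = lconst a * lconst b.
Proof. by rewrite lconst_mul scale_mon. Qed.
Lemma lconstB a b : lconst (a - b) = lconst a - lconst b.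
Proof. exact: monB. Qed.
Lemma lconst_mul_mon n a b : lconst a * mon n b = mon n (a * b).
Proof. by rewrite lconst_mul scale_mon. Qed.
Lemma mon_lconst n a : mon n a = lconst a * mon n 1.
Proof. by rewrite lconst_mul_mon mulr1. Qed.
Lemma lvar_mul_mon n b : lvar * mon n b = mon (n - 1) b + mon n (d b) :> L.
Proof. by rewrite lvar_mul lmul_var_mon. Qed.
Lemma lvar_comm a : lvar * lconst a = lconst a * lvar + lconst (d a).
Proof. by rewrite lvar_mul_mon lconst_mul_mon mulr1. Qed.
Lemma ord_ge_mul f g l m : ord_ge f l -> ord_ge g m -> ord_ge (f * g) (l + m).
Proof. exact: ord_ge_laurent_mul. Qed.
Lemma mul_continuous f c : ord_ge f c -> continuous_map (fun g : L => f * g) c.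
Proof. exact: laurent_mulr_continuous. Qed.
Lemma mulr_continuous g c : ord_ge g c -> continuous_map (fun f : L => f * g) c.
Proof. exact: laurent_mull_continuous. Qed.
Definition leibniz_at (E : L -> L) f := forall g, E (f * g) = E f * g + f * E g.

Lemma leibniz_mul E f g : leibniz_at E f -> leibniz_at E g -> leibniz_at E (f * g).
Proof.
by move=> Ef Eg h; rewrite -mulrA Ef Eg Ef mulrDl !mulrDr -!mulrA addrA.
Qed.

(** The elements satisfying the product rule against all [g] are closed under products. They include
    $z$, because $uz=1$ forces $E(z)=-zE(u)z$, hence all monomials; density does the rest. *)
Lemma leibniz_mon (E : L -> L) c : continuous_map E c -> E 1 = 0 ->
  (forall a, leibniz_at E (lconst a)) -> leibniz_at E lvar ->
  forall f, leibniz_at E f.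
Proof.
move=> [EB Ec] E1 Ea Eu.
have uz : lvar * (mon 1 1 : L) = 1 by rewrite mon_mul.
have zu : (mon 1 1 : L) * lvar = 1 by rewrite mon_mul.
have Ez : leibniz_at E (mon 1 1).
  move=> g; have Ezu : E (mon 1 1) = - ((mon 1 1 : L) * E lvar * mon 1 1).
    have /eqP := Eu (mon 1 1); rewrite uz E1 eq_sym addrC addr_eq0 => /eqP e.
    by rewrite -[LHS]mul1r -zu -mulrA e mulrN mulrA.
  have := Eu ((mon 1 1 : L) * g); rewrite mulrA uz mul1r => e.
  rewrite Ezu e mulrDr [_ * (lvar * _)]mulrA zu mul1r mulNr -!mulrA.
  by rewrite addrA addNr add0r.
have En n : leibniz_at E (mon n 1).
  case: n => i; last rewrite NegzE.
    elim: i => [|i IHi]; first exact: Ea.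
    have -> : mon i.+1 1 = (mon 1 1 : L) * mon i 1 by rewrite mon_mul; congr mon; lia.
    exact: leibniz_mul.
  elim: i.+1 => [|{}i IHi]; first exact: Ea.
  have -> : mon (- i.+1%:Z) 1 = lvar * mon (- i%:Z) 1 :> L.
    by rewrite mon_mul; congr mon; lia.
  exact: leibniz_mul.
have Ena n a : leibniz_at E (mon n a) by rewrite mon_lconst; apply: leibniz_mul.
move=> f g; move: f; have [m gm] := series_bound g.
have [m' Egm] := series_bound (E g); pose M := Num.min (c + m) m'.
apply: (@density_eq _ _ _ _ M) => [||n a]; last exact: Ena.
  split=> [f f'|f l fl]; first by rewrite mulrBl EB.
  by apply: ord_geW (Ec _ _ (ord_ge_mul fl gm)); rewrite /M; lia.
split=> [f f'|f l fl]; first by rewrite EB !mulrBl opprD addrACA.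
apply: ord_geD.
  by apply: ord_geW (ord_ge_mul (Ec _ _ fl) gm); rewrite /M; lia.
by apply: ord_geW (ord_ge_mul fl Egm); rewrite /M; lia.
Qed.

(** The values at $z$ agree because $E(uz)=E'(uz)$ and $u$ can be cancelled; products give all
    monomials. The maps are not bundled as [derivation], since commutators and scalar combinations
    of derivations are compared too. *)
Lemma leibniz_eq (E E' : L -> L) c : continuous_map E c -> continuous_map E' c ->
  (forall f g, E (f * g) = E f * g + f * E g) ->
  (forall f g, E' (f * g) = E' f * g + f * E' g) ->
  (forall a, E (lconst a) = E' (lconst a)) -> E lvar = E' lvar -> E =1 E'.
Proof.
move=> Ec E'c EM E'M EE'a EE'u.
have EE'M f g : E f = E' f -> E g = E' g -> E (f * g) = E' (f * g).
  by move=> ef eg; rewrite EM E'M ef eg.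
have EE'z : E (mon 1 1) = E' (mon 1 1).
  have uz : lvar * (mon 1 1 : L) = 1 by rewrite mon_mul.
  have zu : (mon 1 1 : L) * lvar = 1 by rewrite mon_mul.
  have : E (lvar * mon 1 1) = E' (lvar * mon 1 1) by rewrite uz; exact: EE'a.
  rewrite EM E'M EE'u => /addrI e.
  by rewrite -[LHS]mul1r -[RHS]mul1r -zu -!mulrA e.
apply: (density_eq Ec E'c) => n a; rewrite mon_lconst; apply: (EE'M) => //.
case: n => i; last rewrite NegzE.
  elim: i => [|i IHi]; first exact: EE'a.
  have -> : mon i.+1 1 = (mon 1 1 : L) * mon i 1 by rewrite mon_mul; congr mon; lia.
  exact: EE'M.
elim: i.+1 => [|{}i IHi]; first exact: EE'a.
have -> : mon (- i.+1%:Z) 1 = lvar * mon (- i%:Z) 1 :> L.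
  by rewrite mon_mul; congr mon; lia.
exact: EE'M.
Qed.

(* [e n] is the value at $z^n$ of the extension sought; it is forced by $z^{n-1} = u z^n$. *)
Lemma derivation_ext (D : derivation R) (w : R) :
    (forall a, D (d a) - d (D a) = w * a - a * w) ->
  exists D' : derivation L, [/\ continuous_map D' 0,
    forall a, D' (lconst a) = lconst (D a) & D' lvar = lconst w].
Proof.
move=> Dd.
(* The recursion is $e_{n-1}=w z^n+u e_n$: going up it is solved for $e_n$ by [lmul_inv], going down
   it is read as it stands. *)
pose ep := fix ep (i : nat) : L :=
  if i is i'.+1 then lmul_inv d (ep i' - mon i'.+1%:Z w) else 0.
pose en := fix en (i : nat) : L :=
  if i is i'.+1 then mon (- i'%:Z) w + lmul_var d (en i') else 0.
pose e (n : int) : L := match n with Posz i => ep i | Negz i => en i.+1 end.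
have eN i : e (- i%:Z) = en i by case: i.
have eS n : e (n - 1) = mon n w + lvar * e n.
  rewrite lvar_mul; case: n => [[|i]|i]; first by rewrite -[0 - 1]/(Negz 0).
    rewrite (_ : Posz i.+1 - 1 = i); last lia.
    rewrite -[e (Posz i.+1)]/(lmul_inv d (e i - mon i.+1%:Z w)) lmul_invK.
    by rewrite addrC subrK.
  by rewrite (_ : Negz i - 1 = Negz i.+1) // !NegzE; lia.
have eo n : ord_ge (e n) (n + 1).
  case: n => i; last rewrite NegzE eN.
    elim: i => [|i IHi]; first exact: ord_ge0.
    have := (lmul_inv_continuous d).2 (e i - mon i.+1 w) (i%:Z + 1).
    move=> H; apply: ord_geW (H _); first lia.
    by apply: ord_geB => //; apply: ord_geW (@ord_ge_mon _ _ _); lia.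
  elim: i.+1 => [|{}i IHi]; first exact: ord_ge0.
  apply: ord_geD; first by apply: ord_geW (@ord_ge_mon _ _ _); lia.
  by apply: ord_geW (ord_ge_lmul_var d IHi); lia.
pose phi n a : L := mon n (D a) + lconst a * e n.
have phiB n a b : phi n (a - b) = phi n a - phi n b.
  by rewrite /phi derB monB lconstB mulrBl opprD addrACA.
have phio n a : ord_ge (phi n a) (n + 0).
  rewrite addr0; apply: ord_geD; first exact: ord_ge_mon.
  rewrite lconst_mul; apply/ord_ge_scale/(ord_geW _ (eo n)); lia.
have [E [EB Ec EM]] := continuous_ext phiB (ex_intro _ 0 phio).
have {}Ec := Ec 0 phio.
have Ea a : E (lconst a) = lconst (D a) by rewrite EM /phi mulr0 addr0.
have Eu : E lvar = lconst w.
  rewrite EM /phi der1 mon0 add0r lconst_mul scale1 [LHS](eS 0).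
  by rewrite lvar_mul (sub_map0 (@lmul_varB _ d)) addr0.
have EL : forall f, leibniz_at E f.
  apply: (leibniz_mon Ec) => [|a|].
  - by have := Ea 1; rewrite der1 => ->; exact: mon0.
  - move=> g; move: g; rewrite Ea.
    have Da := mul_continuous (@ord_ge_mon R 0 (D a)).
    have Ca := mul_continuous (@ord_ge_mon R 0 a).
    apply: (@density_eq _ _ _ _ 0) => [||n b].
    + split=> [f f'|f l fl]; first by rewrite mulrBr EB.
      by apply: ord_geW (Ec.2 _ _ (Ca.2 _ _ fl)); lia.
    + split=> [f f'|f l fl]; first by rewrite EB !mulrBr opprD addrACA.
      apply: ord_geD; first exact: Da.2.
      by apply: ord_geW (Ca.2 _ _ (Ec.2 _ _ fl)); lia.
    + rewrite !lconst_mul_mon !EM /phi derM monD lconstM mulrDr.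
      by rewrite lconst_mul_mon -!addrA -mulrA.
  - rewrite /leibniz_at Eu => g; move: g.
    have Cw := mul_continuous (@ord_ge_mon R 0 w).
    have Cu := mul_continuous (@ord_ge_mon R (-1) 1).
    apply: (@density_eq _ _ _ _ (-1)) => [||n b].
    + split=> [f f'|f l fl]; first by rewrite mulrBr EB.
      by apply: ord_geW (Ec.2 _ _ (Cu.2 _ _ fl)); lia.
    + split=> [f f'|f l fl]; first by rewrite EB !mulrBr opprD addrACA.
      apply: ord_geD; first by apply: ord_geW (Cw.2 _ _ fl); lia.
      by apply: ord_geW (Cu.2 _ _ (Ec.2 _ _ fl)); lia.
    + rewrite lvar_mul_mon (sub_mapD EB) !EM /phi lconst_mul_mon mulrDr.
      rewrite lvar_mul_mon mulrA lvar_comm mulrDl eS mulrDr lconst_mul_mon -mulrA.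
      (* The only place where the compatibility of [D] with [d] enters: it is what makes the
         extension respect $ub=bu+d(b)$. *)
      have -> : mon n (D (d b)) = mon n (d (D b)) + (mon n (w * b) - mon n (b * w)).
        by rewrite -monB -Dd -monD addrC subrK.
      set x1 := mon (n - 1) (D b); set x2 := mon n (d (D b)); set x3 := mon n (w * b).
      set x4 := mon n (b * w); set x5 := lconst b * (lvar * e n).
      set x6 := lconst (d b) * e n.
      rewrite [x4 + x5]addrC [x1 + _]addrA [x1 + x5 + x4]addrC [x3 - x4]addrC.
      rewrite [x2 + _]addrCA -[_ + x6]addrA addrACA subrr add0r.
      by rewrite [x2 + x3]addrC -[x3 + _ + _]addrA addrCA [x1 + x5 + _]addrACA.
have ELM f g : E (f * g) = (E f : L) * g + f * (E g : L) by exact: EL.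
by exists (@Derivation L E EB ELM).
Qed.

End LaurentRing.

(** * Lie algebra actions *)

Section LieAction.
Variables (k : fieldType) (M : lmodType k) (brM : M -> M -> M).
Hypotheses (brM_linearl : forall u, linear (brM^~ u))
  (brM_linearr : forall u, linear (brM u))
  (brM_alt : forall u, brM u u = 0) (brM_anti : forall u v, brM u v = - brM v u)
  (brM_jacobi : forall p q u,
     brM p (brM q u) - brM q (brM p u) = brM (brM p q) u).

(* A ring [R] on which [M] acts by derivations, with a partial map [j] defined on [N] which turns
   the action of [N] into commutators: this stands for the crossed product [R * U(M / N)]. *)
Record lie_action (R : nzRingType) (kappa : k -> R) (N : set M) (j : M -> R)
    (d : M -> derivation R) : Prop := LieAction {
  act_one : kappa 1 = 1;
  act_lin : forall a p q f, d (a *: p + q) f = kappa a * d p f + d q f;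
  act_comm : forall a f, kappa a * f = f * kappa a;
  act_kappa : forall p a, d p (kappa a) = 0;
  act_jlin : forall a p q, N p -> N q -> j (a *: p + q) = kappa a * j p + j q;
  act_inner : forall p f, N p -> d p f = j p * f - f * j p;
  act_dj : forall p q, N q -> d p (j q) = j (brM p q);
  act_br : forall p q f, d p (d q f) - d q (d p f) = d (brM p q) f }.

(** Here $N'$ is $N+ku$. Each [d p] extends with the value $j([p,u])$ at the variable, which makes
    sense because $[p,u]\in N$. The axioms that involve an arbitrary series compare two continuous
    derivations, hence are checked on constants and on the variable. *)
Lemma laurent_lie_action (R : nzRingType) (kappa : k -> R) (N N' : set M)
    (j : M -> R) (d : M -> derivation R) (u : M) (j' : M -> laurent (d u)) :
    lie_action kappa N j d ->
    (forall a p q, N p -> N q -> N (a *: p + q)) ->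
    (forall p q, N q -> N (brM p q)) -> (forall p, N (brM p u)) ->
    (forall p, N' p -> exists y a, N y /\ p = a *: u + y) ->
    N' u -> N `<=` N' ->
    (forall a p q, N' p -> N' q ->
       j' (a *: p + q) = lconst (d u) (kappa a) * j' p + j' q) ->
    (forall y, N y -> j' y = lconst (d u) (j y)) -> j' u = lvar (d u) ->
  exists d' : M -> derivation (laurent (d u)),
    [/\ lie_action (fun a => lconst (d u) (kappa a)) N' j' d',
        forall p, continuous_map (d' p) 0
      & forall p f, d' p (lconst (d u) f) = lconst (d u) (d p f)].
Proof.
move=> act Nlin Nbr Nu N'P N'u NN' j'lin j'N j'u.
set L := laurent (d u); pose C := lconst (d u); pose U := lvar (d u).
have N0 : N 0 by rewrite -(brM_alt u).
have jD x y : N x -> N y -> j (x + y) = j x + j y.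
  by move=> Nx Ny; rewrite -{1}(scale1r x) (act_jlin act) // (act_one act) mul1r.
have j0 : j 0 = 0.
  by have /eqP := jD 0 0 N0 N0; rewrite addr0 -{1}[j 0]addr0 (inj_eq (addrI _)) => /eqP <-.
have jB x y : N x -> N y -> j (x - y) = j x - j y.
  move=> Nx Ny; have Nxy : N (x - y) by rewrite addrC -scaleN1r; apply: Nlin.
  by have := jD _ _ Nxy Ny; rewrite subrK => ->; rewrite addrK.
(* The condition for extending [d p]: the commutator of [d p] and [d u] is [d (brM p u)], and this
   derivation is inner because [brM p u] lies in [N]. *)
have comm p a : d p (d u a) - d u (d p a) = j (brM p u) * a - a * j (brM p u).
  by rewrite (act_br act) (act_inner act).
have ext p := cid (derivation_ext (comm p)).
pose d' p := sval (ext p).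
have d'c p : continuous_map (d' p) 0 by rewrite /d'; case: (ext p) => ? [].
have d'C p a : d' p (C a) = C (d p a) by rewrite /d'; case: (ext p) => ? [].
have d'U p : d' p U = C (j (brM p u)) by rewrite /d'; case: (ext p) => ? [].
exists d'; split=> //.
have UC a : U * C a - C a * U = C (d u a) by rewrite [U * _]lvar_comm addrC addKr.
have Ccont a : continuous_map (fun g : L => C a * g) 0.
  exact: (mul_continuous (@ord_ge_mon R 0 a)).
have UK a : U * C (kappa a) = C (kappa a) * U.
  by rewrite [LHS]lvar_comm (act_kappa act) [lconst _ 0]mon0 addr0.
(* Scalars stay central: the commutator with a scalar is a continuous derivation that vanishes on
   constants and on the variable. *)
have kcomm a (f : L) : C (kappa a) * f = f * C (kappa a).
  apply/eqP; rewrite -subr_eq0; apply/eqP.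
  have := @leibniz_eq _ (d u) (fun f : L => C (kappa a) * f - f * C (kappa a)) (fun=> 0) 0.
  move=> -> //.
  - split=> [g g'|g l gl]; first by rewrite mulrBr mulrBl !opprD !opprK addrACA.
    apply: ord_geB; first exact: (Ccont _).2.
    exact: (mulr_continuous (@ord_ge_mon R 0 (kappa a))).2.
  - by split=> *; rewrite ?subr0 //; exact: ord_ge0.
  - by move=> g g'; rewrite mulrBl mulrBr -!mulrA addrA subrK.
  - by move=> *; rewrite mul0r mulr0 addr0.
  - by move=> b; rewrite -!lconstM (act_comm act) subrr.
  - by rewrite -[lvar _]/U UK subrr.
split.
- by rewrite (act_one act).
- move=> a p q f; move: f.
  apply: (@leibniz_eq _ _ _ _ 0) => //.
  - split=> [f g|f l fl]; first by rewrite !derB mulrBr opprD addrACA.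
    apply: ord_geD; last exact: (d'c q).2.
    by have := (Ccont (kappa a)).2 _ _ ((d'c p).2 _ _ fl); rewrite addr0.
  - exact: derM.
  - by move=> f g; rewrite !derM !mulrDr mulrDl !mulrA -[f * C _]kcomm addrACA.
  - by move=> b; rewrite !d'C (act_lin act) -lconstM -monD.
  - by rewrite !d'U brM_linearl (act_jlin act) // -lconstM -monD.
- exact: kcomm.
- by move=> p a; rewrite d'C (act_kappa act) [LHS]mon0.
- by [].
- move=> p f N'p; move: f; have [c pc] := series_bound (j' p).
  have [y [a [Ny pE]]] := N'P _ N'p.
  have j'p : j' p = C (kappa a) * U + C (j y).
    by rewrite pE j'lin //; [rewrite j'u j'N|exact: NN'].
  apply: (@leibniz_eq _ _ _ _ (Num.min c 0)).
  + split=> [f g|f l fl]; first by rewrite derB.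
    by apply: ord_geW ((d'c p).2 _ _ fl); lia.
  + split=> [f g|f l fl]; first by rewrite mulrBr mulrBl !opprD !opprK addrACA.
    apply: ord_geB; first by apply: ord_geW ((mul_continuous pc).2 _ _ fl); lia.
    by apply: ord_geW ((mulr_continuous pc).2 _ _ fl); lia.
  + exact: derM.
  + by move=> f g; rewrite mulrBl mulrBr -!mulrA addrA subrK.
  + move=> b; rewrite d'C {1}pE (act_lin act) j'p mulrDl mulrDr.
    rewrite [lconst _ b * (_ * U)]mulrA -[lconst _ b * C _]kcomm -!mulrA.
    rewrite opprD addrACA -mulrBr UC -!lconstM -lconstB -monD.
    by rewrite (act_inner act b Ny).
  (* With $p=au+y$, only [y] contributes to the bracket with [u]; the sign comes from
     antisymmetry. *)
  + rewrite d'U j'p mulrDl mulrDr [U * (_ * U)]mulrA UK opprD addrACA subrr add0r.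
    rewrite -opprB UC (act_dj act) // -[RHS]sub0r; apply/eqP.
    rewrite eq_sym subr_eq -[lconst _ _ + _]monD; apply/eqP.
    have <- : j (brM p u + brM u y) = j (brM p u) + j (brM u y) by apply: jD => //; exact: Nbr.
    by rewrite pE brM_linearl brM_alt scaler0 add0r brM_anti addNr j0 [RHS]mon0.
- move=> p q N'q; have [y [a [Ny qE]]] := N'P _ N'q.
  have Nq : N (brM p q) by rewrite qE brM_linearr; apply: Nlin => //; exact: Nbr.
  rewrite [j' (brM _ _)]j'N // qE brM_linearr (act_jlin act) //; last exact: Nbr.
  rewrite j'lin ?j'u ?[j' y]j'N //; last exact: NN'.
  rewrite derD derM d'U !d'C (act_kappa act) [C 0]mon0 mul0r add0r.
  by rewrite (act_dj act) // -lconstM -monD.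
- move=> p q f; move: f; apply: (@leibniz_eq _ _ _ _ 0) => //.
  + split=> [f g|f l fl]; first by rewrite !derB !opprD !opprK addrACA.
    have H x y : ord_ge (d' x (d' y f)) (l + 0).
      by have := (d'c x).2 _ _ ((d'c y).2 _ _ fl); rewrite !addr0.
    exact: ord_geB.
  + move=> f g; rewrite !derM !derD !derM mulrBl mulrBr.
    have aux (x1 x2 x3 x4 y1 y4 : L) :
      x1 + x2 + (x3 + x4) - (y1 + x3 + (x2 + y4)) = x1 - y1 + (x4 - y4).
      rewrite [x3 + x4]addrC [x1 + x2 + _]addrACA [x2 + y4]addrC.
      rewrite [y1 + x3 + _]addrACA [x3 + x2]addrC opprD [LHS]addrACA subrr addr0.
      by rewrite opprD addrACA.
    exact: aux.
  + exact: derM.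
  + by move=> b; rewrite !d'C -lconstB (act_br act).
  + rewrite !d'U !d'C -lconstB !(act_dj act) //; congr lconst.
    have <- : j (brM p (brM q u) - brM q (brM p u)) =
              j (brM p (brM q u)) - j (brM q (brM p u)) by apply: jB; apply: Nbr.
    by rewrite brM_jacobi.
Qed.

End LieAction.

(** * Rings up to an equivalence *)

(* Ring operations on a subset [pr_dom] of [W], satisfying the axioms up to the equivalence
   [pr_eq]. *)
Record pre_ring (W : choiceType) := PreRing {
  pr_dom : set W;
  pr_eq : W -> W -> Prop;
  pr_zero : W; pr_one : W;
  pr_opp : W -> W; pr_add : W -> W -> W; pr_mul : W -> W -> W;
  pr_refl : forall x, pr_eq x x;
  pr_sym : forall x y, pr_eq x y -> pr_eq y x;
  pr_trans : forall x y z, pr_eq x y -> pr_eq y z -> pr_eq x z;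
  pr_zeroP : pr_dom pr_zero;
  pr_oneP : pr_dom pr_one;
  pr_oppP : forall x, pr_dom x -> pr_dom (pr_opp x);
  pr_addP : forall x y, pr_dom x -> pr_dom y -> pr_dom (pr_add x y);
  pr_mulP : forall x y, pr_dom x -> pr_dom y -> pr_dom (pr_mul x y);
  pr_opp_eq : forall x x', pr_eq x x' -> pr_eq (pr_opp x) (pr_opp x');
  pr_add_eq : forall x x' y y', pr_eq x x' -> pr_eq y y' ->
    pr_eq (pr_add x y) (pr_add x' y');
  pr_mul_eq : forall x x' y y', pr_eq x x' -> pr_eq y y' ->
    pr_eq (pr_mul x y) (pr_mul x' y');
  pr_addA : forall x y z, pr_eq (pr_add x (pr_add y z)) (pr_add (pr_add x y) z);
  pr_addC : forall x y, pr_eq (pr_add x y) (pr_add y x);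
  pr_add0 : forall x, pr_eq (pr_add pr_zero x) x;
  pr_addN : forall x, pr_eq (pr_add (pr_opp x) x) pr_zero;
  pr_mulA : forall x y z, pr_dom x -> pr_dom y -> pr_dom z ->
    pr_eq (pr_mul x (pr_mul y z)) (pr_mul (pr_mul x y) z);
  pr_1mul : forall x, pr_dom x -> pr_eq (pr_mul pr_one x) x;
  pr_mul1 : forall x, pr_dom x -> pr_eq (pr_mul x pr_one) x;
  pr_mulDl : forall x y z, pr_dom x -> pr_dom y -> pr_dom z ->
    pr_eq (pr_mul (pr_add x y) z) (pr_add (pr_mul x z) (pr_mul y z));
  pr_mulDr : forall x y z, pr_dom x -> pr_dom y -> pr_dom z ->
    pr_eq (pr_mul x (pr_add y z)) (pr_add (pr_mul x y) (pr_mul x z));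
  pr_1neq0 : ~ pr_eq pr_one pr_zero }.

Section PreRing.
Variables (W : choiceType) (p : pre_ring W).
Local Notation E := (pr_eq p).
Local Notation P := (pr_dom p).

(** A representative chosen inside [pr_dom]. The quotient is the type of elements equal to their own
    representative, so each class keeps an honest value [pr_val]. It serves twice: with equality as
    [pr_eq], to make a set of formal series a ring type, and for germs of sequences. *)
Definition pr_nf (x : W) : W := xget (pr_zero p) [set y | P y /\ E x y].

Lemma pr_nfP x : P x -> P (pr_nf x) /\ E x (pr_nf x).
Proof.
move=> Px; apply: (@xgetPex _ _ [set y | P y /\ E x y]).
by exists x; split=> //; exact: pr_refl.
Qed.

Lemma pr_nf_eq x y : E x y -> pr_nf x = pr_nf y.
Proof.
move=> Exy; rewrite /pr_nf; congr xget; apply/seteqP; split=> z /= [Pz Ez].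
  by split=> //; apply: pr_trans Ez; apply: pr_sym.
by split=> //; apply: pr_trans Ez.
Qed.

Record pr_type := PrType {
  pr_val : W; pr_valP : P pr_val; pr_val_nf : pr_nf pr_val = pr_val }.

Lemma pr_val_inj t t' : pr_val t = pr_val t' -> t = t'.
Proof.
case: t t' => [x Px nx] [y Py ny] /= xy; move: Px nx Py ny; rewrite xy => *.
by congr PrType; exact: Prop_irrelevance.
Qed.

Lemma pr_nf_id x : P x -> pr_nf (pr_nf x) = pr_nf x.
Proof. by move=> /pr_nfP[_ /pr_nf_eq]. Qed.

Lemma pr_zero_nfP : P (pr_nf (pr_zero p)). Proof. exact: (pr_nfP (pr_zeroP p)).1. Qed.

(* outside [P] the value is the junk value [0] *)
Definition pr_pi (x : W) : pr_type :=
  match pselect (P x) with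
  | left Px => PrType (pr_nfP Px).1 (pr_nf_id Px)
  | right _ => PrType pr_zero_nfP (pr_nf_id (pr_zeroP p))
  end.

Lemma pr_piE x : P x -> pr_val (pr_pi x) = pr_nf x.
Proof. by rewrite /pr_pi; case: pselect. Qed.

Lemma pr_pi_eq x y : P x -> P y -> pr_pi x = pr_pi y <-> E x y.
Proof.
move=> Px Py; split=> [/(congr1 (@pr_val))|Exy].
  rewrite !pr_piE // => xy; apply: pr_trans (pr_nfP Px).2 _; rewrite xy.
  exact/pr_sym/(pr_nfP Py).2.
by apply: pr_val_inj; rewrite !pr_piE //; apply: pr_nf_eq.
Qed.

Lemma pr_valK t : pr_pi (pr_val t) = t.
Proof. by apply: pr_val_inj; rewrite pr_piE ?pr_val_nf //; exact: pr_valP. Qed.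

Lemma pr_piK x : P x -> E x (pr_val (pr_pi x)).
Proof. by move=> Px; rewrite pr_piE //; exact: (pr_nfP Px).2. Qed.

Definition pr_tadd t t' := pr_pi (pr_add p (pr_val t) (pr_val t')).
Definition pr_topp t := pr_pi (pr_opp p (pr_val t)).
Definition pr_tmul t t' := pr_pi (pr_mul p (pr_val t) (pr_val t')).

Lemma pr_piD x y : P x -> P y -> pr_pi (pr_add p x y) = pr_tadd (pr_pi x) (pr_pi y).
Proof.
move=> Px Py; apply/pr_pi_eq; first exact: pr_addP.
  by apply: pr_addP; exact: pr_valP.
by apply: pr_add_eq; exact: pr_piK.
Qed.
Lemma pr_piN x : P x -> pr_pi (pr_opp p x) = pr_topp (pr_pi x).
Proof.
move=> Px; apply/pr_pi_eq; [exact: pr_oppP|exact/pr_oppP/pr_valP|].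
by apply: pr_opp_eq; exact: pr_piK.
Qed.
Lemma pr_piM x y : P x -> P y -> pr_pi (pr_mul p x y) = pr_tmul (pr_pi x) (pr_pi y).
Proof.
move=> Px Py; apply/pr_pi_eq; first exact: pr_mulP.
  by apply: pr_mulP; exact: pr_valP.
by apply: pr_mul_eq; exact: pr_piK.
Qed.

HB.instance Definition _ := gen_eqMixin pr_type.
HB.instance Definition _ := gen_choiceMixin pr_type.

Local Ltac pr_closed := by repeat
  (apply: pr_addP || apply: pr_mulP || apply: pr_oppP || apply: pr_zeroP || apply: pr_oneP).
Local Ltac pr_ax ax := move=> *;
  repeat match goal with t : pr_type |- _ =>
    rewrite -(pr_valK t); move: (pr_valP t); move: (pr_val t) => {t} ? ? end;
  rewrite -?(pr_piD, pr_piN, pr_piM); try pr_closed;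
  apply/pr_pi_eq; try pr_closed; exact: ax.

Lemma pr_taddA : associative pr_tadd. Proof. pr_ax pr_addA. Qed.
Lemma pr_taddC : commutative pr_tadd. Proof. pr_ax pr_addC. Qed.
Lemma pr_tadd0 : left_id (pr_pi (pr_zero p)) pr_tadd. Proof. pr_ax pr_add0. Qed.
Lemma pr_taddN : left_inverse (pr_pi (pr_zero p)) pr_topp pr_tadd. Proof. pr_ax pr_addN. Qed.
HB.instance Definition _ :=
  GRing.isZmodule.Build pr_type pr_taddA pr_taddC pr_tadd0 pr_taddN.
Lemma pr_tmulA : associative pr_tmul. Proof. pr_ax pr_mulA. Qed.
Lemma pr_t1mul : left_id (pr_pi (pr_one p)) pr_tmul. Proof. pr_ax pr_1mul. Qed.
Lemma pr_tmul1 : right_id (pr_pi (pr_one p)) pr_tmul. Proof. pr_ax pr_mul1. Qed.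
Lemma pr_tmulDl : left_distributive pr_tmul pr_tadd. Proof. pr_ax pr_mulDl. Qed.
Lemma pr_tmulDr : right_distributive pr_tmul pr_tadd. Proof. pr_ax pr_mulDr. Qed.
Lemma pr_t1neq0 : pr_pi (pr_one p) != pr_pi (pr_zero p).
Proof.
apply/eqP => /pr_pi_eq; move=> /(_ (pr_oneP p) (pr_zeroP p)); exact: pr_1neq0.
Qed.
HB.instance Definition _ :=
  GRing.Zmodule_isNzRing.Build pr_type pr_tmulA pr_t1mul pr_tmul1 pr_tmulDl
    pr_tmulDr pr_t1neq0.

End PreRing.

(** * Iterated Laurent series *)

Record well_ordered (H : Type) (B : set H) (lt : H -> H -> Prop) : Prop :=
  WellOrdered {
  wo_irr : forall u, ~ lt u u;
  wo_trans : forall u v w, B u -> B v -> B w -> lt u v -> lt v w -> lt u w;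
  wo_total : forall u v, B u -> B v -> [\/ lt u v, u = v | lt v u];
  wo_wf : forall P : set H,
    (forall u, B u -> (forall v, B v -> lt v u -> P v) -> P u) ->
    forall u, B u -> P u }.

Section Stages.
Variables (H : eqType) (S : nzRingType) (A0 : set S) (B : set H).
Variable lt : H -> H -> Prop.
Hypothesis wo : well_ordered B lt.
Let lt_irr := wo_irr wo.
Let lt_trans := wo_trans wo.
Let lt_total := wo_total wo.
Let lt_wf := wo_wf wo.
Hypotheses (A00 : A0 0) (A0B : forall s t, A0 s -> A0 t -> A0 (s - t)).

(* A formal series [\sum_e s_e z^e] is the function [e |-> s_e] of the exponents. *)
Local Notation Omega := ((H -> int) -> S).
Implicit Types (e : H -> int) (f g : Omega) (u v w : H).

Definition upd e u n : H -> int := fun w => if w == u then n else e w.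
(** The coefficient of $z_u^n$ remains a function of all exponents, supported where the exponent of
    [u] is 0. Thus the coefficients of a series have the same type as the series, and the recursion
    over the stages stays inside [Omega]. *)
Definition coeff u f n : Omega := fun e => if e u == 0 then f (upd e u n) else 0.
Definition assemble u (a : int -> Omega) : Omega := fun e => a (e u) (upd e u 0).
Definition oconst (s : S) : Omega := fun e => if e == 0 then s else 0.
Definition omon u n : Omega := fun e => if e == upd 0 u n then 1 else 0.
Definition free_of u f := forall e, e u != 0 -> f e = 0.

(** Recursion along the variables in inductive form: coefficients are constants or come from a
    smaller stage, which covers the first variable, successors and limits at once. *)
Inductive stage u f : Prop := Stage l of B u
  & (forall n : int, n < l -> coeff u f n = 0)
  & (forall n : int, (exists2 s, A0 s & coeff u f n = oconst s) \/
       exists v, [/\ B v, lt v u & stage v (coeff u f n)]).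

Definition stages (J : set H) : set Omega :=
  [set f | (exists2 s, A0 s & f = oconst s) \/ exists2 v, J v & stage v f].
Definition below u : set H := [set v | B v /\ lt v u].
Definition downset (J : set H) := J `<=` B /\ forall u v, J u -> B v -> lt v u -> J v.

Lemma upd_id e u : upd e u (e u) = e.
Proof. by apply/funext => w; rewrite /upd; case: eqP => [->|]. Qed.
Lemma upd_upd e u n m : upd (upd e u n) u m = upd e u m.
Proof. by apply/funext => w; rewrite /upd; case: eqP. Qed.
Lemma upd_same e u n : upd e u n u = n.
Proof. by rewrite /upd eqxx. Qed.
Lemma upd_eq e u n : e u = n -> upd e u n = e.
Proof. by move=> <-; exact: upd_id. Qed.

Lemma assemble_coeff u f : assemble u (coeff u f) = f.
Proof. by apply/funext => e; rewrite /assemble /coeff upd_same eqxx upd_upd upd_id. Qed.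
Lemma coeff_assemble u (a : int -> Omega) :
  (forall n, free_of u (a n)) -> coeff u (assemble u a) = a.
Proof.
move=> fa; apply/funext => n; apply/funext => e; rewrite /coeff /assemble.
case: ifPn => [/eqP e0|e0]; first by rewrite upd_same upd_upd upd_eq.
by rewrite (fa n e).
Qed.
Lemma coeff_inj u f g : (forall n, coeff u f n = coeff u g n) -> f = g.
Proof.
move=> fg; rewrite -(assemble_coeff u f) -(assemble_coeff u g); congr assemble.
exact/funext.
Qed.
Lemma coeffB u f g n : coeff u (f - g) n = coeff u f n - coeff u g n.
Proof.
apply/funext => e; have -> : (coeff u f n - coeff u g n) e =
  coeff u f n e - coeff u g n e by [].
by rewrite /coeff; case: ifP; rewrite ?subr0.
Qed.
Lemma coeff_free u f n : free_of u f -> coeff u f n = if n == 0 then f else 0.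
Proof.
move=> uf; apply/funext => e; rewrite /coeff.
case: (eqVneq (e u) 0) => [e0|e0]; case: (eqVneq n 0) => [n0|n0] //.
- by rewrite n0 upd_eq.
- by rewrite uf // upd_same.
- by rewrite uf.
Qed.
Lemma oconst_free u s : free_of u (oconst s).
Proof. by move=> e eu; rewrite /oconst; case: eqP => // e0; rewrite e0 eqxx in eu. Qed.
Lemma oconst0 : oconst 0 = 0.
Proof. by apply/funext => e; rewrite /oconst; case: ifP. Qed.
Lemma oconstB s t : oconst (s - t) = oconst s - oconst t.
Proof.
apply/funext => e; have -> : (oconst s - oconst t) e = oconst s e - oconst t e by [].
by rewrite /oconst; case: ifP; rewrite ?subr0.
Qed.
Lemma coeff_omon u n m : coeff u (omon u n) m = if m == n then oconst 1 else 0.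
Proof.
apply/funext => e; rewrite /coeff /omon /oconst.
have -> : (upd e u m == upd 0 u n) = (m == n) && (upd e u 0 == 0).
  apply/eqP/andP => [em|[/eqP -> /eqP e0]].
    have := congr1 (fun e => e u) em; rewrite /upd eqxx => ->; rewrite eqxx.
    split=> //; apply/eqP/funext => w; have := congr1 (fun e => e w) em.
    by rewrite /upd; case: eqP.
  apply/funext => w; have := congr1 (fun e => e w) e0.
  by rewrite /upd; case: eqP.
case: (eqVneq m n) => [_|_] /=; last by case: ifP.
case: (eqVneq (e u) 0) => [eu|eu]; first by rewrite upd_eq.
by case: eqP => // e0; rewrite e0 eqxx in eu.
Qed.
Lemma omon_coeff u n f : (forall m, coeff u f m = if m == n then oconst 1 else 0) -> f = omon u n.
Proof. by move=> fE; apply: (@coeff_inj u) => m; rewrite fE coeff_omon. Qed.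

Lemma stageP u f : stage u f <-> [/\ B u,
  exists l : int, forall n, n < l -> coeff u f n = 0
  & forall n, stages (below u) (coeff u f n)].
Proof.
split=> [[l Bu fl fs]|[Bu [l fl] fs]].
  split=> //; first by exists l.
  by move=> n; have [|[v [Bv vu sv]]] := fs n; [left|right; exists v].
apply: (@Stage u f l) => // n; have [|[v [Bv vu] sv]] := fs n; first by left.
by right; exists v.
Qed.

Lemma stage_index u f : stage u f -> B u. Proof. by case/stageP. Qed.

Lemma stages_sub J J' f : J `<=` J' -> stages J f -> stages J' f.
Proof. by move=> JJ' [|[v Jv vf]]; [left|right; exists v => //; exact: JJ']. Qed.
Lemma stages0 J : stages J 0.
Proof. by left; exists 0; rewrite ?oconst0. Qed.
Lemma stages_const J s : A0 s -> stages J (oconst s).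
Proof. by move=> As; left; exists s. Qed.

Lemma below_downset u : B u -> downset (below u).
Proof.
by move=> Bu; split=> [v []//|v w [Bv vu] Bw wv]; split=> //; apply: (lt_trans _ Bv).
Qed.

(** By induction along the variables, larger variables never enter. It follows that coefficients
    from [below u] do not involve [u], so that a series can be reassembled from them
    ([stage_assemble]). *)
Lemma stage_support u f : stage u f ->
  forall w, u <> w -> ~ (B w /\ lt w u) -> free_of w f.
Proof.
move=> uf; have Bu := stage_index uf; move: u Bu f uf.
apply: lt_wf => u Bu IHu f /stageP[_ _ fs] w uw wu e ew.
rewrite -(assemble_coeff u f) /assemble.
have ew' : upd e u 0 w != 0 by rewrite /upd; case: (eqVneq w u) => // wu'; case: uw.
have [[s _ ->]|[v [Bv vu] sv]] := fs (e u); first exact: (@oconst_free w s _ ew').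
apply: (IHu v Bv vu _ sv w) => //; first by move=> vw; apply: wu; rewrite -vw.
move=> [Bw wv]; apply: wu; split=> //; exact: lt_trans wv vu.
Qed.

Lemma below_free u f : B u -> stages (below u) f -> free_of u f.
Proof.
move=> Bu [[s _ ->]|[v [Bv vu] sv]]; first exact: oconst_free.
apply: (stage_support sv) => [vu'|[_ uv]]; first by apply: (@lt_irr v); rewrite {2}vu'.
by apply: (@lt_irr u); exact: lt_trans uv vu.
Qed.

Lemma below_stage u f : B u -> stages (below u) f -> stage u f.
Proof.
move=> Bu uf; apply/stageP; split=> //.
  by exists 0 => n n0; rewrite coeff_free ?ifF //; [lia|exact: below_free].
move=> n; rewrite coeff_free; last exact: below_free.
by case: ifP => // _; exact: stages0.
Qed.

Lemma coeff_below u f n : B u -> stages (below u) f ->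
  coeff u f n = if n == 0 then f else 0.
Proof. by move=> Bu uf; apply: coeff_free; exact: below_free. Qed.

Lemma stage_mono u v f : B v -> lt u v -> stage u f -> stage v f.
Proof.
move=> Bv uv uf; apply: below_stage => //; right; exists u => //.
by split=> //; exact: stage_index uf.
Qed.

Lemma stage_assemble u (a : int -> Omega) : B u ->
    (exists l : int, forall n : int, n < l -> a n = 0) ->
    (forall n, stages (below u) (a n)) ->
  stage u (assemble u a) /\ coeff u (assemble u a) = a.
Proof.
move=> Bu [l al] ab; have ca : coeff u (assemble u a) = a.
  by apply: coeff_assemble => n; exact: below_free.
by split=> //; apply/stageP; rewrite ca; split=> //; exists l.
Qed.

(** Stages form a chain, so two elements can be compared inside a single one. Constants are kept
    apart because [J] may be empty. *)
Lemma stages_max J f g : downset J -> stages J f -> stages J g ->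
  (exists s t, [/\ A0 s, A0 t, f = oconst s & g = oconst t]) \/
  exists v, [/\ J v, stage v f & stage v g].
Proof.
move=> [JB _] [[s As ->]|[v Jv vf]] [[t At ->]|[w Jw wg]].
- by left; exists s, t.
- right; exists w; split=> //; apply: below_stage; first exact: JB.
  exact: stages_const.
- right; exists v; split=> //; apply: below_stage; first exact: JB.
  exact: stages_const.
- right; have [vw|vw|wv] := lt_total (JB _ Jv) (JB _ Jw).
  + by exists w; split=> //; apply: (stage_mono _ vw) => //; exact: JB.
  + by exists v; split=> //; rewrite vw.
  + by exists v; split=> //; apply: (stage_mono _ wv) => //; exact: JB.
Qed.

Lemma stageB u f g : stage u f -> stage u g -> stage u (f - g).
Proof.
move=> uf; have Bu := stage_index uf; move: u Bu f g uf.
apply: lt_wf => u Bu IHu f g /stageP[_ [l fl] fs] /stageP[_ [m gm] gs].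
apply/stageP; split=> //.
  exists (Num.min l m) => n nlm; rewrite coeffB fl ?gm ?subr0 //; lia.
move=> n; rewrite coeffB.
have [[s [t [As At -> ->]]]|[v [[Bv vu] vf vg]]] :=
  stages_max (below_downset Bu) (fs n) (gs n).
  by rewrite -oconstB; apply/stages_const/A0B.
by right; exists v => //; apply: IHu.
Qed.

Lemma stagesB J f g : downset J -> stages J f -> stages J g -> stages J (f - g).
Proof.
move=> dJ Jf Jg; have [[s [t [As At -> ->]]]|[v [Jv vf vg]]] := stages_max dJ Jf Jg.
  by rewrite -oconstB; apply/stages_const/A0B.
by right; exists v => //; exact: stageB.
Qed.

Lemma stage_omon u n : A0 1 -> B u -> stage u (omon u n).
Proof.
move=> A1 Bu; apply/stageP; split=> //.
  by exists n => m mn; rewrite coeff_omon ifF //; lia.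
by move=> m; rewrite coeff_omon; case: ifP => _; [exact: stages_const|exact: stages0].
Qed.

End Stages.

(** * Towers of stages *)

Section Towers.
Variables (k : fieldType) (M : lmodType k) (brM : M -> M -> M).
Hypotheses (brM_linearl : forall u, linear (brM^~ u))
  (brM_linearr : forall u, linear (brM u))
  (brM_alt : forall u, brM u u = 0) (brM_anti : forall u v, brM u v = - brM v u)
  (brM_jacobi : forall p q u,
     brM p (brM q u) - brM q (brM p u) = brM (brM p q) u).
Variables (H : eqType) (S : algType k) (A0 : set S) (B : set H).
Variable lt : H -> H -> Prop.
Hypothesis wo : well_ordered B lt.
Variables (mu : M -> S) (gen : H -> M) (crd : M -> H -> k).
Hypotheses (A01 : A0 1) (A0B : forall s t, A0 s -> A0 t -> A0 (s - t))
  (A0M : forall s t, A0 s -> A0 t -> A0 (s * t)) (A0k : forall a : k, A0 a%:A)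
  (A0d : forall p s, A0 s -> A0 (inner_der (mu p) s)).
Hypotheses (mu_linear : linear mu)
  (mu_br : forall p q, mu (brM p q) = inner_der (mu p) (mu q)).
Hypotheses (crd_lin : forall a p q b, crd (a *: p + q) b = a * crd p b + crd q b)
  (crd_gen : forall u v, B u -> B v -> crd (gen u) v = (u == v)%:R)
  (crd_br : forall p q b, B b -> crd (brM p q) b != 0 ->
     exists b', [/\ B b', lt b b' & crd q b' != 0]).

Local Notation Omega := ((H -> int) -> S).
Local Notation stages := (stages A0 B lt).
Local Notation stage := (stage A0 B lt).
Local Notation below := (below B lt).
Local Notation downset := (downset B lt).
Local Notation oconst := (@oconst H S).
Local Notation omon := (@omon H S).

(** An element without coordinates on [B] satisfies this for every [J]; such elements are sent by
    [mu] into the base ring. When [M] is $H\oplus K$ and [B] consists of the first [n] layers,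
    [supported_in set0] amounts to $H$-component in [Hs n]. *)
Definition supported_in (J : set H) : set M :=
  [set p | forall b, B b -> crd p b != 0 -> J b].
Local Notation N := supported_in.

Variable j : M -> Omega.
Hypotheses (j_lin : forall a p q e, j (a *: p + q) e = a *: j p e + j q e)
  (j_gen : forall u, B u -> j (gen u) = omon u (-1))
  (j_base : forall p, N set0 p -> A0 (mu p) /\ j p = oconst (mu p)).

Definition oscale (s : S) (f : Omega) : Omega := fun e => s * f e.

(* [mul] and [d] make the union of the stages in [J] into the ring [R((N))], acted on by [M]. *)
Record tower_on (J : set H) (mul : Omega -> Omega -> Omega)
    (d : M -> Omega -> Omega) : Prop := TowerOn {
  tw_down : downset J;
  tw_mulP : forall f g, stages J f -> stages J g -> stages J (mul f g);
  tw_mulA : forall f g h, stages J f -> stages J g -> stages J h ->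
    mul f (mul g h) = mul (mul f g) h;
  tw_mul1 : forall f, stages J f -> mul f (oconst 1) = f;
  tw_mulBl : forall f g h, stages J f -> stages J g -> stages J h ->
    mul (f - g) h = mul f h - mul g h;
  tw_mulBr : forall f g h, stages J f -> stages J g -> stages J h ->
    mul h (f - g) = mul h f - mul h g;
  tw_const : forall s f, A0 s -> stages J f -> mul (oconst s) f = oscale s f;
  tw_dP : forall p f, stages J f -> stages J (d p f);
  tw_dB : forall p f g, stages J f -> stages J g -> d p (f - g) = d p f - d p g;
  tw_dM : forall p f g, stages J f -> stages J g ->
    d p (mul f g) = mul (d p f) g + mul f (d p g);
  tw_dconst : forall p s, A0 s -> d p (oconst s) = oconst (inner_der (mu p) s);
  tw_dlin : forall a p q f e, stages J f ->
    d (a *: p + q) f e = a *: d p f e + d q f e;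
  tw_comm : forall a f, stages J f ->
    mul f (oconst a%:A) = mul (oconst a%:A) f;
  tw_jP : forall p, N J p -> stages J (j p);
  tw_inner : forall p f, N J p -> stages J f -> d p f = mul (j p) f - mul f (j p);
  tw_dj : forall p q, N J q -> d p (j q) = j (brM p q);
  tw_br : forall p q f, stages J f -> d p (d q f) - d q (d p f) = d (brM p q) f;
  tw_mul_stage : forall v f g, J v -> stage v f -> stage v g -> stage v (mul f g);
  tw_d_stage : forall v p f, J v -> stage v f -> stage v (d p f);
  tw_coefM : forall v a g n, J v -> stages (below v) a -> stage v g ->
    coeff v (mul a g) n = mul a (coeff v g n);
  tw_coefU : forall v g n, J v -> stage v g ->
    coeff v (mul (omon v (-1)) g) n = coeff v g (n + 1) + d (gen v) (coeff v g n);
  tw_ordM : forall v f g (l m : int), J v -> stage v f -> stage v g ->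
    (forall n : int, n < l -> coeff v f n = 0) ->
    (forall n : int, n < m -> coeff v g n = 0) ->
    forall n : int, n < l + m -> coeff v (mul f g) n = 0;
  tw_ordd : forall v p f (l : int), J v -> stage v f ->
    (forall n : int, n < l -> coeff v f n = 0) ->
    forall n : int, n < l -> coeff v (d p f) n = 0 }.

Lemma A0_zero : A0 0. Proof. by rewrite -(subrr 1); apply: A0B. Qed.

Lemma coeff_oscale u s f n : coeff u (oscale s f) n = oscale s (coeff u f n).
Proof. by apply/funext => e; rewrite /coeff /oscale; case: ifP; rewrite ?mulr0. Qed.

Section Typed.
Variables (J : set H) (mul : Omega -> Omega -> Omega) (d : M -> Omega -> Omega).
Hypothesis tw : tower_on J mul d.

Lemma tw_stagesB f g : stages J f -> stages J g -> stages J (f - g).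
Proof. by apply: stagesB => //; [exact: A0_zero|exact: tw_down tw]. Qed.
Lemma tw_stagesN f : stages J f -> stages J (- f).
Proof. by move=> Jf; rewrite -sub0r; apply: tw_stagesB => //; apply/stages0/A0_zero. Qed.
Lemma tw_stagesD f g : stages J f -> stages J g -> stages J (f + g).
Proof. by move=> Jf Jg; rewrite -(opprK g); apply/tw_stagesB/tw_stagesN. Qed.

Definition tower_pre_ring : pre_ring Omega.
Proof.
refine (@PreRing Omega (stages J) eq 0 (oconst 1) -%R +%R mul _ _ _ _ _ _ _ _ _ _ _
  (@addrA _) (@addrC _) (@add0r _) (@addNr _) _ _ _ _ _ _) => //.
- by move=> x y z -> ->.
- exact/stages0/A0_zero.
- exact: stages_const.
- exact: tw_stagesN.
- exact: tw_stagesD.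
- exact: tw_mulP tw.
- by move=> x x' ->.
- by move=> x x' y y' -> ->.
- by move=> x x' y y' -> ->.
- exact: tw_mulA tw.
- move=> f Jf; rewrite (tw_const tw) //; apply/funext => e; exact: mul1r.
- exact: tw_mul1 tw.
- move=> f g h Jf Jg Jh; have J0 : stages J 0 := stages0 B lt A0_zero J.
  have m0 : mul 0 h = 0 by rewrite -{1}(subrr h) (tw_mulBl tw) // subrr.
  rewrite -{1}(opprK g) (tw_mulBl tw) //; last exact: tw_stagesN.
  by rewrite -{1}(sub0r g) (tw_mulBl tw) // m0 sub0r opprK.
- move=> h f g Jh Jf Jg; have J0 : stages J 0 := stages0 B lt A0_zero J.
  have m0 : mul h 0 = 0 by rewrite -{1}(subrr h) (tw_mulBr tw) // subrr.
  rewrite -{1}(opprK g) (tw_mulBr tw) //; last exact: tw_stagesN.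
  by rewrite -{1}(sub0r g) (tw_mulBr tw) // m0 sub0r opprK.
- by move=> /(congr1 (fun f => f 0)); rewrite /oconst eqxx; apply/eqP/oner_neq0.
Defined.

(** [val] identifies a ring type with the set of functions in the stages of [J]; over this type a
    further Laurent series ring can be formed. *)
Lemma tower_ring : exists (R : nzRingType) (val : R -> Omega),
  [/\ injective val, forall f, stages J f <-> exists t, val t = f,
      forall x y, val (x - y) = val x - val y,
      forall x y, val (x * y) = mul (val x) (val y)
    & val 1 = oconst 1].
Proof.
pose R := pr_type tower_pre_ring; pose val : R -> Omega := @pr_val _ tower_pre_ring.
have piK f : stages J f -> val (pr_pi tower_pre_ring f) = f.
  by move=> Jf; have := pr_piK (p := tower_pre_ring) Jf; move=> /= {2}->.
have valP t : stages J (val t) := pr_valP t.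
exists R, val; split.
- exact: pr_val_inj.
- by move=> f; split=> [Jf|[t <-]]; [exists (pr_pi tower_pre_ring f); rewrite piK|].
- move=> x y; rewrite -[x - y]/(pr_pi _ (val x + val (pr_pi _ (- val y)))).
  have Jy : stages J (- val y) by exact: tw_stagesN.
  by rewrite (piK (- val y)) // piK //; exact: tw_stagesD.
- by move=> x y; rewrite -[x * y]/(pr_pi _ (mul (val x) (val y))) piK //; apply: tw_mulP tw _ _ _ _.
- by rewrite -[1]/(pr_pi _ (oconst 1)) piK //; apply: stages_const.
Qed.

End Typed.

(** * Adjoining one variable to a tower *)

Section Step.
Variables (J : set H) (mul : Omega -> Omega -> Omega) (d : M -> Omega -> Omega) (u : H).
Hypotheses (tw : tower_on J mul d) (Bu : B u) (Ju : J = below u).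
Local Notation J' := (J `|` [set u]).

Lemma supported_lin (K : set H) a p q : N K p -> N K q -> N K (a *: p + q).
Proof.
move=> Kp Kq b Bb; rewrite crd_lin; case: (eqVneq (crd p b) 0) => [->|/(Kp _ Bb)//].
by rewrite mulr0 add0r; exact: Kq.
Qed.

(** The hypothesis [crd_br] is $[L,u_\beta]\subseteq N_\beta$ in coordinates: every letter of a
    bracket is strictly below some letter of its second argument. *)
Lemma supported_br (K : set H) p q : downset K -> N K q -> N K (brM p q).
Proof. by move=> [_ Kd] Kq b Bb /(crd_br Bb)[b' [Bb' bb' /(Kq _ Bb')/Kd]]; exact. Qed.

Lemma supported_br_gen p : N J (brM p (gen u)).
Proof.
move=> b Bb /(crd_br Bb)[b' [Bb' bb']]; rewrite crd_gen //.
case: (eqVneq u b') => [ub|_]; last by rewrite eqxx.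
by rewrite Ju => _; split=> //; rewrite ub.
Qed.

Lemma supported_stepP p : N J' p -> exists y a, N J y /\ p = a *: gen u + y.
Proof.
move=> Np; exists (p - crd p u *: gen u), (crd p u); split; last by rewrite addrC subrK.
move=> b Bb; rewrite addrC -scaleNr crd_lin crd_gen //.
case: (eqVneq u b) => [<-|ub]; first by rewrite mulr1 addNr eqxx.
by rewrite mulr0 add0r => /(Np _ Bb)[//|/= bu]; rewrite bu eqxx in ub.
Qed.

Lemma supported_gen : N J' (gen u).
Proof.
move=> b Bb; rewrite crd_gen //; case: (eqVneq u b) => [->|_]; first by right.
by rewrite eqxx.
Qed.

Lemma downset_step : downset J'.
Proof.
have [JB Jd] := tw_down tw; split=> [v [/JB//|->//]|v w [Jv|->] Bw wv].
  by left; exact: Jd wv.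
by left; rewrite Ju.
Qed.

Lemma stages_step f : stages J' f <-> stage u f.
Proof.
split=> [[[s As ->]|[v [Jv|->//] vf]]|uf]; last by right; exists u => //; right.
  by apply: (below_stage wo A0_zero Bu); apply: stages_const.
by move: Jv; rewrite Ju => -[_ vu]; exact: (stage_mono wo A0_zero Bu vu vf).
Qed.

(** The stages of [J] form a ring type [R] with an action of [M]; the Laurent ring over it, carried
    to functions by [assemble], is the stage of [u]. Since the new operations extend the old ones,
    the step is an enlargement in the sense of Zorn's lemma. *)
Lemma tower_on_step : exists mul' d', [/\ tower_on J' mul' d',
    forall f g, stages J f -> stages J g -> mul' f g = mul f g
  & forall p f, stages J f -> d' p f = d p f].
Proof.
have [R [val [val_inj Xval valB valM val1]]] := tower_ring tw.
have valP t : stages J (val t) by apply/Xval; exists t.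
have val0 : val 0 = 0 by rewrite -(subrr 0) valB subrr.
have valD x y : val (x + y) = val x + val y.
  by rewrite -{1}(opprK y) valB -sub0r valB val0 sub0r opprK.
(* The inverse of [val], with default value 0; only its values on the stages of [J] matter. *)
pose inv f : R := xget 0 [set t | val t = f].
have invK f : stages J f -> val (inv f) = f.
  by move=> /Xval ex; apply: (@xgetPex _ _ [set t | val t = f]).
have dB p x y : inv (d p (val (x - y))) = inv (d p (val x)) - inv (d p (val y)).
  have dJ z : stages J (d p (val z)) by apply: (tw_dP tw).
  by apply: val_inj; rewrite [RHS]valB !(invK _ (dJ _)) valB (tw_dB tw).
have dM p x y : inv (d p (val (x * y))) =
    inv (d p (val x)) * y + x * inv (d p (val y)).
  have dJ z : stages J (d p (val z)) by apply: (tw_dP tw).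
  apply: val_inj; rewrite (invK _ (dJ (x * y))) valM (tw_dM tw) // [RHS]valD !valM.
  by rewrite !(invK _ (dJ _)).
pose dd p : derivation R := Derivation (dB p) (dM p).
have ddE p t : val (dd p t) = d p (val t) by rewrite invK //; exact: (tw_dP tw).
pose kap a := inv (oconst a%:A); pose jR p := inv (j p).
have kapE a : val (kap a) = oconst a%:A by rewrite invK //; apply: stages_const.
have jRE p : N J p -> val (jR p) = j p by move=> Np; rewrite invK //; exact: (tw_jP tw).
have kapM a t : val (kap a * t) = oscale a%:A (val t).
  by rewrite valM kapE (tw_const tw).
have act : lie_action brM kap (N J) jR dd.
  split.
  - by apply: val_inj; rewrite kapE val1 scale1r.
  - move=> a p q t; apply: val_inj; rewrite valD kapM !ddE; apply/funext => e.
    by rewrite (tw_dlin tw) // -[a *: d p _ _]mulr_algl.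
  - by move=> a t; apply: val_inj; rewrite !valM kapE (tw_comm tw).
  - move=> p a; apply: val_inj; rewrite ddE kapE (tw_dconst tw) // val0.
    by rewrite /inner_der mulr_algr mulr_algl subrr oconst0.
  - move=> a p q Np Nq; apply: val_inj; rewrite valD kapM !jRE //; last exact: supported_lin.
    by apply/funext => e; rewrite j_lin -[a *: j p _]mulr_algl.
  - by move=> p t Np; apply: val_inj; rewrite valB !valM ddE jRE // (tw_inner tw).
  - move=> p q Nq; apply: val_inj; rewrite ddE !jRE // ?(tw_dj tw) //.
    by apply: supported_br => //; exact: (tw_down tw).
  - by move=> p q t; apply: val_inj; rewrite valB !ddE (tw_br tw).
pose L := laurent (dd (gen u)); pose C := lconst (dd (gen u)).
(* The bijection between Laurent series over [R] and the stage of [u]; [pr] is its inverse, again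
   with a default value. *)
pose rho (F : L) := assemble u (fun n => val (F n)).
have rhoP (F : L) : stage u (rho F) /\ coeff u (rho F) = fun n => val (F n).
  apply: (stage_assemble wo) => //; last by move=> n; rewrite -Ju.
  by have [l Fl] := series_bound F; exists l => n nl; rewrite Fl.
have rho_stage F : stage u (rho F) := (rhoP F).1.
have rhoE F n : coeff u (rho F) n = val (F n) by rewrite (rhoP F).2.
have rho_inj : injective rho.
  move=> F G FG; apply: seriesP => n; apply: val_inj.
  by rewrite -!rhoE FG.
have rho_surj f : stage u f -> exists F, rho F = f.
  move=> /stageP[_ [l fl] fs].
  have bd : (fun n => inv (coeff u f n)) \in @bounded_below_pred R.
    apply/asboolP; exists l => n nl; rewrite fl //; apply: val_inj.
    by rewrite invK ?val0 //; exact/stages0/A0_zero.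
  exists (Series bd); apply: (@coeff_inj _ _ u) => n; rewrite rhoE invK //.
  by rewrite Ju.
have rhoB F G : rho (F - G) = rho F - rho G.
  by apply: (@coeff_inj _ _ u) => n; rewrite coeffB !rhoE seriesBE valB.
have rho0 : rho 0 = 0 by rewrite -(subrr 0) rhoB subrr.
have rhoD F G : rho (F + G) = rho F + rho G.
  by rewrite -{1}(opprK G) rhoB -sub0r rhoB rho0 sub0r opprK.
have rhoC t : rho (C t) = val t.
  have tB : stages (below u) (val t) by rewrite -Ju.
  apply: (@coeff_inj _ _ u) => n; rewrite rhoE (coeff_below wo n Bu tB).
  by rewrite /C /lconst monE; case: ifP.
have rhoU : rho (lvar _) = omon u (-1).
  apply: omon_coeff => n; rewrite rhoE monE; case: ifP => _ //.
have rho_kap a F G e : rho (C (kap a) * F + G) e = a *: rho F e + rho G e.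
  rewrite /rho /assemble seriesDE lconst_mul scaleE valD kapM.
  by rewrite -[a *: val _ _]mulr_algl.
pose pr f : L := xget 0 [set F | rho F = f].
have prK f : stage u f -> rho (pr f) = f.
  by move=> /rho_surj ex; apply: (@xgetPex _ _ [set F | rho F = f]).
have rhoK F : pr (rho F) = F by apply: rho_inj; rewrite prK.
have jstage p : N J' p -> stage u (j p).
  move=> /supported_stepP[y [a [Ny ->]]].
  suff -> : j (a *: gen u + y) = rho (C (kap a) * lvar _ + C (jR y)) by [].
  by apply/funext => e; rewrite j_lin rho_kap rhoU j_gen // rhoC jRE.
have JJ' : J `<=` J' by left.
pose j' p := pr (j p).
have j'E p : N J' p -> rho (j' p) = j p by move=> Np; rewrite prK //; exact: jstage.
have NN' : N J `<=` N J' by move=> p Np b Bb /(Np _ Bb); left.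
have [|p q|||||a p q Np Nq|y Ny||d' [act' d'c d'C]] :=
    @laurent_lie_action _ _ _ brM_linearl brM_linearr brM_alt brM_anti brM_jacobi
      R kap (N J) (N J') jR dd (gen u) j' act.
- exact: supported_lin.
- by apply: supported_br; exact: (tw_down tw).
- exact: supported_br_gen.
- exact: supported_stepP.
- exact: supported_gen.
- exact: NN'.
- apply: rho_inj; apply/funext => e; rewrite rho_kap !j'E ?j_lin //.
  exact: supported_lin.
- by apply: rho_inj; rewrite rhoC j'E ?jRE //; exact: NN'.
- by apply: rho_inj; rewrite rhoU j'E ?j_gen //; exact: supported_gen.
pose mul' f g := rho (pr f * pr g); pose dO p f := rho (d' p (pr f)).
have mulE F G : mul' (rho F) (rho G) = rho (F * G) by rewrite /mul' !rhoK.
have dE p F : dO p (rho F) = rho (d' p F) by rewrite /dO rhoK.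
have Xrho f : stages J' f -> exists F, rho F = f by move=> /stages_step/rho_surj.
have XrhoP F : stages J' (rho F) by apply/stages_step.
have mul_ext f g : stages J f -> stages J g -> mul' f g = mul f g.
  by move=> /Xval[x <-] /Xval[y <-]; rewrite -!rhoC mulE -lconstM !rhoC valM.
have d_ext p f : stages J f -> dO p f = d p f.
  by move=> /Xval[x <-]; rewrite -rhoC dE d'C !rhoC ddE.
have constE s : A0 s -> exists t, val t = oconst s.
  by move=> As; apply/Xval/stages_const.
exists mul', dO; split=> //; split.
- exact: downset_step.
- by move=> f g /Xrho[F <-] /Xrho[G <-]; rewrite mulE.
- by move=> f g h /Xrho[F <-] /Xrho[G <-] /Xrho[G' <-]; rewrite !mulE mulrA.
- by move=> f /Xrho[F <-]; rewrite -val1 -rhoC mulE mulr1.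
- by move=> f g h /Xrho[F <-] /Xrho[G <-] /Xrho[G' <-]; rewrite -rhoB !mulE mulrBl rhoB.
- by move=> f g h /Xrho[F <-] /Xrho[G <-] /Xrho[G' <-]; rewrite -rhoB !mulE mulrBr rhoB.
- move=> s f As /Xrho[F <-]; have [t ts] := constE s As; rewrite -ts -rhoC mulE.
  apply: (@coeff_inj _ _ u) => n; rewrite coeff_oscale !rhoE lconst_mul scaleE valM ts.
  by rewrite (tw_const tw).
- by move=> p f /Xrho[F <-]; rewrite dE.
- by move=> p f g /Xrho[F <-] /Xrho[G <-]; rewrite -rhoB !dE derB rhoB.
- by move=> p f g /Xrho[F <-] /Xrho[G <-]; rewrite mulE !dE derM rhoD !mulE.
- by move=> p s As; rewrite d_ext ?(tw_dconst tw) //; exact: stages_const.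
- by move=> a p q f e /Xrho[F <-]; rewrite !dE (act_lin act') rho_kap.
- by move=> a f /Xrho[F <-]; rewrite -kapE -rhoC !mulE (act_comm act').
- by move=> p /jstage/stages_step.
- by move=> p f Np /Xrho[F <-]; rewrite dE (act_inner act') // rhoB -!mulE j'E.
- move=> p q Nq; have Npq : N J' (brM p q) by apply: supported_br Nq; exact: downset_step.
  by rewrite -j'E // dE (act_dj act') // j'E.
- by move=> p q f /Xrho[F <-]; rewrite !dE -rhoB (act_br act').
- move=> v f g [Jv|->] vf vg; last by apply/stages_step/XrhoP.
  by rewrite mul_ext; [exact: (tw_mul_stage tw)|right; exists v|right; exists v].
- move=> v p f [Jv|->] vf; last by apply/stages_step/XrhoP.
  by rewrite d_ext; [exact: (tw_d_stage tw)|right; exists v].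
- move=> v a g n [Jv|->].
    move=> va vg; have bJ : below v `<=` J.
      by move=> w [Bw wv]; apply: (tw_down tw).2 Jv Bw wv.
    have Ja := stages_sub bJ va; have Jg : stages J g by right; exists v.
    rewrite !mul_ext //; first exact: (tw_coefM tw).
    by have [_ _ /(_ n)/(stages_sub bJ)] := (stageP _ _ _ _ _).1 vg.
  rewrite -Ju => /Xval[t <-] /rho_surj[G <-].
  rewrite -rhoC mulE !rhoE rhoC mul_ext // lconst_mul scaleE valM //.
- move=> v g n [Jv|->] vg.
    have Jg : stages J g by right; exists v.
    have bJ : below v `<=` J by move=> w [Bw wv]; apply: (tw_down tw).2 Jv Bw wv.
    rewrite mul_ext // ?(tw_coefU tw) // ?d_ext //.
      by have [_ _ /(_ n)/(stages_sub bJ)] := (stageP _ _ _ _ _).1 vg.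
    by right; exists v => //; apply: stage_omon => //; [exact: A0_zero|exact: (tw_down tw).1].
  have [G <-] := rho_surj _ vg; rewrite -rhoU mulE !rhoE lvar_mul lmul_varE valD.
  by rewrite ddE d_ext.
- move=> v f g l m [Jv|->] vf vg fl gm n nlm.
    rewrite mul_ext; [|by right; exists v|by right; exists v].
    exact: (tw_ordM tw) fl gm n nlm.
  move: vf vg fl gm => /rho_surj[F <-] /rho_surj[G <-] Fl Gm.
  rewrite mulE rhoE (@ord_ge_mul _ _ F G l m) //.
    by move=> i il; apply: val_inj; rewrite -rhoE Fl ?val0.
  by move=> i im; apply: val_inj; rewrite -rhoE Gm ?val0.
- move=> v p f l [Jv|->] vf fl n nl.
    rewrite d_ext; last by right; exists v.
    exact: (tw_ordd tw) fl n nl.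
  move: vf fl => /rho_surj[F <-] Fl.
  rewrite dE rhoE ((d'c p).2 F l) ?addr0 //.
  by move=> i il; apply: val_inj; rewrite -rhoE Fl ?val0.
Qed.

End Step.

Lemma stages_none f : stages set0 f <-> exists2 s, A0 s & f = oconst s.
Proof. by split=> [[//|[v []]]|]; left. Qed.

Lemma oconst_at0 s : oconst s 0 = s. Proof. by rewrite /oconst eqxx. Qed.

Lemma oconstD s t : oconst s + oconst t = oconst (s + t).
Proof.
by rewrite -[in RHS](opprK t) oconstB -[in RHS](sub0r t) oconstB oconst0 sub0r opprK.
Qed.

Lemma oscale_const s t : oscale s (oconst t) = oconst (s * t).
Proof. by apply/funext => e; rewrite /oscale /oconst; case: ifP; rewrite ?mulr0. Qed.

Lemma inner_derB (T : nzRingType) (x s t : T) :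
  inner_der x (s - t) = inner_der x s - inner_der x t.
Proof. by rewrite /inner_der mulrBl mulrBr !opprD !opprK addrACA. Qed.

Lemma inner_derM (T : nzRingType) (x s t : T) :
  inner_der x (s * t) = inner_der x s * t + s * inner_der x t.
Proof. by rewrite /inner_der mulrBl mulrBr -!mulrA addrA subrK. Qed.

Lemma inner_der_br (T : nzRingType) (x y s : T) :
  inner_der x (inner_der y s) - inner_der y (inner_der x s) =
  inner_der (inner_der x y) s.
Proof.
rewrite [X in inner_der x X]/inner_der inner_derB !inner_derM.
rewrite [inner_der y _]/inner_der [RHS]/inner_der [_ * y + _]addrC opprD addrACA.
by rewrite addrK.
Qed.

(** Without variables, the stages contain only constants, read off at the zero exponent. *)
Lemma tower_base_on : tower_on set0 (fun f g => oconst (f 0 * g 0))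
  (fun p f => oconst (inner_der (mu p) (f 0))).
Proof.
have ds0 : downset set0 by split.
split=> //.
- by move=> f g /stages_none[s As ->] /stages_none[t At ->]; rewrite !oconst_at0;
    apply: stages_const; exact: A0M.
- by move=> f g h _ _ _; rewrite !oconst_at0 mulrA.
- by move=> f /stages_none[s As ->]; rewrite !oconst_at0 mulr1.
- by move=> f g h _ _ _; rewrite -oconstB -mulrBl.
- by move=> f g h _ _ _; rewrite -oconstB -mulrBr.
- by move=> s f As /stages_none[t At ->]; rewrite !oconst_at0 oscale_const.
- move=> p f /stages_none[s As ->]; rewrite oconst_at0.
  by apply: stages_const; exact: A0d.
- by move=> p f g _ _; rewrite -oconstB -inner_derB.
- by move=> p f g _ _; rewrite !oconst_at0 inner_derM oconstD.
- by move=> p s _; rewrite oconst_at0.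
- move=> a p q f e /stages_none[s As ->]; rewrite oconst_at0 /oconst.
  case: ifP => _; last by rewrite scaler0 addr0.
  by rewrite /inner_der mu_linear mulrDl mulrDr scalerBr -scalerAl -scalerAr opprD addrACA.
- by move=> a f _; rewrite !oconst_at0 mulr_algr mulr_algl.
- by move=> p /j_base[Ap ->]; apply: stages_const.
- move=> p f /j_base[_ ->] /stages_none[s _ ->].
  by rewrite !oconst_at0 -oconstB.
- move=> p q Nq; have [_ ->] := j_base Nq; rewrite oconst_at0 -mu_br.
  by have [_ ->] := j_base (@supported_br _ p _ ds0 Nq).
- by move=> p q f _; rewrite !oconst_at0 -oconstB inner_der_br mu_br.
Qed.

Definition tower : Type := {x : set H * (Omega -> Omega -> Omega) *
  (M -> Omega -> Omega) | tower_on x.1.1 x.1.2 x.2}.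
Definition tw_set (t : tower) := (sval t).1.1.
Definition tw_mul (t : tower) := (sval t).1.2.
Definition tw_act (t : tower) := (sval t).2.

(** Agreement is demanded on the stages of the smaller tower only, as its operations are arbitrary
    elsewhere. *)
Definition tower_le : rel tower := fun t t' => `[< [/\ tw_set t `<=` tw_set t',
  forall f g, stages (tw_set t) f -> stages (tw_set t) g ->
    tw_mul t' f g = tw_mul t f g
  & forall p f, stages (tw_set t) f -> tw_act t' p f = tw_act t p f] >].

Lemma tower_le_refl : reflexive tower_le.
Proof. by move=> t; apply/asboolP; split. Qed.

Lemma tower_le_trans : transitive tower_le.
Proof.
move=> t2 t1 t3 /asboolP[J12 m12 d12] /asboolP[J23 m23 d23]; apply/asboolP; split.
- exact: subset_trans J23.
- move=> f g f1 g1; rewrite m23 ?m12 //; exact: stages_sub f1 || exact: stages_sub g1.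
- by move=> p f f1; rewrite d23 ?d12 //; exact: stages_sub f1.
Qed.

(** * Unions of chains of towers *)

Section ChainUnion.
Variable A : set tower.
Hypotheses (Atot : total_on A tower_le) (A0t : A !=set0).

Definition union_set : set H := [set v | exists2 t, A t & tw_set t v].
(** Computed in any tower of the chain that contains both factors; two such towers have a common
    extension in the chain, so the choice is harmless. *)
Definition union_mul (f g : Omega) : Omega := xget 0
  [set h | exists2 t, A t & [/\ stages (tw_set t) f, stages (tw_set t) g
    & h = tw_mul t f g]].
Definition union_act p (f : Omega) : Omega := xget 0
  [set h | exists2 t, A t & stages (tw_set t) f /\ h = tw_act t p f].

Lemma union_stages f : stages union_set f -> exists2 t, A t & stages (tw_set t) f.
Proof.
case: A0t => t0 At0 [fb|[v [t At tv] vf]]; first by exists t0 => //; left.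
by exists t => //; right; exists v.
Qed.

Lemma union_stages_sub t : A t -> stages (tw_set t) `<=` stages union_set.
Proof. by move=> At f; apply: stages_sub => v tv; exists t. Qed.

Lemma chain_max t t' : A t -> A t' ->
  exists t'', [/\ A t'', tower_le t t'' & tower_le t' t''].
Proof.
move=> At At'; have [tt'|t't] := Atot At At'.
  by exists t'; split=> //; exact: tower_le_refl.
by exists t; split=> //; exact: tower_le_refl.
Qed.

Lemma tower_le_stages t t' : tower_le t t' -> stages (tw_set t) `<=` stages (tw_set t').
Proof. by move=> /asboolP[tt' _ _] f; exact: stages_sub. Qed.

Lemma union_mulE t f g : A t -> stages (tw_set t) f -> stages (tw_set t) g ->
  union_mul f g = tw_mul t f g.
Proof.
move=> At tf tg; have : [set h | exists2 t, A t & [/\ stages (tw_set t) f,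
    stages (tw_set t) g & h = tw_mul t f g]] (union_mul f g).
  by apply: xgetPex; exists (tw_mul t f g), t.
move=> [t' At' [t'f t'g ->]]; have [t'' [_]] := chain_max At At'.
by move=> /asboolP[_ e _] /asboolP[_ e' _]; rewrite -e // -e'.
Qed.

Lemma union_actE t p f : A t -> stages (tw_set t) f -> union_act p f = tw_act t p f.
Proof.
move=> At tf; have : [set h | exists2 t, A t & stages (tw_set t) f /\
    h = tw_act t p f] (union_act p f).
  by apply: xgetPex; exists (tw_act t p f), t.
move=> [t' At' [t'f ->]]; have [t'' [_]] := chain_max At At'.
by move=> /asboolP[_ _ e] /asboolP[_ _ e']; rewrite -e // -e'.
Qed.

Lemma union_stages2 f g : stages union_set f -> stages union_set g ->
  exists2 t, A t & stages (tw_set t) f /\ stages (tw_set t) g.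
Proof.
move=> /union_stages[t At tf] /union_stages[t' At' t'g].
have [t'' [At'' /tower_le_stages l /tower_le_stages l']] := chain_max At At'.
by exists t'' => //; split; [exact: l|exact: l'].
Qed.

Lemma union_stages3 f g h : stages union_set f -> stages union_set g ->
  stages union_set h -> exists2 t, A t &
  [/\ stages (tw_set t) f, stages (tw_set t) g & stages (tw_set t) h].
Proof.
move=> uf ug /union_stages[t' At' t'h]; have [t At [tf tg]] := union_stages2 uf ug.
have [t'' [At'' /tower_le_stages l /tower_le_stages l']] := chain_max At At'.
by exists t'' => //; split; [exact: l|exact: l|exact: l'].
Qed.

Hypothesis crd_fin : forall p, exists s : seq H, forall b, B b -> crd p b != 0 -> b \in s.

(** Each element has finitely many nonzero coordinates on [B], and finitely many letters of the
    union lie in one member of the chain. *)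
Lemma union_supported p : N union_set p -> exists2 t, A t & N (tw_set t) p.
Proof.
move=> Np; have [s sP] := crd_fin p.
suff [t At tP] : exists2 t, A t &
    forall b, b \in s -> B b -> crd p b != 0 -> tw_set t b.
  by exists t => // b Bb pb; apply: tP => //; exact: sP.
elim: s {sP} => [|b s [t At IHs]]; first by case: A0t => t At; exists t.
have [[Bb pb]|nb] := pselect (B b /\ crd p b != 0); last first.
  by exists t => // c; rewrite in_cons => /orP[/eqP-> *|]; [case: nb|exact: IHs].
have [t' At' t'b] := Np b Bb pb.
have [t'' [At'' /asboolP[l _ _] /asboolP[l' _ _]]] := chain_max At At'.
exists t'' => // c; rewrite in_cons => /orP[/eqP-> _ _|cs Bc pc]; first exact: l'.
by apply: l; exact: IHs.
Qed.

(** Each axiom involves finitely many series, which all lie in one member of the chain. *)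
Lemma union_tower : tower_on union_set union_mul union_act.
Proof.
have tw t : tower_on (tw_set t) (tw_mul t) (tw_act t) := svalP t.
have down : downset union_set.
  split=> [v [t _ tv]|v w [t At tv] Bw wv]; first exact: (tw_down (tw t)).1.
  by exists t => //; exact: (tw_down (tw t)).2 tv Bw wv.
have belowt t v : tw_set t v -> below v `<=` tw_set t.
  by move=> tv w [Bw wv]; apply: (tw_down (tw t)).2 tv Bw wv.
have closedM t f g : stages (tw_set t) f -> stages (tw_set t) g ->
  stages (tw_set t) (tw_mul t f g) by exact: (tw_mulP (tw t)).
have closedd t p f : stages (tw_set t) f -> stages (tw_set t) (tw_act t p f).
  exact: (tw_dP (tw t)).
have closedB t f g : stages (tw_set t) f -> stages (tw_set t) g ->
  stages (tw_set t) (f - g) by exact: (tw_stagesB (tw t)).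
split=> //.
- move=> f g uf ug; have [t At [tf tg]] := union_stages2 uf ug.
  by rewrite (union_mulE At) //; apply: (union_stages_sub At); exact: closedM.
- move=> f g h uf ug uh; have [t At [tf tg th]] := union_stages3 uf ug uh.
  by rewrite !(union_mulE At) ?(tw_mulA (tw t)) //; exact: closedM.
- move=> f uf; have [t At tf] := union_stages uf.
  by rewrite (union_mulE At) ?(tw_mul1 (tw t)) //; exact: stages_const.
- move=> f g h uf ug uh; have [t At [tf tg th]] := union_stages3 uf ug uh.
  by rewrite !(union_mulE At) ?(tw_mulBl (tw t)) //; exact: closedB.
- move=> f g h uf ug uh; have [t At [tf tg th]] := union_stages3 uf ug uh.
  by rewrite !(union_mulE At) ?(tw_mulBr (tw t)) //; exact: closedB.
- move=> s f As uf; have [t At tf] := union_stages uf.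
  by rewrite (union_mulE At) ?(tw_const (tw t)) //; exact: stages_const.
- move=> p f uf; have [t At tf] := union_stages uf.
  by rewrite (union_actE _ At) //; apply: (union_stages_sub At); exact: closedd.
- move=> p f g uf ug; have [t At [tf tg]] := union_stages2 uf ug.
  by rewrite !(union_actE _ At) ?(tw_dB (tw t)) //; exact: closedB.
- move=> p f g uf ug; have [t At [tf tg]] := union_stages2 uf ug.
  have tdf := closedd t p f tf; have tdg := closedd t p g tg.
  have tfg := closedM t f g tf tg.
  rewrite (union_mulE At tf tg) !(union_actE _ At) // !(union_mulE At) //.
  exact: (tw_dM (tw t)).
- move=> p s As; case: A0t => t At; rewrite (union_actE _ At).
    exact: (tw_dconst (tw t)).
  exact: stages_const.
- move=> a p q f e uf; have [t At tf] := union_stages uf.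
  by rewrite !(union_actE _ At) ?(tw_dlin (tw t)).
- move=> a f uf; have [t At tf] := union_stages uf.
  have tk : stages (tw_set t) (oconst a%:A) by exact: stages_const.
  by rewrite !(union_mulE At) ?(tw_comm (tw t)).
- move=> p /union_supported[t At tp]; apply: (union_stages_sub At).
  exact: (tw_jP (tw t)).
- move=> p f /union_supported[t' At' t'p] /union_stages[t'' At'' t''f].
  have [t [At l' l'']] := chain_max At' At''.
  have tf := tower_le_stages l'' t''f.
  have tp : N (tw_set t) p.
    by move/asboolP: l' => [l' _ _] b Bb /(t'p b Bb)/l'.
  have tj := tw_jP (tw t) tp.
  by rewrite !(union_mulE At) // (union_actE _ At) // (tw_inner (tw t)).
- move=> p q /union_supported[t At tq]; rewrite (union_actE _ At).
    exact: (tw_dj (tw t)).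
  exact: (tw_jP (tw t)).
- move=> p q f uf; have [t At tf] := union_stages uf.
  have tpf := closedd t p f tf; have tqf := closedd t q f tf.
  by rewrite !(union_actE _ At) ?(tw_br (tw t)) // !(union_actE _ At) // (tw_br (tw t)).
- move=> v f g [t At tv] vf vg.
  by rewrite (union_mulE At); [exact: (tw_mul_stage (tw t))|right; exists v|right; exists v].
- move=> v p f [t At tv] vf.
  by rewrite (union_actE _ At); [exact: (tw_d_stage (tw t))|right; exists v].
- move=> v a g n [t At tv] va vg.
  have ta := stages_sub (belowt _ _ tv) va; have tg : stages (tw_set t) g by right; exists v.
  have tgn : stages (tw_set t) (coeff v g n).
    by have [_ _ /(_ n)/(stages_sub (belowt _ _ tv))] := (stageP _ _ _ _ _).1 vg.
  by rewrite !(union_mulE At) // (tw_coefM (tw t)).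
- move=> v g n [t At tv] vg; have tg : stages (tw_set t) g by right; exists v.
  have tgn : stages (tw_set t) (coeff v g n).
    by have [_ _ /(_ n)/(stages_sub (belowt _ _ tv))] := (stageP _ _ _ _ _).1 vg.
  have tu : stages (tw_set t) (omon v (-1)).
    by right; exists v => //; apply: stage_omon => //; [exact: A0_zero|exact: stage_index vg].
  by rewrite (union_mulE At) // (union_actE _ At) // (tw_coefU (tw t)).
- move=> v f g l m [t At tv] vf vg fl gm.
  rewrite (union_mulE At); [|by right; exists v|by right; exists v].
  exact: (tw_ordM (tw t)).
- move=> v p f l [t At tv] vf fl.
  rewrite (union_actE _ At); last by right; exists v.
  exact: (tw_ordd (tw t)).
Qed.

End ChainUnion.

Hypothesis crd_fin : forall p, exists s : seq H, forall b, B b -> crd p b != 0 -> b \in s.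

(** If a maximal tower misses a letter, let [u] be the least one. All letters below [u] are present
    and none above it, since the index set is an initial segment; this set is thus [below u], and
    adjoining [u] contradicts maximality. *)
Lemma full_tower : exists mul d, tower_on B mul d.
Proof.
pose mk J mul d tw : tower := exist _ (J, mul, d) tw.
have [A|t tmax] := @ZL_preorder tower (mk _ _ _ tower_base_on) tower_le
  tower_le_refl (fun r s t => @tower_le_trans s r t).
  move=> Atot; have [->|/set0P A0t] := eqVneq A set0.
    by exists (mk _ _ _ tower_base_on).
  exists (mk _ _ _ (union_tower Atot A0t crd_fin)) => t At; apply/asboolP; split.
  - by move=> v tv; exists t.
  - by move=> f g tf tg; rewrite -(union_mulE Atot At tf tg).
  - by move=> p f tf; rewrite -(union_actE Atot p At tf).
have tw : tower_on (tw_set t) (tw_mul t) (tw_act t) := svalP t.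
suff BJ : tw_set t = B by rewrite -BJ; exists (tw_mul t), (tw_act t).
apply/seteqP; split; first exact: (tw_down tw).1.
apply: (wo_wf wo) => u Bu IHu; have [//|nu] := pselect (tw_set t u).
have Ju : tw_set t = below u.
  apply/seteqP; split=> [v tv|v [Bv vu]]; last exact: IHu.
  have Bv := (tw_down tw).1 _ tv; have [vu|vu|uv] := wo_total wo Bv Bu => //.
    by rewrite -vu in nu.
  by case: nu; exact: (tw_down tw).2 tv Bu uv.
have [mul' [d' [tw' mul'E d'E]]] := tower_on_step tw Bu Ju.
have /asboolP[sub _ _] : tower_le (mk _ _ _ tw') t.
  by apply: tmax; apply/asboolP; split=> //; left.
by apply: sub; right.
Qed.

Variable le : rel H.
Hypothesis ltE : forall u v, lt u v <-> u != v /\ le u v.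

Lemma subring_closedP (T : nzRingType) (A : set T) : A 1 ->
  (forall x y, A x -> A y -> A (x - y)) -> (forall x y, A x -> A y -> A (x * y)) ->
  subring_closed [in A].
Proof.
move=> A1 AB AM; split=> [|x y|x y]; rewrite ?in_setE //; [exact: AB|exact: AM].
Qed.

Lemma stages_below_act mul d u p f : tower_on B mul d -> B u ->
  stages (below u) f -> stages (below u) (d p f).
Proof.
move=> tw Bu [[s As ->]|[v [Bv vu] vf]].
  by rewrite (tw_dconst tw) //; apply: stages_const; exact: A0d.
by right; exists v => //; exact: (tw_d_stage tw).
Qed.

(** The full tower in terms of the Laurent axioms. The map [i] is claimed to respect the ring
    operations on [A0] only, because a constant outside [A0] belongs to no stage. *)
Lemma full_tower_ring : exists (Q : nzRingType) (i : S -> Q) (jQ : M -> Q)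
    (F : H -> set Q) (c : H -> Q -> int -> Q),
  [/\ [/\ i 1 = 1, forall s t, A0 s -> A0 t -> i (s - t) = i s - i t
        & forall s t, A0 s -> A0 t -> i (s * t) = i s * i t],
      [/\ forall a p q, jQ (a *: p + q) = i a%:A * jQ p + jQ q,
        forall p q, jQ (brM p q) = inner_der (jQ p) (jQ q)
        & forall p, N set0 p -> jQ p = i (mu p)],
      forall u, B u -> exists z,
        laurent_ring (stage_below (i @` A0) B le F u) (F u) (jQ (gen u)) z (c u),
      forall p u f, B u -> F u f -> F u (inner_der (jQ p) f)
    & forall p u f l, B u -> F u f ->
        order_ge (c u) f l -> order_ge (c u) (inner_der (jQ p) f) l].
Proof.
have [mul [d tw]] := full_tower.
have [Q [val [val_inj Xval valB valM val1]]] := tower_ring tw.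
have valP t : stages B (val t) by apply/Xval; exists t.
have val0 : val 0 = 0 by rewrite -(subrr 0) valB subrr.
have valD x y : val (x + y) = val x + val y.
  by rewrite -{1}(opprK y) valB -sub0r valB val0 sub0r opprK.
pose inv f : Q := xget 0 [set t | val t = f].
have invK f : stages B f -> val (inv f) = f.
  by move=> /Xval ex; apply: (@xgetPex _ _ [set t | val t = f]).
have valK t : inv (val t) = t by apply: val_inj; rewrite invK.
have iK s : A0 s -> val (inv (oconst s)) = oconst s.
  by move=> As; apply/invK/stages_const.
have NB p : N B p by move=> b Bb.
have jK p : val (inv (j p)) = j p by apply/invK/(tw_jP tw).
have derE p t : val (inner_der (inv (j p)) t) = d p (val t).
  by rewrite valB !valM jK (tw_inner tw).
have iM s t : A0 s -> val (inv (oconst s) * t) = oscale s (val t).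
  by move=> As; rewrite valM iK // (tw_const tw).
exists Q, (fun s => inv (oconst s)), (fun p => inv (j p)),
  (fun u => [set t | stage u (val t)]), (fun u t n => inv (coeff u (val t) n)).
split.
- split=> [|s t As At|s t As At]; apply: val_inj; first by rewrite iK // val1.
    by rewrite valB !iK ?oconstB //; exact: A0B.
  by rewrite iM // !iK ?oscale_const //; exact: A0M.
- split=> [a p q|p q|p /j_base[_ ->]] //; apply: val_inj.
    by rewrite valD iM // !jK; apply/funext => e; rewrite j_lin -[a *: j p _]mulr_algl.
  by rewrite derE !jK (tw_dj tw).
- move=> u Bu.
  have belowE t : stage_below ((fun s => inv (oconst s)) @` A0) B le
      (fun u => [set t | stage u (val t)]) u t <-> stages (below u) (val t).
    split=> [[[s As <-]|[v [Bv vu luv] vt]]|[[s As ts]|[v [Bv vu] vt]]].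
    + by rewrite iK //; apply: stages_const.
    + by right; exists v => //; split=> //; apply/ltE.
    + by left; exists s => //; rewrite -ts valK.
    + by right; exists v => //; move/ltE: vu => [? ?]; split.
  have B_below f : stages (below u) f -> stages B f by apply: stages_sub => v [].
  have coefP t n : stage u (val t) -> stages (below u) (coeff u (val t) n).
    by move=> /stageP[].
  have coefK t n : stage u (val t) -> val (inv (coeff u (val t) n)) = coeff u (val t) n.
    by move=> ut; apply/invK/B_below/coefP.
  have stage1 : stage u (val 1).
    by rewrite val1; apply: (below_stage wo A0_zero Bu); apply: stages_const.
  have stage_omonP n : stage u (omon u n) by apply: stage_omon => //; exact: A0_zero.
  pose zp n := inv (omon u n).
  have zpK n : val (zp n) = omon u n by apply: invK; right; exists u.
  pose U := inv (j (gen u)).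
  have UE : U = zp (-1) by rewrite /U j_gen.
  have coefU t n : stage u (val t) ->
      coeff u (val (U * t)) n = coeff u (val t) (n + 1) + d (gen u) (coeff u (val t) n).
    by move=> ut; rewrite valM UE zpK (tw_coefU tw).
  have coefA a t n : stages (below u) (val a) -> stage u (val t) ->
      coeff u (val (a * t)) n = mul (val a) (coeff u (val t) n).
    by move=> ua ut; rewrite valM (tw_coefM tw).
  have stageM s t : stage u (val s) -> stage u (val t) -> stage u (val (s * t)).
    by move=> us ut; rewrite valM; exact: (tw_mul_stage tw).
  have d1 : d (gen u) (oconst 1) = 0.
    by rewrite (tw_dconst tw) // /inner_der mulr1 mul1r subrr oconst0.
  have d0 p : d p 0 = 0.
    by rewrite -oconst0 (tw_dconst tw) ?/inner_der ?mulr0 ?mul0r ?subrr //; exact: A0_zero.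
  have Uzp n : U * zp n = zp (n - 1).
    apply: val_inj; rewrite zpK; apply: omon_coeff => m; rewrite coefU ?zpK //.
    rewrite !coeff_omon; have -> : (m + 1 == n) = (m == n - 1) by apply/eqP/eqP; lia.
    by case: (m == n); rewrite ?d1 ?d0 addr0.
  have zp0 : zp 0 = 1.
    apply: val_inj; rewrite val1; apply: (@coeff_inj _ _ u) => n.
    by rewrite zpK coeff_omon (coeff_below wo n Bu (stages_const _ _ _ A01)).
  (* As for [lmul_var]: if [U * x = 0], each vanishing coefficient of [x] forces the next one to
     vanish. *)
  have Uinj s t : stage u (val s) -> stage u (val t) -> U * s = U * t -> s = t.
    move=> us ut /eqP; rewrite -subr_eq0 -mulrBr => /eqP e; apply/eqP.
    have ust : stage u (val (s - t)) by rewrite valB; apply: (stageB wo A0_zero A0B).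
    rewrite -subr_eq0; apply/eqP/val_inj; move: (s - t) ust e => x ux Ux.
    apply: (@coeff_inj _ _ u) => n; rewrite val0.
    have c0 m : coeff u (0 : Omega) m = 0.
      by apply/funext => e; rewrite /coeff; case: ifP.
    have [_ [l xl] _] := (stageP _ _ _ _ _).1 ux.
    suff xk k' m : m < l + k'%:Z -> coeff u (val x) m = 0.
      by rewrite c0 (xk (absz (n - l)%R).+1) //; lia.
    elim: k' m => [|k' IHk] m mk; first by apply: xl; lia.
    have [|mk'] := ltP m (l + k'%:Z); first exact: IHk.
    have m1k : m - 1 < l + k'%:Z by lia.
    by have := coefU x (m - 1) ux; rewrite Ux val0 c0 subrK (IHk _ m1k) d0 addr0.
  have UZ : U * zp 1 = 1 by rewrite Uzp subrr zp0.
  have stU : stage u (val U) by rewrite UE zpK.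
  have stZ : stage u (val (zp 1)) by rewrite zpK.
  have ZU : zp 1 * U = 1.
    by apply: Uinj => //; [exact: stageM|rewrite mulrA UZ mul1r mulr1].
  have zpX m : zp 1 ^+ m = zp m%:Z.
    elim: m => [|m IHm]; first by rewrite expr0 zp0.
    rewrite exprS IHm (_ : m%:Z = m.+1%:Z - 1); last by lia.
    by rewrite -Uzp mulrA ZU mul1r.
  have UX m : U ^+ m = zp (- m%:Z).
    elim: m => [|m IHm]; first by rewrite expr0 oppr0 zp0.
    by rewrite exprS IHm Uzp; congr zp; lia.
  have stA a : stages (below u) (val a) -> stage u (val a).
    exact: (below_stage wo A0_zero Bu).
  have coef_zp a n m : stages (below u) (val a) ->
      inv (coeff u (val (a * zp n)) m) = if m == n then a else 0.
    move=> ua; rewrite coefA ?zpK // coeff_omon; case: ifP => _.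
      by rewrite (tw_mul1 tw) ?valK //; exact: B_below.
    by rewrite -val0 -valM mulr0 valK.
  exists (zp 1); split.
  + apply: subring_closedP => [//|x y ux uy|x y ux uy]; last exact: stageM.
    by rewrite /mkset valB; apply: (stageB wo A0_zero A0B).
  + by move=> t /belowE; exact: stA.
  + by split.
  + move=> a /belowE ua; apply/belowE; rewrite derE.
    exact: (stages_below_act _ tw).
  + move=> f uf; split=> [n|]; first by apply/belowE; rewrite coefK //; exact: coefP.
    have [_ [l fl] _] := (stageP _ _ _ _ _).1 uf.
    by exists l => n nl; rewrite fl // -val0 valK.
  + move=> a aA [l al].
    have a'l : exists l : int, forall n : int, n < l -> val (a n) = 0.
      by exists l => n nl; rewrite al.
    have ab n : stages (below u) (val (a n)) by exact/belowE.
    have [st co] := stage_assemble wo Bu a'l ab.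
    pose f := inv (assemble u (fun n => val (a n))).
    have fK : val f = assemble u (fun n => val (a n)) by apply: invK; right; exists u.
    exists f; split=> [|g [ug ga]].
      by split=> [|n]; rewrite /= fK // co valK.
    apply: val_inj; rewrite fK; apply: (@coeff_inj _ _ u) => n.
    by rewrite co -ga coefK.
  + move=> f g uf ug n.
    have stN : stage u (- val g).
      rewrite -sub0r; apply: (stageB wo A0_zero A0B) => //.
      by apply: (below_stage wo A0_zero Bu); exact/stages0/A0_zero.
    have ufg : stage u (val (f + g)).
      by rewrite valD -(opprK (val g)); apply: (stageB wo A0_zero A0B).
    apply: val_inj; rewrite [RHS]valD !coefK // valD.
    rewrite -{1}(opprK (val g)) -[in LHS](sub0r (val g)) !coeffB.
    have -> : coeff u (0 : Omega) n = 0.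
      by apply/funext => e; rewrite /coeff; case: ifP.
    by rewrite sub0r opprK.
  + move=> a m /belowE ua; split=> n; first by rewrite zpX coef_zp.
    by rewrite UX coef_zp.
  + move=> a /belowE ua; have uza : stage u (val (zp 1 * a)) by apply: stageM => //; exact: stA.
    have rec n : coeff u (val (zp 1 * a)) (n + 1) =
        (if n == 0 then val a else 0) - d (gen u) (coeff u (val (zp 1 * a)) n).
      have := coefU _ n uza; rewrite mulrA UZ mul1r (coeff_below wo n Bu ua) => ->.
      by rewrite addrK.
    (* The recursion [rec] comes from $u(za)=a$. Started below the order of $za$, it shows that this
       order is at least 1; continued upwards, it produces the signs and iterated derivations of the
       commutation rule. *)
    have low n : n < 1 -> coeff u (val (zp 1 * a)) n = 0.
      have [_ [l zl] _] := (stageP _ _ _ _ _).1 uza.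
      suff zk k' m : m < l + k'%:Z -> m < 1 -> coeff u (val (zp 1 * a)) m = 0.
        by apply: (zk (absz (n - l)%R).+1); lia.
      elim: k' m => [|k' IHk] m mk m1; first by apply: zl; lia.
      rewrite -(subrK 1 m) rec ifF ?IHk ?d0 ?subr0 //; lia.
    split=> [n n1|n]; first by rewrite low // -val0 valK.
    apply: val_inj; rewrite coefK //.
    elim: n => [|n IHn].
      by rewrite -[1%:Z]add0r rec low // d0 subr0 expr0 mul1r.
    rewrite (_ : n.+2%:Z = n.+1%:Z + 1); last by lia.
    have valN x : val (- x) = - val x by rewrite -sub0r valB val0 sub0r.
    rewrite rec IHn sub0r exprS mulN1r mulNr iterS -derE -valN.
    congr (val (- _)); move: (iter n _ a) => x.
    rewrite -signr_odd; case: (odd n); rewrite ?expr0 ?expr1 ?mul1r ?mulN1r //.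
    by rewrite /inner_der mulrN mulNr opprB opprK addrC.
  + move=> f g l m uf ug fl gm n nlm; rewrite valM (tw_ordM tw Bu uf ug _ _ nlm).
    * by rewrite -val0 valK.
    * by move=> i il; rewrite -coefK // fl // val0.
    * by move=> i im; rewrite -coefK // gm // val0.
- by move=> p u f Bu uf /=; rewrite derE; exact: (tw_d_stage tw).
- move=> p u f l Bu uf fl n nl; rewrite derE (@tw_ordd _ _ _ tw u p (val f) l Bu uf _ n nl).
    by rewrite -val0 valK.
  move=> m ml; have := fl m ml; move=> /(congr1 val); rewrite val0 invK //.
  have [_ _ /(_ m)] := (stageP _ _ _ _ _).1 uf; apply: stages_sub; by move=> v [].
Qed.

End Towers.

(** * Standard monomials *)

Section Span.
Variables (k : fieldType) (H : lmodType k) (br : H -> H -> H) (K : algType k).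
Variables (A : nzRingType) (i : K -> A) (jA : H -> A).
Variables (delta : H -> K -> K) (t : H -> H -> K).
Hypotheses (i1 : i 1 = 1) (iB : forall a b, i (a - b) = i a - i b)
  (iM : forall a b, i (a * b) = i a * i b)
  (j_lin : forall (a : k) x y, jA (a *: x + y) = i a%:A * jA x + jA y)
  (ji : forall x a, jA x * i a = i a * jA x + i (delta x a))
  (jj : forall x y, jA x * jA y - jA y * jA x = jA (br x y) + i (t x y)).
Variables (N E : set H) (le : rel H).
Hypotheses (N_br : forall x y, N x -> N y -> N (br x y)) (EN : E `<=` N)
  (E_span : forall x, N x -> exists (s : seq H) (a : H -> k),
     {subset s <= E} /\ x = \sum_(b <- s) a b *: b)
  (le_total : {in E &, total le}).

Definition monomial (w : seq H) : A := \prod_(x <- w) jA x.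
Local Notation mon := monomial.

(** The filtration by length of words. The maps [i] and [jA] are abstract because the rewriting
    takes place both in the crossed product and in its product with a target ring. *)
Inductive lspan (n : nat) : A -> Prop :=
| SpanZero : lspan n 0
| SpanCons a w y of standard_monomial E le w & (size w <= n)%N & lspan n y :
    lspan n (i a * mon w + y).

Let i0 : i 0 = 0. Proof. by rewrite -(subrr 0) iB subrr. Qed.
Let iN a : i (- a) = - i a. Proof. by rewrite -sub0r iB i0 sub0r. Qed.

Let j0 : jA 0 = 0.
Proof.
have /eqP := j_lin 1 0 0; rewrite scaler0 addr0 scale1r i1 mul1r.
by rewrite -{1}[jA 0]addr0 (inj_eq (addrI _)) => /eqP.
Qed.

Lemma mon_cons x w : mon (x :: w) = jA x * mon w.
Proof. by rewrite /mon big_cons. Qed.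

Lemma span_leq n m y : (n <= m)%N -> lspan n y -> lspan m y.
Proof.
move=> nm; elim=> [|a w z sw wn _ IH]; first exact: SpanZero.
by apply: SpanCons => //; exact: leq_trans nm.
Qed.

Lemma spanD n y z : lspan n y -> lspan n z -> lspan n (y + z).
Proof.
move=> + nz; elim=> [|a w x sw wn _ IH]; first by rewrite add0r.
by rewrite -addrA; apply: SpanCons.
Qed.

Lemma span_mon n a w : standard_monomial E le w -> (size w <= n)%N ->
  lspan n (i a * mon w).
Proof. by move=> sw wn; rewrite -[_ * _]addr0; apply: SpanCons => //; exact: SpanZero. Qed.

Lemma span_scale n a y : lspan n y -> lspan n (i a * y).
Proof.
elim=> [|b w z sw wn _ IH]; first by rewrite mulr0; exact: SpanZero.
by rewrite mulrDr mulrA -iM; apply: SpanCons.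
Qed.

Lemma spanN n y : lspan n y -> lspan n (- y).
Proof. by move=> /(span_scale (- 1)); rewrite iN i1 mulN1r. Qed.

Fixpoint insert_letter x (w : seq H) :=
  if w is y :: w' then if le x y then x :: w else y :: insert_letter x w' else [:: x].

Lemma standard_insert x w : E x -> standard_monomial E le w ->
  standard_monomial E le (insert_letter x w).
Proof.
move=> Ex [wE ws]; have xE : x \in E by rewrite in_setE.
split.
  elim: w wE {ws} => [|y w IHw] wE z /=; first by rewrite mem_seq1 => /eqP ->.
  have yE := wE y (mem_head _ _).
  have w'E : {subset w <= E} by move=> u uw; apply: wE; rewrite in_cons uw orbT.
  case: ifP => _; rewrite !in_cons; first by case/or3P => [/eqP->|/eqP->|/w'E].
  by case/orP => [/eqP->//|]; exact: IHw.
have pathI y v : le y x -> {subset v <= E} -> path le y v -> path le y (insert_letter x v).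
  elim: v y => [|z v IHv] y yx vE /=; first by rewrite yx.
  case/andP=> yz zv; have zE := vE z (mem_head _ _).
  case: ifPn => [xz|xz] /=; first by rewrite yx xz.
  rewrite yz; apply: IHv => //; last by move=> u uv; apply: vE; rewrite in_cons uv orbT.
  by have := le_total xE zE; rewrite (negPf xz).
case: w wE ws => [|y w] wE //= yw; case: ifPn => [xy|xy] /=; first by rewrite xy.
apply: pathI => //; last by move=> u uv; apply: wE; rewrite in_cons uv orbT.
by have := le_total xE (wE y (mem_head _ _)); rewrite (negPf xy).
Qed.

Lemma size_insert x w : size (insert_letter x w) = (size w).+1.
Proof. by elim: w => //= y w IHw; case: ifP => _ //=; rewrite IHw. Qed.

Lemma standard_behead y w : standard_monomial E le (y :: w) -> E y /\ standard_monomial E le w.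
Proof.
move=> [wE ws]; split; first by have := wE y (mem_head _ _); rewrite in_setE.
split; first by move=> u uw; apply: wE; rewrite in_cons uw orbT.
exact: path_sorted ws.
Qed.

(** Moving [x] to the right past a letter [y] leaves the terms of [br x y] and [t x y], which are
    shorter by one and by two letters. The hypothesis is [span_mul] for smaller lengths, so the
    induction there absorbs these terms. *)
Lemma span_insert w x n :
    (forall m, (m < n)%N -> forall z y, N z -> lspan m y -> lspan m.+1 (jA z * y)) ->
    E x -> standard_monomial E le w -> (size w <= n)%N ->
  exists2 r, lspan n r & jA x * mon w = mon (insert_letter x w) + r.
Proof.
elim: w n => [|y w IHw] n Pn Ex sw wn.
  by exists 0; [exact: SpanZero|rewrite addr0 /= mon_cons].
have [Ey sw'] := standard_behead sw.
rewrite /=; case: ifPn => _; first by exists 0; [exact: SpanZero|rewrite addr0 -mon_cons].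
case: n Pn wn => // n Pn wn.
have [r rn re] := IHw n (fun m mn => Pn m (ltnW mn)) Ex sw' wn.
exists (jA y * r + (jA (br x y) * mon w + i (t x y) * mon w)).
  apply: spanD; first by apply: Pn => //; exact: EN.
  apply: spanD; last by apply: span_mon => //; exact: leqW.
  apply: Pn => //; first by apply: N_br; exact: EN.
  by have := span_mon 1 sw' wn; rewrite i1 mul1r.
rewrite !mon_cons mulrA -[jA x * jA y](subrK (jA y * jA x)) jj mulrDl -mulrA re.
by rewrite mulrDl mulrDr addrC -addrA.
Qed.

(** Strong induction on the length. A letter is first moved past the coefficient, where [delta]
    leaves only a shorter word, and then inserted; a general element of [N] is expanded in
    letters. *)
Lemma span_mul n : forall x y, N x -> lspan n y -> lspan n.+1 (jA x * y).
Proof.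
elim/ltn_ind: n => n IHn x y Nx.
have Eb b z : E b -> lspan n z -> lspan n.+1 (jA b * z).
  move=> Eb; elim=> [|a w u sw wn _ IH]; first by rewrite mulr0; exact: SpanZero.
  rewrite mulrDr; apply: spanD => //.
  have [r rn re] := span_insert IHn Eb sw wn.
  rewrite mulrA ji mulrDl -mulrA re; apply: spanD; last by apply: span_mon => //; exact: leqW.
  apply: span_scale; apply: spanD; last exact: span_leq rn.
  rewrite -[mon _]mul1r -i1; apply: span_mon; first exact: standard_insert.
  by rewrite size_insert.
move=> ny; have [s [a [sE ->]]] := E_span Nx.
elim: s sE => [|b s IHs] sE; first by rewrite big_nil j0 mul0r; exact: SpanZero.
rewrite big_cons j_lin mulrDl -mulrA; apply: spanD.
  by apply/span_scale/Eb => //; rewrite -in_setE; apply: sE; exact: mem_head.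
by apply: IHs => u us; apply: sE; rewrite in_cons us orbT.
Qed.

Definition spanned : set A := [set y | exists n, lspan n y].

Lemma spanned_zero : spanned 0. Proof. by exists 0%N; exact: SpanZero. Qed.
Lemma spanned_add y z : spanned y -> spanned z -> spanned (y + z).
Proof.
move=> [n ny] [m mz]; exists (maxn n m); apply: spanD.
  exact: span_leq (leq_maxl _ _) ny.
exact: span_leq (leq_maxr _ _) mz.
Qed.
Lemma spanned_sub y z : spanned y -> spanned z -> spanned (y - z).
Proof. by move=> Ay [n /spanN nz]; apply: spanned_add => //; exists n. Qed.
Lemma spanned_one : spanned 1.
Proof.
exists 0%N; have := @span_mon 0 1 [::]; rewrite i1 mul1r /mon big_nil.
by apply=> //; split.
Qed.
Lemma spanned_scale a y : spanned y -> spanned (i a * y).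
Proof. by move=> [n ny]; exists n; exact: span_scale. Qed.
Lemma spanned_coef a : spanned (i a).
Proof. by rewrite -[i a]mulr1; apply/spanned_scale/spanned_one. Qed.
Lemma spanned_lie_mul x y : N x -> spanned y -> spanned (jA x * y).
Proof. by move=> Nx [n ny]; exists n.+1; exact: span_mul. Qed.
Lemma spanned_lie x : N x -> spanned (jA x).
Proof. by move=> Nx; rewrite -[jA x]mulr1; apply/spanned_lie_mul/spanned_one. Qed.
Lemma spanned_monomial w y : {subset w <= E} -> spanned y -> spanned (mon w * y).
Proof.
elim: w => [|x w IHw] wE Ay; first by rewrite /mon big_nil mul1r.
rewrite mon_cons -mulrA; apply: spanned_lie_mul.
  by apply: EN; rewrite -in_setE; apply: wE; exact: mem_head.
by apply: IHw => // u uw; apply: wE; rewrite in_cons uw orbT.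
Qed.
Lemma spanned_mul y z : spanned y -> spanned z -> spanned (y * z).
Proof.
move=> [n] + Az; elim=> [|a w u [wE _] _ _ IH]; first by rewrite mul0r; exact: spanned_zero.
rewrite mulrDl -mulrA; apply: spanned_add => //.
exact/spanned_scale/spanned_monomial.
Qed.

(** Coefficients of equal words are collected, because freeness of the monomials is stated for lists
    without repetition. *)
Lemma spanned_uniq y : spanned y -> exists (ws : seq (seq H)) (r : seq H -> K),
  [/\ uniq ws, forall w, w \in ws -> standard_monomial E le w
    & y = \sum_(w <- ws) i (r w) * mon w].
Proof.
move=> [n]; elim=> [|a w z sw _ _ [ws [r [uws sws ->]]]].
  by exists [::], (fun=> 0); rewrite big_nil.
have iD b c : i (b + c) = i b + i c by rewrite -{1}(opprK c) iB iN opprK.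
have [wws|wws] := boolP (w \in ws).
  exists ws, (fun v => if v == w then a + r v else r v); split=> //.
  rewrite !(bigD1_seq w) //= eqxx iD mulrDl -addrA; congr (_ + (_ + _)).
  by apply: eq_bigr => v /negPf ->.
exists (w :: ws), (fun v => if v == w then a else r v); split.
- by rewrite /= wws.
- by move=> v; rewrite in_cons => /orP[/eqP->//|]; exact: sws.
- rewrite big_cons eqxx; congr (_ + _); rewrite big_seq [RHS]big_seq.
  by apply: eq_bigr => v vws; case: eqP => // vw; rewrite -vw vws in wws.
Qed.

End Span.

(** * The universal property of the crossed product *)

Section Lift.
Variables (k : fieldType) (H : lmodType k) (br : {bilinear H -> H -> H}).
Variables (K S : algType k) (iota : {lrmorphism K -> S}) (bar : {linear H -> S}).
Variables (delta : {bilinear H -> K -> K}) (t : {bilinear H -> H -> K}).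
Hypotheses (bar_iota : forall x a, bar x * iota a = iota a * bar x + iota (delta x a))
  (bar_bar : forall x y, bar x * bar y - bar y * bar x = bar (br x y) + iota (t x y)).
Hypothesis cp : crossed_product br iota bar.
Variables (Q : nzRingType) (iQ : K -> Q) (jQ : H -> Q).
Hypotheses (iQ1 : iQ 1 = 1) (iQB : forall a b, iQ (a - b) = iQ a - iQ b)
  (iQM : forall a b, iQ (a * b) = iQ a * iQ b)
  (jQ_lin : forall (a : k) x y, jQ (a *: x + y) = iQ a%:A * jQ x + jQ y)
  (jiQ : forall x a, jQ x * iQ a = iQ a * jQ x + iQ (delta x a))
  (jjQ : forall x y, jQ x * jQ y - jQ y * jQ x = jQ (br x y) + iQ (t x y)).

(** The map is obtained from its graph [G], the span over [K] in [S * Q] of the standard monomials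
    in the pairs [(bar x, jQ x)]. Rewriting makes [G] a subring; it projects onto [S] because
    monomials span [S], and injectively because they are independent there. *)
Lemma crossed_product_lift : exists Phi : {rmorphism S -> Q},
  (forall a, Phi (iota a) = iQ a) /\ forall x, Phi (bar x) = jQ x.
Proof.
have [E [le [[_ Espan _] _ _ Etot [Sspan Sfree]]]] := cp_basis cp.
pose P := (S * Q)%type; pose i a : P := (iota a, iQ a); pose j x : P := (bar x, jQ x).
have i1 : i 1 = 1 by rewrite /i rmorph1 iQ1.
have iB a b : i (a - b) = i a - i b by rewrite /i rmorphB iQB.
have iM a b : i (a * b) = i a * i b by rewrite /i rmorphM iQM.
have jlin (a : k) x y : j (a *: x + y) = i a%:A * j x + j y.
  congr pair; last exact: jQ_lin.
  by rewrite linearP /i /= linearZ rmorph1 mulr_algl.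
have ji x a : j x * i a = i a * j x + i (delta x a).
  by congr pair; [exact: bar_iota|exact: jiQ].
have jj x y : j x * j y - j y * j x = j (br x y) + i (t x y).
  by congr pair; [exact: bar_bar|exact: jjQ].
have Esp x : setT x -> exists (s : seq H) (a : H -> k),
    {subset s <= E} /\ x = \sum_(b <- s) a b *: b.
  move=> /Espan[s [a [sE /eqP]]]; rewrite subr_eq0 => /eqP xE.
  by exists s, a.
pose G := spanned i j E le.
have monP w : monomial j w = (\prod_(x <- w) bar x, \prod_(x <- w) jQ x) :> P.
  by elim: w => [|x w IHw]; rewrite /monomial ?big_nil // !big_cons -/(monomial j w) IHw.
have sumP ws (r : seq H -> K) : \sum_(w <- ws) i (r w) * monomial j w =
    (\sum_(w <- ws) iota (r w) * \prod_(x <- w) bar x,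
     \sum_(w <- ws) iQ (r w) * \prod_(x <- w) jQ x) :> P.
  elim: ws => [|w ws IHws]; first by rewrite !big_nil.
  by rewrite !big_cons IHws monP.
have G_fun q : G (0, q) -> q = 0.
  move=> /(spanned_uniq iB)[ws [r [uws sws]]]; rewrite sumP => -[/esym e ->].
  have r0 := Sfree ws r uws sws e; rewrite big_seq big1 // => w wws.
  have -> : r w = 0 by exact: r0.
  by rewrite -(subrr 0) iQB subrr mul0r.
have GB := spanned_sub i1 iB iM (E := E) (le := le).
have G_ex s : exists q, G (s, q).
  have [ws [r [sws ->]]] := Sspan s.
  exists (\sum_(w <- ws) iQ (r w) * \prod_(x <- w) jQ x); rewrite -sumP.
  elim: ws sws => [|w ws IHws] sws; first by rewrite big_nil; exact: spanned_zero.
  rewrite big_cons; apply: spanned_add; last first.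
    by apply: IHws => v vws; apply: sws; rewrite in_cons vws orbT.
  by exists (size w); apply: span_mon => //; apply: sws; exact: mem_head.
pose Phi s : Q := xget 0 [set q | G (s, q)].
have PhiP s : G (s, Phi s) by apply: (@xgetPex _ _ [set q | G (s, q)]); exact: G_ex.
have PhiE s q : G (s, q) -> Phi s = q.
  move=> Gsq; apply/eqP; rewrite -subr_eq0; apply/eqP/G_fun.
  by rewrite -(subrr s); exact: GB (PhiP s) Gsq.
have GM : forall y z, G y -> G z -> G (y * z).
  move=> y z; rewrite /G.
  by apply: (spanned_mul i1 iM jlin ji jj (N := setT)).
have PhiB : zmod_morphism Phi by move=> s s'; apply/PhiE/(GB _ _ _ (PhiP s) (PhiP s')).
have PhiM : monoid_morphism Phi.
  split; first by apply: PhiE; rewrite -[(1, 1)]/(1 : P); exact: spanned_one.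
  by move=> s s'; apply/PhiE/(GM _ _ (PhiP s) (PhiP s')).
pose m1 := GRing.isZmodMorphism.Build S Q Phi PhiB.
pose m2 := GRing.isMonoidMorphism.Build S Q Phi PhiM.
pose PhiR : {rmorphism S -> Q} := HB.pack Phi m1 m2.
exists PhiR; split=> [a|x]; apply: PhiE.
  by rewrite /G; exact: spanned_coef.
by apply: (spanned_lie i1 iM jlin ji jj (N := setT)).
Qed.

End Lift.

(** * Canonical orders *)

Section WoChain.
Variables (T : eqType) (R : rel T) (A : set T).
Hypothesis woR : wo_chain R [in A].

(** A [wo_chain] provides least elements of nonempty subsets; the least element of [{x, y, z}]
    yields transitivity. *)
Lemma wo_chain_trans x y z : A x -> A y -> A z -> R x y -> R y z -> R x z.
Proof.
move=> Ax Ay Az xy yz; pose D : {pred T} := [in [:: x; y; z]].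
have DA : {subset D <= [in A]}.
  move=> w wD; have : w \in [:: x; y; z] by [].
  by rewrite !in_cons in_nil orbF => /or3P[] /eqP ->; exact: mem_set.
have anti := wo_chain_antisymmetric woR.
have [|m [[Dm lbm] _]] := woR DA; first by exists x; exact: mem_head.
have Dx : x \in D by exact: mem_head.
have Dy : y \in D by rewrite [y \in D]mem_seq3 eqxx orbT.
have Dz : z \in D by rewrite [z \in D]mem_seq3 eqxx !orbT.
have {}Dm : m \in [:: x; y; z] by [].
have [Ax' Ay' Az'] : [/\ x \in [in A], y \in [in A] & z \in [in A]].
  by split; exact: mem_set.
move: Dm; rewrite mem_seq3 => /or3P[] /eqP me; rewrite me in lbm.
- exact: lbm.
- by rewrite (anti x y) // xy lbm.
- by rewrite -(anti y z) // yz lbm.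
Qed.

Lemma wo_chain_ind (P : set T) :
  (forall u, A u -> (forall v, A v -> v != u -> R v u -> P v) -> P u) ->
  forall u, A u -> P u.
Proof.
move=> Pind u Au; apply: contrapT => nPu; pose D : {pred T} := [in A `\` P].
have DA : {subset D <= [in A]} by move=> w; rewrite !in_setE => -[].
have [|m [[]]] := woR DA; first by exists u; rewrite in_setE.
rewrite in_setE => -[Am nPm] lbm _; apply: nPm; apply: Pind => // v Av vm Rvm.
apply: contrapT => nPv; move: vm; rewrite (wo_chain_antisymmetric woR (x := v) (y := m)) ?eqxx ?in_setE //.
by rewrite Rvm lbm // in_setE.
Qed.
End WoChain.

Definition slt (T : eqType) (le : rel T) (v u : T) : Prop := v != u /\ le v u.

Section RNSeries.
Variables (k : fieldType) (H : lmodType k) (br : {bilinear H -> H -> H}).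
Variables (Hs C : nat -> set H) (rnH : rn_series br Hs) (qC : q_basis Hs C).
Variables (le : rel H) (canC : canonical_order C le).

Definition layers (m : nat) : set H := \bigcup_(i in [set i | (i < m)%N]) C i.
Definition all_layers : set H := \bigcup_i C i.
Local Notation slt := (slt le).

Lemma Hs_leq m n : (m <= n)%N -> Hs n `<=` Hs m.
Proof.
move=> mn x; rewrite -(subnK mn) addnC.
by elim: (n - m)%N => [|i IHi]; rewrite ?addn0 // addnS => /(rn_desc rnH).
Qed.

Lemma Hs_submod m a x y : Hs m x -> Hs m y -> Hs m (a *: x + y).
Proof.
have [_ /(_ a x y)] := lie_ideal_submod (rn_ideal rnH m).
by rewrite !in_setE => h hx hy; exact: h.
Qed.

Lemma Hs0 m : Hs m 0.
Proof. by have [] := lie_ideal_submod (rn_ideal rnH m); rewrite in_setE. Qed.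

Lemma layer_nmem i u : C i u -> ~ Hs i.+1 u.
Proof.
move=> Ciu Hu; have [_ _ free] := q_basis_layer qC i.
have := free [:: u] (fun=> 1) isT; rewrite big_seq1 scale1r => f.
have /(_ u (mem_head _ _)) : {in [:: u], forall b : H, (1 : k) = 0}.
  by apply: f => // v; rewrite mem_seq1 => /eqP ->; rewrite in_setE.
by apply/eqP/oner_neq0.
Qed.

Lemma layer_sub i : C i `<=` Hs i. Proof. exact: basis_sub (q_basis_layer qC i). Qed.

Lemma layer_uniq i i' u : C i u -> C i' u -> i = i'.
Proof.
wlog ii' : i i' / (i <= i')%N => [wl Ci Ci'|Ci Ci'].
  by case: (leqP i i') => [/wl|/ltnW /wl]; [exact|move=> ->].
move: ii'; rewrite leq_eqVlt => /orP[/eqP//|ii'].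
by case: (layer_nmem Ci); apply: (Hs_leq ii'); exact: layer_sub.
Qed.

Lemma layer_wo i : wo_chain le [in C i].
Proof. exact: (@canonical_layer _ _ _ canC i). Qed.

Lemma le_across i j u v : C i u -> C j v -> i != j -> le u v = (j < i)%N.
Proof. exact: (canonical_across canC). Qed.

Lemma sltP i j u v : C i u -> C j v ->
  slt u v <-> (j < i)%N \/ [/\ i = j, u != v & le u v].
Proof.
move=> Ciu Cjv; have [ij|ij] := eqVneq i j.
  by split=> [[? ?]|[|[]//]]; [right|rewrite ij ltnn].
rewrite /slt (le_across Ciu Cjv ij); split=> [[_]|[ji|[]]]; first by left.
  split=> //; apply: contra_neq ij => uv; apply: (layer_uniq Ciu); rewrite uv //.
by move=> /eqP; rewrite (negPf ij).
Qed.

Lemma all_layers_total : {in all_layers &, total le}.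
Proof.
move=> u v; rewrite !in_setE => -[i _ Ciu] [j _ Cjv].
have [ij|ij] := eqVneq i j.
  subst j; have tot : {in [in C i] &, total le} := wo_chainW (@layer_wo i).
  by apply: tot; exact: mem_set.
rewrite (le_across Ciu Cjv ij) (le_across Cjv Ciu); last by rewrite eq_sym.
by case: ltngtP ij.
Qed.

(** Finitely many well-ordered layers are stacked. All layers together need not be well-ordered:
    layers of growing index descend, which is why the series ring is built level by level. *)
Lemma layers_well_ordered n : well_ordered (layers n) slt.
Proof.
split.
- by move=> u []; rewrite eqxx.
- move=> u v w [i _ Ciu] [j _ Cjv] [l _ Clw] /(sltP Ciu Cjv) uv /(sltP Cjv Clw) vw.
  apply/(sltP Ciu Clw).
  case: uv => [ji|[ij uv luv]]; case: vw => [lj|[jl vw lvw]].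
  + by left; exact: ltn_trans ji.
  + by left; rewrite -jl.
  + by left; rewrite ij.
  + right; subst i l; split=> //; last exact: (wo_chain_trans (@layer_wo j) Ciu Cjv Clw).
    apply: contra_neq uv => uw; subst w.
    have anti := wo_chain_antisymmetric (@layer_wo j).
    by apply: anti; rewrite ?luv //; exact: mem_set.
- move=> u v [i _ Ciu] [j _ Cjv]; have [<-|uv] := eqVneq u v; first by apply: Or32.
  have vu : v != u by rewrite eq_sym.
  have := @all_layers_total u v; rewrite !in_setE.
  move=> /(_ (ex_intro2 _ _ i I Ciu) (ex_intro2 _ _ j I Cjv)) /orP[uv'|vu'].
    by apply: Or31.
  by apply: Or33.
- move=> P Pind.
  (* [d] bounds [n - i]: the induction goes from the last layer, which holds the smallest letters,
     up to the first. *)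
  suff Pi d : forall i u, (n <= i + d)%N -> (i < n)%N -> C i u -> P u.
    by move=> u [i /= ilt Ciu]; apply: (Pi n i u _ ilt Ciu); rewrite leq_addl.
  elim: d => [i u|d IHd i u nid ilt]; first by rewrite addn0 leqNgt => /negP.
  move: u; apply: (wo_chain_ind (@layer_wo i)) => u Ciu IHu.
  apply: Pind; first by exists i.
  move=> v [j /= jn Cjv] /(sltP Cjv Ciu) [ij|[ji vu lvu]].
    by apply: (IHd j v) => //; lia.
  by subst j; exact: IHu.
Qed.

(** * Coordinates in the Q-basis *)

Lemma span_uniq (E : set H) (s : seq H) (a : H -> k) : {subset s <= E} ->
  exists (s' : seq H) (a' : H -> k), [/\ uniq s', {subset s' <= E}
    & \sum_(b <- s) a b *: b = \sum_(b <- s') a' b *: b].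
Proof.
elim: s => [|b s IHs] sC; first by exists [::], a.
have [|s' [a' [us' s'C e]]] := IHs; first by move=> c cs; apply: sC; rewrite in_cons cs orbT.
have bC : b \in E by apply: sC; exact: mem_head.
rewrite big_cons e; have [bs'|bs'] := boolP (b \in s').
  exists s', (fun c => if c == b then a b + a' c else a' c); split=> //.
  rewrite !(bigD1_seq b) //= eqxx scalerDl -addrA; congr (_ + (_ + _)).
  by apply: eq_bigr => c /negPf ->.
exists (b :: s'), (fun c => if c == b then a b else a' c); split=> /=.
- by rewrite bs'.
- by move=> c; rewrite in_cons => /orP[/eqP->//|]; exact: s'C.
rewrite big_cons eqxx; congr (_ + _); rewrite big_seq [RHS]big_seq.
by apply: eq_bigr => c cs'; case: eqP => // cb; rewrite -cb cs' in bs'.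
Qed.

Lemma coords_exists x : exists sa : seq H * (H -> k), [/\ uniq sa.1,
  {subset sa.1 <= all_layers} & x = \sum_(b <- sa.1) sa.2 b *: b].
Proof.
have [s [a [sC /eqP]]] := basis_span (q_basis_total qC) (x := x) I.
rewrite subr_eq0 => /eqP ->; have [s' [a' [us' s'C ->]]] := span_uniq a sC.
by exists (s', a').
Qed.

(** A chosen finite list of letters expressing [x], possibly larger than its support; only the
    coordinates are canonical ([coord_unique]). *)
Definition qsupp (x : H) := (sval (cid (coords_exists x))).1.
Definition qcoord (x b : H) : k :=
  if b \in qsupp x then (sval (cid (coords_exists x))).2 b else 0.

Lemma supp_uniq x : uniq (qsupp x). Proof. by rewrite /qsupp; case: cid => ? []. Qed.
Lemma supp_sub x : {subset qsupp x <= all_layers}.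
Proof. by rewrite /qsupp; case: cid => ? []. Qed.
Lemma coordE x : x = \sum_(b <- qsupp x) qcoord x b *: b.
Proof.
rewrite {1}[x](_ : x = \sum_(b <- qsupp x) (sval (cid (coords_exists x))).2 b *: b).
  by rewrite big_seq [RHS]big_seq; apply: eq_bigr => b bs; rewrite /qcoord bs.
by rewrite /qsupp; case: cid => ? [].
Qed.
Lemma coord_out x b : b \notin qsupp x -> qcoord x b = 0.
Proof. by rewrite /qcoord => /negPf ->. Qed.

Lemma sum_widen (V : lmodType k) (s U : seq H) (a : H -> k) (g : H -> V) :
    uniq s -> uniq U -> {subset s <= U} -> (forall b, b \notin s -> a b = 0) ->
  \sum_(b <- s) a b *: g b = \sum_(b <- U) a b *: g b.
Proof.
move=> us uU sU a0; rewrite [RHS](bigID (mem s)) /=.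
rewrite [X in _ + X]big1 ?addr0; last by move=> b /a0 ->; rewrite scale0r.
rewrite -[RHS]big_filter; apply: perm_big; apply: uniq_perm => //.
  exact: filter_uniq.
by move=> b; rewrite mem_filter; case: (boolP (b \in s)) => //= /sU ->.
Qed.

Lemma coord_unique (s : seq H) (a : H -> k) x : uniq s -> {subset s <= all_layers} ->
  (forall b, b \notin s -> a b = 0) -> x = \sum_(b <- s) a b *: b ->
  forall b, qcoord x b = a b.
Proof.
move=> us sC a0 xE b; pose U := undup (s ++ qsupp x).
have uU : uniq U by exact: undup_uniq.
have sU : {subset s <= U} by move=> c; rewrite mem_undup mem_cat => ->.
have xU : {subset qsupp x <= U} by move=> c; rewrite mem_undup mem_cat => ->; rewrite orbT.
have [bU|bU] := boolP (b \in U); last first.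
  rewrite a0 ?coord_out //; first by apply: contra bU; exact: xU.
  by apply: contra bU; exact: sU.
apply/eqP; rewrite -subr_eq0; apply/eqP.
have := Defs.basis_free (q_basis_total qC) (s := U) (a := fun c => qcoord x c - a c) uU.
move=> H1; apply: H1 bU.
  by move=> c; rewrite mem_undup mem_cat => /orP[/sC|/supp_sub].
have := sum_widen (fun c => c) us uU sU a0.
have := sum_widen (fun c => c) (supp_uniq x) uU xU (@coord_out x).
rewrite -coordE -xE => e1 e2; rewrite /set1 /mkset.
by under eq_bigr do rewrite scalerBl; rewrite sumrB -e1 -e2 subrr.
Qed.

Lemma coord_lin a x y b : qcoord (a *: x + y) b = a * qcoord x b + qcoord y b.
Proof.
pose U := undup (qsupp x ++ qsupp y).
have uU : uniq U by exact: undup_uniq.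
have xU : {subset qsupp x <= U} by move=> c; rewrite mem_undup mem_cat => ->.
have yU : {subset qsupp y <= U} by move=> c; rewrite mem_undup mem_cat => ->; rewrite orbT.
apply: (@coord_unique U (fun c => a * qcoord x c + qcoord y c)) => //.
- by move=> c; rewrite mem_undup mem_cat => /orP[/supp_sub|/supp_sub].
- move=> c; rewrite mem_undup mem_cat negb_or => /andP[/coord_out -> /coord_out ->].
  by rewrite mulr0 addr0.
- have := sum_widen (fun c => c) (supp_uniq x) uU xU (@coord_out x).
  have := sum_widen (fun c => c) (supp_uniq y) uU yU (@coord_out y).
  rewrite -!coordE => e1 e2; rewrite {1}e1 {1}e2 scaler_sumr -big_split /=.
  by apply: eq_bigr => c _; rewrite scalerDl scalerA.
Qed.

Lemma coord_basis u v : all_layers u -> qcoord u v = (u == v)%:R.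
Proof.
move=> Cu; rewrite (@coord_unique [:: u] (fun v => (u == v)%:R)) //.
- by move=> c; rewrite mem_seq1 => /eqP ->; rewrite in_setE.
- by move=> b; rewrite mem_seq1 eq_sym => /negPf ->.
- by rewrite big_seq1 eqxx scale1r.
Qed.

(** Induction on the layer. If the coordinates in the layers before [i] vanish, the layers after [i]
    contribute an element of [Hs i.+1], hence so does layer [i], and independence modulo [Hs i.+1]
    kills its coordinates. This ties the total basis to the bases of the layers. *)
Lemma Hs_coord m x : Hs m x <-> forall i b, (i < m)%N -> C i b -> qcoord x b = 0.
Proof.
split=> [Hx i|x0]; last first.
  rewrite (coordE x) big_seq; apply: big_rec => [|b y bs Hy]; first exact: Hs0.
  have [i _ Cib] := set_mem (supp_sub bs); have [im|mi] := ltnP i m.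
    by rewrite (x0 i) // scale0r add0r.
  by apply: Hs_submod => //; apply: (Hs_leq mi); exact: layer_sub.
elim/ltn_ind: i => i IHi b im Cib; have [bs|/coord_out//] := boolP (b \in qsupp x).
have [_ _ free] := q_basis_layer qC i.
pose s := [seq c <- qsupp x | `[< C i c >]].
apply: (free s (qcoord x)) => [|c||].
- by apply: filter_uniq; exact: supp_uniq.
- by rewrite mem_filter in_setE => /andP[/asboolP].
- have e : \sum_(c <- s) qcoord x c *: c =
      x - \sum_(c <- qsupp x | ~~ `[< C i c >]) qcoord x c *: c.
    apply: (canRL (addrK _)); rewrite [RHS](coordE x).
    by rewrite [RHS](bigID (fun c => `[< C i c >])) /= big_filter.
  rewrite e -scaleN1r addrC; apply: Hs_submod; last exact: (Hs_leq im).
  rewrite big_seq_cond; apply: big_rec => [|c y /andP[cs /asboolP nCi] Hy]; first exact: Hs0.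
  have [j _ Cjc] := set_mem (supp_sub cs); have [ji|ij|ij] := ltngtP j i.
  + by rewrite (IHi j ji c) ?scale0r ?add0r //; exact: ltn_trans im.
  + by apply: Hs_submod => //; apply: (Hs_leq ij); exact: layer_sub.
  + by rewrite ij in Cjc.
- by rewrite mem_filter bs andbT; apply/asboolP.
Qed.

Definition lin_ext (V : lmodType k) (g : H -> V) (x : H) : V :=
  \sum_(b <- qsupp x) qcoord x b *: g b.

Lemma lin_ext_lin (V : lmodType k) (g : H -> V) a x y :
  lin_ext g (a *: x + y) = a *: lin_ext g x + lin_ext g y.
Proof.
pose z := a *: x + y; pose U := undup (qsupp x ++ qsupp y ++ qsupp z).
have uU : uniq U by exact: undup_uniq.
have xU : {subset qsupp x <= U} by move=> c cs; rewrite mem_undup !mem_cat cs.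
have yU : {subset qsupp y <= U} by move=> c cs; rewrite mem_undup !mem_cat cs orbT.
have zU : {subset qsupp z <= U} by move=> c cs; rewrite mem_undup !mem_cat cs !orbT.
rewrite /lin_ext -/z (sum_widen _ (supp_uniq x) uU xU (@coord_out x)).
rewrite (sum_widen _ (supp_uniq y) uU yU (@coord_out y)).
rewrite (sum_widen _ (supp_uniq z) uU zU (@coord_out z)).
rewrite scaler_sumr -big_split /=; apply: eq_bigr => c _.
by rewrite coord_lin scalerDl scalerA.
Qed.

Lemma lin_ext_basis (V : lmodType k) (g : H -> V) u : all_layers u -> lin_ext g u = g u.
Proof.
move=> Cu; rewrite /lin_ext.
have us : {subset [:: u] <= qsupp u}.
  move=> c; rewrite mem_seq1 => /eqP ->; apply/negPn/negP => /coord_out/eqP.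
  by rewrite coord_basis // eqxx oner_eq0.
rewrite -(@sum_widen V [:: u]) ?supp_uniq //; first by rewrite big_seq1 coord_basis // eqxx scale1r.
by move=> b; rewrite coord_basis // mem_seq1 eq_sym => /negPf ->.
Qed.

(** * The towers of a crossed product *)

Section CpSub.
Variables (S : nzRingType) (G : set S).
(** [cp_sub iota bar N] is an instance, by conversion. *)
Definition gen_subring : set S := smallest (fun A : set S => subring_closed [in A]) G.

Lemma gen_subring_sub : G `<=` gen_subring.
Proof. by move=> x Gx A [_]; exact. Qed.
Lemma gen_subring_ind (A : set S) : A 1 ->
  (forall x y, A x -> A y -> A (x - y)) -> (forall x y, A x -> A y -> A (x * y)) ->
  G `<=` A -> gen_subring `<=` A.
Proof.
by move=> A1 AB AM GA x Gx; apply: (Gx A); split=> //; exact: subring_closedP.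
Qed.
Lemma gen_subring1 : gen_subring 1.
Proof. by move=> A [[A1 _ _] _]; rewrite in_setE in A1. Qed.
Lemma gen_subringB x y : gen_subring x -> gen_subring y -> gen_subring (x - y).
Proof.
move=> Gx Gy A [cA GA]; have [_ AB _] := cA; have := AB x y; rewrite !in_setE.
by apply; [exact: Gx|exact: Gy].
Qed.
Lemma gen_subringM x y : gen_subring x -> gen_subring y -> gen_subring (x * y).
Proof.
move=> Gx Gy A [cA GA]; have [_ _ AM] := cA; have := AM x y; rewrite !in_setE.
by apply; [exact: Gx|exact: Gy].
Qed.
Lemma gen_subring0 : gen_subring 0.
Proof. by rewrite -(subrr 1); apply: gen_subringB; exact: gen_subring1. Qed.
Lemma gen_subring_der d : (forall x, G x -> gen_subring (inner_der d x)) ->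
  forall x, gen_subring x -> gen_subring (inner_der d x).
Proof.
move=> Gd x Gx; suff [] : gen_subring x /\ gen_subring (inner_der d x) by [].
move: x Gx; apply: (@gen_subring_ind [set x | gen_subring x /\ gen_subring (inner_der d x)]).
- split; first exact: gen_subring1.
  rewrite /inner_der mulr1 mul1r subrr -(subrr 1).
  exact: (gen_subringB gen_subring1 gen_subring1).
- by move=> x y [Gx dx] [Gy dy]; rewrite /mkset inner_derB; split; exact: gen_subringB.
- move=> x y [Gx dx] [Gy dy]; rewrite /mkset inner_derM; split; first exact: gen_subringM.
  rewrite -(opprK (x * _)); apply: gen_subringB; first exact: gen_subringM.
  rewrite -sub0r; apply: gen_subringB; last exact: gen_subringM.
  by rewrite -(subrr 1); exact: (gen_subringB gen_subring1 gen_subring1).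
- by move=> x Gx; split; [exact: gen_subring_sub|exact: Gd].
Qed.
End CpSub.

Section CrossedTower.
Variables (K S : algType k) (iota : {lrmorphism K -> S}) (bar : {linear H -> S}).
Hypotheses (cpS : crossed_product br iota bar).

(** The empty word and the words of one letter are standard, so their coefficients are independent.
    The letters are those of the basis supplied by the crossed product, which need not be the
    Q-basis. *)
Lemma cp_bar_iota0 x a : bar x + iota a = 0 -> x = 0 /\ a = 0.
Proof.
have [E [leE [[_ Espan _] _ _ _ [_ Sfree]]]] := cp_basis cpS.
have [s0 [a0 [s0E /eqP]]] := Espan x I; rewrite subr_eq0 => /eqP x0E.
have [s [c [us sE xE]]] : exists (s : seq H) (c : H -> k), [/\ uniq s,
    {subset s <= E} & x = \sum_(b <- s) c b *: b].
  by rewrite x0E; exact: span_uniq.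
pose ws : seq (seq H) := [::] :: [seq [:: b] | b <- s].
pose r (w : seq H) : K := if w is b :: _ then (c b)%:A else a.
move=> e; have r0 : {in ws, forall w, r w = 0}.
  apply: Sfree.
  - rewrite /ws /= map_inj_uniq ?us ?andbT //; last by move=> u v [].
    by apply/mapP => -[].
  - move=> w; rewrite in_cons => /orP[/eqP->|/mapP[b bs ->]]; first by split.
    by split=> // u; rewrite mem_seq1 => /eqP ->; exact: sE.
  - rewrite big_cons big_nil mulr1 big_map addrC -[RHS]e; congr (_ + _).
    rewrite [in RHS]xE linear_sum; apply: eq_bigr => b _.
    by rewrite big_seq1 linearZ /= linearZ /= rmorph1 mulr_algl.
split; last by apply: (r0 [::]); exact: mem_head.
rewrite xE big_seq big1 // => b bs; have /eqP : r [:: b] = 0.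
  by apply: r0; rewrite in_cons map_f ?orbT.
by rewrite /= scaler_eq0 oner_eq0 orbF => /eqP ->; rewrite scale0r.
Qed.

Local Notation M := (H * K)%type.
Variables (delta : {bilinear H -> K -> K}) (t : {bilinear H -> H -> K}).
Hypotheses (bar_iota : forall x a, bar x * iota a = iota a * bar x + iota (delta x a))
  (bar_bar : forall x y, bar x * bar y - bar y * bar x = bar (br x y) + iota (t x y)).

(* [H + K] as a Lie subalgebra of [S] *)
Definition mu (p : M) : S := bar p.1 + iota p.2.
Definition brM (p q : M) : M := (br p.1 q.1,
  t p.1 q.1 + delta p.1 q.2 - delta q.1 p.2 + (p.2 * q.2 - q.2 * p.2)).

(** Injectivity lets bilinearity, antisymmetry and the Jacobi identity of [brM] be pulled back from
    commutators in [S], instead of being derived from identities between [br], [delta] and [t]. *)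
Lemma mu_inj : injective mu.
Proof.
move=> [x a] [y b] e; have [] := @cp_bar_iota0 (x - y) (a - b).
  by rewrite linearB rmorphB addrACA -opprD; apply/eqP; rewrite subr_eq0; apply/eqP.
by move=> /eqP; rewrite subr_eq0 => /eqP -> /eqP; rewrite subr_eq0 => /eqP ->.
Qed.

Lemma mu_lin : linear mu.
Proof.
move=> a [x b] [y c]; rewrite /mu /= !linearP /= scalerDr.
by rewrite addrACA.
Qed.

Lemma inner_derD (T : nzRingType) (x y s : T) :
  inner_der (x + y) s = inner_der x s + inner_der y s.
Proof. by rewrite /inner_der mulrDl mulrDr opprD addrACA. Qed.
Lemma inner_derN (T : nzRingType) (x y : T) : inner_der x y = - inner_der y x.
Proof. by rewrite /inner_der opprB. Qed.
Lemma inner_derDr (T : nzRingType) (x s s' : T) :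
  inner_der x (s + s') = inner_der x s + inner_der x s'.
Proof. by rewrite inner_derN inner_derD opprD -!inner_derN. Qed.
Lemma inner_derZ (a : k) (x s : S) : inner_der (a *: x) s = a *: inner_der x s.
Proof. by rewrite /inner_der -scalerAl -scalerAr scalerBr. Qed.

Lemma inner_bar_iota x a : inner_der (bar x) (iota a) = iota (delta x a).
Proof. by rewrite /inner_der bar_iota addrAC subrr add0r. Qed.

Lemma mu_br p q : mu (brM p q) = inner_der (mu p) (mu q).
Proof.
case: p q => [x a] [y b]; rewrite /mu /= !rmorphD /= !rmorphN /= !rmorphM /=.
have e1 : inner_der (bar x) (bar y) = bar (br x y) + iota (t x y) := bar_bar x y.
rewrite inner_derD !inner_derDr e1 inner_bar_iota.
by rewrite [inner_der (iota a) (bar y)]inner_derN inner_bar_iota -!addrA.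
Qed.

Lemma brM_linearl u : linear (brM^~ u).
Proof.
move=> a p q; apply: mu_inj; rewrite mu_lin !mu_br mu_lin.
by rewrite inner_derD inner_derZ.
Qed.
Lemma brM_anti p q : brM p q = - brM q p.
Proof.
apply: mu_inj; rewrite -scaleN1r -[_ *: _]addr0 mu_lin !mu_br inner_derN.
by rewrite /mu linear0 rmorph0 !addr0 scaleN1r.
Qed.
Lemma brM_linearr u : linear (brM u).
Proof.
by move=> a p q; rewrite !(brM_anti u) brM_linearl opprD scalerN.
Qed.
Lemma brM_alt u : brM u u = 0.
Proof.
apply: mu_inj; rewrite mu_br /inner_der subrr /mu.
by rewrite linear0 rmorph0 addr0.
Qed.
Lemma brM_jacobi p q u : brM p (brM q u) - brM q (brM p u) = brM (brM p q) u.
Proof.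
apply: mu_inj; rewrite addrC -scaleN1r mu_lin !mu_br scaleN1r addrC.
exact: inner_der_br.
Qed.

Variable n : nat.
Local Notation B := (layers n).
Local Notation A0 := (cp_sub iota bar (Hs n)).

Lemma layers_all : B `<=` all_layers. Proof. by move=> u [i _ Ciu]; exists i. Qed.

Lemma cp_sub_iota a : A0 (iota a).
Proof. by apply: gen_subring_sub; left; exists a. Qed.
Lemma cp_sub_bar x : Hs n x -> A0 (bar x).
Proof. by move=> Hx; apply: gen_subring_sub; right; exists x. Qed.

(** The part of [p] that involves no variable: letters of [B] are deleted, and the remaining ones
    lie in [Hs n], hence in the base ring. *)
Definition base_part (p : M) : S :=
  lin_ext (fun b => if `[< B b >] then 0 else bar b) p.1 + iota p.2.

(* [p] as a formal series, the variable attached to [b] being $z_b = \bar b^{-1}$ *)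
Definition formal (p : M) : (H -> int) -> S := fun e =>
  if e == 0 then base_part p else
  if pselect (exists b, B b /\ e = upd 0 b (-1)) is left eb
  then (qcoord p.1 (sval (cid eb)))%:A else 0.

Lemma upd0_inj (b b' : H) : upd 0 b (-1) = upd 0 b' (-1) -> b = b'.
Proof.
by move=> /(congr1 (fun e => e b)); rewrite /upd eqxx; case: eqP.
Qed.

Lemma upd0_neq0 (b : H) : (upd 0 b (-1) == 0) = false.
Proof.
by apply/eqP => /(congr1 (fun e => e b)); rewrite /upd eqxx.
Qed.

Lemma formal_at p b : B b -> formal p (upd 0 b (-1)) = (qcoord p.1 b)%:A.
Proof.
move=> Bb; rewrite /formal upd0_neq0; case: pselect => [eb|]; last by case; exists b.
by case: (cid eb) => b' /= [_ /upd0_inj ->].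
Qed.

Lemma formal_out p e : e != 0 -> ~ (exists b, B b /\ e = upd 0 b (-1)) -> formal p e = 0.
Proof. by rewrite /formal => /negPf -> ne; case: pselect. Qed.

Lemma formal_lin a p q e : formal (a *: p + q) e = a *: formal p e + formal q e.
Proof.
have [->|e0] := eqVneq e 0.
  rewrite /formal eqxx /base_part lin_ext_lin linearP /= scalerDr addrACA //.
have [[b [Bb ->]]|ne] := pselect (exists b, B b /\ e = upd 0 b (-1)).
  by rewrite !formal_at // coord_lin scalerDl scalerA.
by rewrite !formal_out // scaler0 addr0.
Qed.

Lemma formal_gen u : B u -> formal (u, 0) = omon S u (-1).
Proof.
move=> Bu; apply/funext => e; have Cu := layers_all Bu.
have [->|e0] := eqVneq e 0.
  rewrite /omon eq_sym upd0_neq0 /formal eqxx /base_part rmorph0 addr0.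
  by rewrite (lin_ext_basis _ Cu); case: asboolP.
have [[b [Bb ->]]|ne] := pselect (exists b, B b /\ e = upd 0 b (-1)).
  rewrite formal_at // (coord_basis) // /omon.
  have -> : (upd 0 b (-1) == upd 0 u (-1)) = (u == b).
    by apply/eqP/eqP => [/upd0_inj ->|->].
  by case: eqP; rewrite ?scale1r ?scale0r.
rewrite formal_out // /omon; case: eqP => // eu.
by case: ne; exists u.
Qed.

Definition crd (p : M) (b : H) : k := qcoord p.1 b.

Lemma formal_base p : supported_in B crd set0 p ->
  A0 (mu p) /\ formal p = oconst (mu p).
Proof.
move=> p0; have c0 b : B b -> qcoord p.1 b = 0.
  by move=> Bb; apply/eqP/negPn/negP => /(p0 b Bb).
have Hp : Hs n p.1.
  by apply/(Hs_coord) => i b ilt Cib; apply: c0; exists i.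
split.
  rewrite /mu -[iota _]opprK; apply: gen_subringB; first exact: cp_sub_bar.
  by rewrite -rmorphN; exact: cp_sub_iota.
apply/funext => e; have [->|e0] := eqVneq e 0.
  rewrite /formal /oconst eqxx /base_part /mu; congr (_ + _).
  rewrite {2}(coordE p.1) linear_sum; apply: eq_bigr => b _ /=.
  rewrite linearZ /=; case: asboolP => // Bb; rewrite c0 //.
  by rewrite !scale0r.
rewrite /oconst (negPf e0).
have [[b [Bb ->]]|ne] := pselect (exists b, B b /\ e = upd 0 b (-1)).
  by rewrite formal_at // c0 // scale0r.
by rewrite formal_out.
Qed.

(** Let [b] be in layer [i]. If [q] has no coordinate in an earlier layer, where the letters are
    larger, then its first component lies in [Hs i], the bracket falls into [Hs i.+1] by centrality,
    and its coordinate at [b] vanishes. *)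
Lemma coord_br p q b : B b -> crd (brM p q) b != 0 ->
  exists b', [/\ B b', slt b b' & crd q b' != 0].
Proof.
move=> [i /= ilt Cib]; apply: contraNP => nb; apply/eqP.
have Hq : Hs i q.1.
  apply/(Hs_coord) => i' b' i'i Ci'b'; apply/eqP/negPn/negP => qb'.
  apply: nb; exists b'; split=> //; first by exists i' => //=; exact: ltn_trans ilt.
  by apply/(sltP Cib Ci'b'); left.
by have /(Hs_coord) := rn_central rnH p.1 Hq; apply; [exact: ltnSn|exact: Cib].
Qed.

Lemma cp_sub_der p s : A0 s -> A0 (inner_der (mu p) s).
Proof.
apply: gen_subring_der => x [[a _ <-]|[y Hy <-]].
  rewrite inner_derD inner_bar_iota -(opprK (inner_der _ _)).
  apply: gen_subringB; first exact: cp_sub_iota.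
  rewrite /inner_der -!rmorphM -rmorphB -rmorphN; exact: cp_sub_iota.
have -> : bar y = mu (y, 0) by rewrite /mu rmorph0 addr0.
rewrite -mu_br /mu -[iota _]opprK; apply: gen_subringB.
  by apply: cp_sub_bar => /=; apply: (rn_desc rnH); exact: rn_central.
by rewrite -rmorphN; exact: cp_sub_iota.
Qed.

(** The tower of formal series provides a ring map on the base ring and images of the elements of
    $H$. The universal property gives a map on all of [S], and the two agree on the base ring
    because they agree on its generators. *)
Lemma crossed_tower_exists : exists (Q : nzRingType) (Phi : {rmorphism S -> Q})
    (F : H -> set Q) (c : H -> Q -> int -> Q),
  series_tower (Phi @` A0) B le (Phi \o bar) F c.
Proof.
have A0k a : A0 (a%:A : S).
  by have := cp_sub_iota a%:A; rewrite linearZ /= rmorph1.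
have cfin p : exists s : seq H, forall b, B b -> crd p b != 0 -> b \in s.
  by exists (qsupp p.1) => b _; apply: contraNT => /coord_out; rewrite /crd => ->.
have crdl a p q b : crd (a *: p + q) b = a * crd p b + crd q b by exact: coord_lin.
have crdg u v : B u -> B v -> crd (u, 0) v = (u == v)%:R.
  by move=> Bu Bv; apply: (coord_basis); exact: layers_all.
have [Q [i [jQ [F [c [[i1 iB iM] [jl jb j0] tw twd two]]]]]] :=
  full_tower_ring brM_linearl brM_linearr brM_alt brM_anti brM_jacobi
    (layers_well_ordered n) (@gen_subring1 _ _) (@gen_subringB _ _)
    (@gen_subringM _ _) A0k cp_sub_der mu_lin mu_br crdl crdg coord_br formal_lin formal_gen
    formal_base cfin (fun u v => iff_refl _).
have jD p q : jQ (p + q) = jQ p + jQ q.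
  have := jl 1 p q; rewrite scale1r => ->; rewrite scale1r i1 mul1r //.
have s0 x a : Hs n x -> supported_in B crd set0 (x, a).
  move=> Hx b [j jn Cjb]; rewrite /crd /=.
  by rewrite ((Hs_coord n x).1 Hx j b jn Cjb) eqxx.
have jK a : jQ (0, a) = i (iota a).
  by rewrite j0 ?/mu ?linear0 ?add0r //; apply: s0; exact: Hs0.
have [||||||Phi [PhiK Phib]] := @crossed_product_lift _ _ br K S iota bar delta t
  bar_iota bar_bar cpS Q (fun a => i (iota a)) (fun x => jQ (x, 0)).
- by rewrite rmorph1.
- by move=> a b; rewrite rmorphB iB //; exact: cp_sub_iota.
- by move=> a b; rewrite rmorphM iM //; exact: cp_sub_iota.
- move=> a x y; have -> : (a *: x + y, 0) = a *: (x, 0) + (y, 0) :> M.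
    by congr pair; rewrite /= scaler0 addr0.
  by rewrite jl linearZ /= rmorph1.
- move=> x a; apply/eqP; rewrite addrC -subr_eq -!jK.
  rewrite -[_ - _]/(inner_der (jQ (x, 0)) (jQ (0, a))) -jb /brM /=.
  by rewrite !linear0 mul0r mulr0 !subr0 add0r !addr0.
- move=> x y; rewrite -[LHS]/(inner_der (jQ (x, 0)) (jQ (y, 0))) -jb -jK -jD.
  congr jQ; congr pair => /=; first by rewrite addr0.
  by rewrite !linear0 mul0r !subr0 !addr0 add0r.
have PhiA s : A0 s -> Phi s = i s.
  suff H1 : A0 `<=` [set s | A0 s /\ Phi s = i s] by move=> /H1[].
  apply: gen_subring_ind.
  - by split; [exact: gen_subring1|rewrite rmorph1 i1].
  - by move=> x y [Ax ex] [Ay ey]; split; [exact: gen_subringB|rewrite rmorphB iB // ex ey].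
  - by move=> x y [Ax ex] [Ay ey]; split; [exact: gen_subringM|rewrite rmorphM iM // ex ey].
  - move=> _ [[a _ <-]|[x Hx <-]]; first by split; [exact: cp_sub_iota|rewrite PhiK].
    split; first exact: cp_sub_bar.
    by rewrite Phib j0 ?/mu ?rmorph0 ?addr0 //; exact: s0.
have imA : Phi @` A0 = i @` A0.
  by apply/seteqP; split=> _ [s As <-]; exists s => //; rewrite PhiA.
exists Q, Phi, F, c; rewrite imA; split.
- apply: subring_closedP; first by exists 1 => //; exact: gen_subring1.
    move=> _ _ [x Ax <-] [y Ay <-]; exists (x - y); last exact: iB.
    exact: gen_subringB.
  move=> _ _ [x Ax <-] [y Ay <-]; exists (x * y); last exact: iM.
  exact: gen_subringM.
- rewrite -imA => x _ [s As <-]; exists (inner_der (bar x) s).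
    by have := cp_sub_der (x, 0) As; rewrite /mu rmorph0 addr0.
  by rewrite /inner_der rmorphB !rmorphM.
- by move=> u Bu; have [z Lz] := tw u Bu; exists z; rewrite /= Phib.
- by move=> x u f Bu uf; rewrite /= Phib; exact: twd.
- by move=> x u f l Bu uf fl; rewrite /= Phib; exact: two.
Qed.

End CrossedTower.
End RNSeries.

(** * Consequences of the Laurent axioms *)

Section LaurentAxioms.
Variables (T : nzRingType) (A A' : set T) (u z : T) (c : T -> int -> T).
Hypothesis Lr : laurent_ring A A' u z c.
Hypotheses (AM : forall x y, A x -> A y -> A (x * y)) (A1 : A 1).
Local Notation ge := (order_ge c).

Lemma lr1 : A' 1.
Proof. by have [h _ _] := laurent_subring Lr; rewrite in_setE in h. Qed.
Lemma lrB f g : A' f -> A' g -> A' (f - g).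
Proof. by have [_ /(_ f g) h _] := laurent_subring Lr; rewrite !in_setE in h; exact: h. Qed.
Lemma lrM f g : A' f -> A' g -> A' (f * g).
Proof. by have [_ _ /(_ f g) h] := laurent_subring Lr; rewrite !in_setE in h; exact: h. Qed.
Lemma lr0 : A' 0. Proof. by rewrite -(subrr 1); apply: lrB; exact: lr1. Qed.
Lemma lrN f : A' f -> A' (- f).
Proof. by move=> Af; rewrite -sub0r; apply: lrB => //; exact: lr0. Qed.
Lemma lrD f g : A' f -> A' g -> A' (f + g).
Proof. by move=> Af Ag; rewrite -(opprK g); apply/lrB/lrN. Qed.
Lemma lrA a : A a -> A' a. Proof. exact: (laurent_sub Lr). Qed.
Lemma lr_sum I (r : seq I) (P : pred I) (f : I -> T) :
  (forall i, P i -> A' (f i)) -> A' (\sum_(i <- r | P i) f i).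
Proof. by move=> Af; apply: big_ind => //; [exact: lr0|exact: lrD]. Qed.

Lemma lr_cD f g n : A' f -> A' g -> c (f + g) n = c f n + c g n.
Proof. by move=> Af Ag; exact: (laurent_add Lr). Qed.
Lemma lr_c0 n : c 0 n = 0.
Proof.
have /eqP := lr_cD n lr0 lr0; rewrite addr0 -{1}[c 0 n]addr0.
by rewrite (inj_eq (addrI _)) eq_sym => /eqP.
Qed.
Lemma lr_cN f n : A' f -> c (- f) n = - c f n.
Proof.
move=> Af; apply/eqP; rewrite -subr_eq0 opprK -lr_cD //; last exact: lrN.
by rewrite addNr lr_c0.
Qed.
Lemma lr_cB f g n : A' f -> A' g -> c (f - g) n = c f n - c g n.
Proof. by move=> Af Ag; rewrite lr_cD ?lr_cN //; exact: lrN. Qed.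
Lemma lr_csum I (r : seq I) (f : I -> T) n : (forall i, A' (f i)) ->
  c (\sum_(i <- r) f i) n = \sum_(i <- r) c (f i) n.
Proof.
move=> Af; elim: r => [|i r IHr]; first by rewrite !big_nil lr_c0.
by rewrite !big_cons lr_cD ?IHr //; exact: lr_sum.
Qed.
Lemma lr_coefA f n : A' f -> A (c f n).
Proof. by move=> /(laurent_coef Lr)[]. Qed.
Lemma lr_bound f : A' f -> exists l, ge f l.
Proof. by move=> /(laurent_coef Lr)[]. Qed.
Lemma lr_ext f g : A' f -> A' g -> c f =1 c g -> f = g.
Proof.
move=> Af Ag fg; have [cA [l fl]] := laurent_coef Lr Af.
have [|h [_ hu]] := laurent_series Lr cA; first by exists l.
have hg : h = g by apply: hu; split=> // n; rewrite fg.
by rewrite -hg; apply/esym/hu.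
Qed.
Lemma lr_eq0 f : A' f -> (forall n, c f n = 0) -> f = 0.
Proof. by move=> Af f0; apply: lr_ext => // [|n]; [exact: lr0|rewrite f0 lr_c0]. Qed.
Lemma lr_geW f (l m : int) : m <= l -> ge f l -> ge f m.
Proof. by move=> ml fl n nm; apply: fl; lia. Qed.
Lemma lr_geD f g l : A' f -> A' g -> ge f l -> ge g l -> ge (f + g) l.
Proof. by move=> Af Ag fl gl n nl; rewrite lr_cD // fl ?gl ?addr0. Qed.
Lemma lr_geN f l : A' f -> ge f l -> ge (- f) l.
Proof. by move=> Af fl n nl; rewrite lr_cN // fl ?oppr0. Qed.
Lemma lr_ge_mul f g l m : A' f -> A' g -> ge f l -> ge g m -> ge (f * g) (l + m).
Proof. exact: (laurent_order_mul Lr). Qed.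
Lemma lr_u : A' u. Proof. by have [] := laurent_inv Lr. Qed.
Lemma lr_z : A' z. Proof. by have [] := laurent_inv Lr. Qed.
Lemma lr_uz : u * z = 1. Proof. by have [] := laurent_inv Lr. Qed.
Lemma lr_zu : z * u = 1. Proof. by have [] := laurent_inv Lr. Qed.

Definition zpow (n : int) : T := match n with Posz m => z ^+ m | Negz m => u ^+ m.+1 end.

Lemma lrX f m : A' f -> A' (f ^+ m).
Proof.
move=> Af; elim: m => [|m IHm]; first by rewrite expr0; exact: lr1.
by rewrite exprS; exact: lrM.
Qed.
Lemma lr_zpow n : A' (zpow n).
Proof. by case: n => m; apply: lrX; [exact: lr_z|exact: lr_u]. Qed.
Lemma lr_c_mon a n m : A a -> c (a * zpow n) m = if m == n then a else 0.
Proof.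
move=> Aa; case: n => n.
  by have [h _] := laurent_monomial Lr n Aa; rewrite /= h.
by have [_ h] := laurent_monomial Lr n.+1 Aa; rewrite /= h NegzE.
Qed.
Lemma lr_mon a n : A a -> A' (a * zpow n).
Proof. by move=> Aa; apply: lrM; [exact: lrA|exact: lr_zpow]. Qed.
Lemma lr_ge_mon a n : A a -> ge (a * zpow n) n.
Proof. by move=> Aa m mn; rewrite lr_c_mon //; case: eqP => // e; lia. Qed.
Lemma lr_ge_zpow n : ge (zpow n) n.
Proof. by rewrite -[zpow n]mul1r; exact: lr_ge_mon. Qed.
Lemma lr_c_zpow n m : c (zpow n) m = if m == n then 1 else 0.
Proof. by rewrite -[zpow n]mul1r lr_c_mon. Qed.
Lemma lr_ge_A a : A a -> ge a 0.
Proof. by move=> Aa; have := @lr_ge_mon a 0 Aa; rewrite /= expr0 mulr1. Qed.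
Lemma lr_c_A a n : A a -> c a n = if n == 0 then a else 0.
Proof. by move=> Aa; have := lr_c_mon 0 n Aa; rewrite /= expr0 mulr1. Qed.
Lemma lr_u_zpow n : u * zpow n = zpow (n - 1).
Proof.
case: n => [[|m]|m].
- by transitivity u; [exact: mulr1|].
- have e : Posz m.+1 - 1 = Posz m by lia.
  by rewrite e /zpow exprS mulrA lr_uz mul1r.
- have e : Negz m - 1 = Negz m.+1 by rewrite !NegzE; lia.
  by rewrite e /zpow -exprS.
Qed.
Lemma lr_zpowN n : zpow (- n) * zpow n = 1.
Proof.
have zu m : z ^+ m * u ^+ m = 1.
  by elim: m => [|m IHm]; rewrite ?mulr1 // exprSr exprS mulrA -(mulrA _ z) lr_zu mulr1.
have uz m : u ^+ m * z ^+ m = 1.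
  by elim: m => [|m IHm]; rewrite ?mulr1 // exprSr exprS mulrA -(mulrA _ u) lr_uz mulr1.
case: n => [[|m]|m]; [exact: mulr1|exact: (uz m.+1)|exact: (zu m.+1)].
Qed.

Definition lr_trunc f (l : int) (N : nat) :=
  \sum_(k < N) c f (l + k%:Z) * zpow (l + k%:Z).

Lemma lr_truncA f l N : A' f -> A' (lr_trunc f l N).
Proof. by move=> Af; apply: lr_sum => k _; apply/lr_mon/lr_coefA. Qed.
Lemma lr_truncE f l N n : A' f ->
  c (lr_trunc f l N) n = if (l <= n) && (n < l + N%:Z) then c f n else 0.
Proof.
move=> Af; rewrite lr_csum; last by move=> k; apply/lr_mon/lr_coefA.
under eq_bigr => k _ do rewrite (lr_c_mon _ _ (lr_coefA _ Af)).
case: ifP => ln.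
  have lt : (absz (n - l)%R < N)%N by lia.
  have e : l + (absz (n - l)%R)%:Z = n by lia.
  rewrite (bigD1 (Ordinal lt)) // [l + _]e eqxx big1; first exact: addr0.
  move=> k kn; have {}kn : (k : nat) != absz (n - l)%R by [].
  by rewrite ifF //; apply/eqP; lia.
by rewrite big1 // => k _; rewrite ifF //; apply/eqP; have := ltn_ord k; lia.
Qed.
Lemma lr_ge_trunc f l N : A' f -> ge f l -> ge (f - lr_trunc f l N) (l + N%:Z).
Proof.
move=> Af fl n nN; rewrite lr_cB ?lr_truncE //; last exact: lr_truncA.
case: ifP => [_|]; first exact: subrr.
by move=> e; rewrite fl ?subr0 //; lia.
Qed.

(** The axioms give the coefficients of monomials; by the order axiom the tail of [f] beyond degree
    [n] does not contribute, which leaves a finite sum of monomials. *)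
Lemma lr_cAM a f n : A a -> A' f -> c (a * f) n = a * c f n.
Proof.
move=> Aa Af; have [l fl] := lr_bound Af; pose N := (absz (n - l)%R).+1.
have At := lr_truncA l N Af; have A'a := lrA Aa.
rewrite -{1}(subrK (lr_trunc f l N) f) mulrDr lr_cD; [|exact/lrM/lrB|exact: lrM].
have -> : c (a * (f - lr_trunc f l N)) n = 0.
  by apply: (lr_ge_mul A'a _ (lr_ge_A Aa) (lr_ge_trunc Af fl)); [exact: lrB|rewrite /N; lia].
rewrite add0r /lr_trunc mulr_sumr lr_csum; last first.
  by move=> k; apply: lrM => //; apply/lr_mon/lr_coefA.
transitivity (\sum_(k < N) a * c (c f (l + k%:Z) * zpow (l + k%:Z)) n).
  apply: eq_bigr => k _; have Ac := lr_coefA (l + k%:Z) Af.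
  by rewrite mulrA !lr_c_mon //; [case: ifP; rewrite ?mulr0|exact: AM].
rewrite -mulr_sumr -lr_csum; last by move=> k; apply/lr_mon/lr_coefA.
rewrite lr_truncE //; case: ifP => // nl; rewrite [c f n]fl //; move: nl; rewrite /N; lia.
Qed.

(** Only the left factor is truncated. The coefficients of the products $z^i g$ are left as they
    are, since they can be reached one power of the variable at a time. *)
Lemma lr_c_mul f g (l l' : int) (N : nat) n : A' f -> A' g -> ge f l -> ge g l' ->
    n < l + N%:Z + l' ->
  c (f * g) n = \sum_(k < N) c f (l + k%:Z) * c (zpow (l + k%:Z) * g) n.
Proof.
move=> Af Ag fl gl nN; have At := lr_truncA l N Af.
rewrite -{1}(subrK (lr_trunc f l N) f) mulrDl lr_cD; [|exact/lrM/Ag/lrB|exact: lrM].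
have -> : c ((f - lr_trunc f l N) * g) n = 0.
  by apply: (lr_ge_mul _ Ag (lr_ge_trunc Af fl) gl) => //; exact: lrB.
rewrite add0r /lr_trunc mulr_suml lr_csum; last first.
  by move=> k; apply: lrM => //; apply/lr_mon/lr_coefA.
apply: eq_bigr => k _; rewrite -mulrA lr_cAM //; first exact: lr_coefA.
by apply: lrM => //; exact: lr_zpow.
Qed.

Lemma lr_c_u f n : A' f -> c (u * f) n = c f (n + 1) + inner_der u (c f n).
Proof.
move=> Af; have [l fl] := lr_bound Af; pose N := (absz (n - l)%R + 2)%N.
have At := lr_truncA l N Af; have Au := lr_u.
have gu : ge u (-1) by rewrite -[u]mulr1 -[1]/(zpow 0) lr_u_zpow; exact: lr_ge_zpow.
rewrite -{1}(subrK (lr_trunc f l N) f) mulrDr lr_cD; [|exact/lrM/lrB|exact: lrM].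
have -> : c (u * (f - lr_trunc f l N)) n = 0.
  by apply: (lr_ge_mul Au _ gu (lr_ge_trunc Af fl)); [exact: lrB|rewrite /N; lia].
have Aterm k : A' (c f (l + k%:Z) * zpow (l + k%:Z)) by apply/lr_mon/lr_coefA.
have Ad a : A a -> A (inner_der u a) by exact: (laurent_der Lr).
rewrite add0r /lr_trunc mulr_sumr lr_csum; last by move=> k; apply: lrM.
have ucf x m : A x -> u * (x * zpow m) = x * zpow (m - 1) + inner_der u x * zpow m.
  by move=> Ax; rewrite -lr_u_zpow !mulrA -mulrDl addrC /inner_der subrK.
transitivity (\sum_(k < N) (c (c f (l + k%:Z) * zpow (l + k%:Z)) (n + 1) +
    inner_der u (c (c f (l + k%:Z) * zpow (l + k%:Z)) n))).
  apply: eq_bigr => k _; have Ac := lr_coefA (l + k%:Z) Af.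
  rewrite ucf // lr_cD; [|exact: lr_mon|by apply: lr_mon; exact: Ad].
  rewrite !lr_c_mon //; last exact: Ad.
  have -> : (n + 1 == l + k%:Z) = (n == l + k%:Z - 1) by apply/eqP/eqP; lia.
  by congr (_ + _); case: ifP => //; rewrite /inner_der mulr0 mul0r subrr.
rewrite big_split /= -lr_csum //.
have -> (r : seq 'I_N) (h : 'I_N -> T) :
    \sum_(k <- r) inner_der u (h k) = inner_der u (\sum_(k <- r) h k).
  by rewrite /inner_der sumrB -mulr_sumr -mulr_suml.
rewrite -lr_csum // -/(lr_trunc f l N) !lr_truncE //.
have -> : (if (l <= n + 1) && (n + 1 < l + N%:Z) then c f (n + 1) else 0) = c f (n + 1).
  by case: ifP => // nl; rewrite fl //; move: nl; rewrite /N; lia.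
by case: ifP => // nl; rewrite [c f n]fl //; move: nl; rewrite /N; lia.
Qed.

Lemma lr_c_z f n : A' f -> c (z * f) (n + 1) = c f n - inner_der u (c (z * f) n).
Proof.
move=> Af; have := lr_c_u n (lrM lr_z Af); rewrite mulrA lr_uz mul1r => ->.
by rewrite addrK.
Qed.
Lemma lr_ge_z f l : A' f -> ge f l -> ge (z * f) (l + 1).
Proof.
move=> Af fl; rewrite addrC; apply: lr_ge_mul => //; first exact: lr_z.
by have := @lr_ge_zpow 1; rewrite /= expr1.
Qed.

(** The inverse is the geometric series in $-e$. Its coefficient of degree [n] is that of the
    partial sum [q (absz n).+1], as all later terms have order above [n]. *)
Lemma lr_one_plus e : A' e -> ge e 1 -> exists2 q, A' q & q * (1 + e) = 1.
Proof.
move=> Ae e1; pose q N := \sum_(i < N) (- e) ^+ i.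
have Ane : A' (- e) by exact: lrN.
have ge_e i : ge ((- e) ^+ i) i%:Z.
  elim: i => [|i IHi]; first by rewrite expr0; exact: lr_ge_A.
  rewrite exprS (_ : i.+1%:Z = 1 + i%:Z); last by lia.
  by apply: lr_ge_mul => //; [exact: lrX|exact: lr_geN].
have Aq N : A' (q N) by apply: lr_sum => i _; exact: lrX.
have qS N : q N.+1 = q N + (- e) ^+ N by rewrite /q big_ord_recr.
have qe N : q N * (1 + e) = 1 - (- e) ^+ N.
  elim: N => [|N IHN]; first by rewrite /q big_ord0 mul0r expr0 subrr.
  rewrite qS mulrDl IHN mulrDr mulr1 exprSr mulrN opprK.
  by rewrite addrA subrK.
have cq N M n : n < N%:Z -> (N <= M)%N -> c (q M) n = c (q N) n.
  move=> nN /subnK <-; elim: (M - N)%N => [|d IHd]; first by rewrite add0n.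
  rewrite addSn qS lr_cD //; last exact: lrX.
  by rewrite IHd (ge_e (d + N)%N n) ?addr0 //; lia.
pose a (n : int) := c (q (absz n).+1) n.
have [||h [[Ah ha] _]] := laurent_series Lr (a := a).
- by move=> n; apply: lr_coefA.
- exists 0 => n n0; rewrite /a lr_csum; last by move=> i; exact: lrX.
  by rewrite big1 // => i _; apply: ge_e; lia.
have hq N : ge (h - q N) N%:Z.
  move=> n nN; rewrite lr_cB // ha /a; apply/eqP; rewrite subr_eq0; apply/eqP.
  have [n0|n0] := ltP n 0.
    rewrite !lr_csum; [|by move=> i; exact: lrX|by move=> i; exact: lrX].
    by rewrite !big1 // => i _; apply: ge_e; lia.
  by rewrite [RHS](@cq (absz n).+1) //; lia.
exists h => //; apply/eqP; rewrite -subr_eq0; apply/eqP.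
have A1e : A' (1 + e) by apply: lrD => //; exact: lr1.
have Ar : A' (h * (1 + e) - 1) by apply: lrB; [exact: lrM|exact: lr1].
apply: lr_eq0 => // n; pose N := (absz n).+1.
(* Both terms on the right have order at least [N], which exceeds [n]. *)
have -> : h * (1 + e) - 1 = (h - q N) * (1 + e) - (- e) ^+ N.
  have aux (x y : T) : x - 1 = x + (y - 1) - y.
    by rewrite -addrA [y - 1 + _]addrAC subrr add0r.
  by rewrite mulrBl qe opprB.
rewrite lr_cB; [|by apply: lrM => //; exact: lrB|exact: lrX].
rewrite (ge_e N n) ?subr0; last by rewrite /N; lia.
apply: (lr_ge_mul _ A1e (hq N) (m := 0)); [exact: lrB| |by rewrite /N; lia].
apply: lr_geD => //; [exact: lr1|exact: lr_ge_A|by apply: lr_geW e1].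
Qed.

(** One has $bf=z^l+r$ with [r] of order above [l], so that $z^{-l}bf=1+z^{-l}r$ is inverted by the
    geometric series. *)
Lemma lr_left_inverse f l b : A' f -> ge f l -> A b -> b * c f l = 1 ->
  exists2 g, A' g & g * f = 1.
Proof.
move=> Af fl Ab bl; have A'b := lrA Ab; have Abf : A' (b * f) by exact: lrM.
have Zl := lr_zpow l; have ZNl := lr_zpow (- l).
pose r := b * f - zpow l; have Ar : A' r by exact: lrB.
have gr : ge r (l + 1).
  move=> n nl; rewrite lr_cB // lr_cAM // lr_c_zpow.
  have [->|nl'] := eqVneq n l; first by rewrite bl subrr.
  by rewrite fl ?mulr0 ?subr0 //; lia.
have [||q Aq qe] := @lr_one_plus (zpow (- l) * r); first exact: lrM.
  have := lr_ge_mul ZNl Ar (@lr_ge_zpow (- l)) gr; apply: lr_geW; lia.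
exists (q * (zpow (- l) * b)); first by apply: lrM => //; exact: lrM.
rewrite -!mulrA -[b * f](subrK (zpow l)) -/r mulrDr lr_zpowN addrC.
exact: qe.
Qed.

End LaurentAxioms.

(** * Inverses *)

Section SeriesTower.
Variables (H : eqType) (T : nzRingType) (A : set T) (B : set H) (le : rel H).
Variables (barT : H -> T) (F : H -> set T) (c : H -> T -> int -> T).
Hypothesis tw : series_tower A B le barT F c.
Hypothesis wo : well_ordered B (slt le).
Local Notation below := (stage_below A B le F).

Lemma st_A1 : A 1.
Proof. by have [h _ _] := tower_base tw; rewrite in_setE in h. Qed.
Lemma st_AB x y : A x -> A y -> A (x - y).
Proof. by have [_ /(_ x y) h _] := tower_base tw; rewrite !in_setE in h; exact: h. Qed.
Lemma st_AM x y : A x -> A y -> A (x * y).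
Proof. by have [_ _ /(_ x y) h] := tower_base tw; rewrite !in_setE in h; exact: h. Qed.

Lemma st_A_F u : B u -> A `<=` F u.
Proof.
move=> Bu x Ax; have [z Lr] := tower_step tw Bu.
by apply: (laurent_sub Lr); left.
Qed.

Lemma st_below_F u : B u -> below u `<=` F u.
Proof. by move=> Bu x bx; have [z Lr] := tower_step tw Bu; apply: (laurent_sub Lr). Qed.

Lemma st_mono u v : B u -> B v -> slt le v u -> F v `<=` F u.
Proof.
by move=> Bu Bv [vu lvu] x vx; apply: st_below_F => //; right; exists v.
Qed.

Lemma st_FB u x y : B u -> F u x -> F u y -> F u (x - y).
Proof. by move=> Bu; have [z Lr] := tower_step tw Bu; exact: (lrB Lr). Qed.
Lemma st_FM u x y : B u -> F u x -> F u y -> F u (x * y).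
Proof. by move=> Bu; have [z Lr] := tower_step tw Bu; exact: (lrM Lr). Qed.
Lemma st_Fvar u : B u -> F u (barT u).
Proof. by move=> Bu; have [z Lr] := tower_step tw Bu; exact: (lr_u Lr). Qed.

Lemma st_below_max u x y : B u -> below u x -> below u y ->
  (A x /\ A y) \/ exists w, [/\ B w, slt le w u, F w x & F w y].
Proof.
move=> Bu [Ax|[v [Bv vu lvu] vx]] [Ay|[w [Bw wu lwu] wy]].
- by left.
- by right; exists w; split=> //; exact: st_A_F.
- by right; exists v; split=> //; exact: st_A_F.
- right; have [vw|vw|wv] := wo_total wo Bv Bw.
  + by exists w; split=> //; exact: (st_mono Bw Bv vw).
  + by exists v; split=> //; rewrite vw.
  + by exists v; split=> //; exact: (st_mono Bv Bw wv).
Qed.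

Lemma st_below1 u : below u 1. Proof. by left; exact: st_A1. Qed.
Lemma st_belowB u x y : B u -> below u x -> below u y -> below u (x - y).
Proof.
move=> Bu bx by_; have [[Ax Ay]|[w [Bw [wu lwu] wx wy]]] := st_below_max Bu bx by_.
  by left; exact: st_AB.
by right; exists w => //; exact: st_FB.
Qed.
Lemma st_belowM u x y : B u -> below u x -> below u y -> below u (x * y).
Proof.
move=> Bu bx by_; have [[Ax Ay]|[w [Bw [wu lwu] wx wy]]] := st_below_max Bu bx by_.
  by left; exact: st_AM.
by right; exists w => //; exact: st_FM.
Qed.
Lemma st_below0 u : B u -> below u 0.
Proof. by move=> Bu; rewrite -(subrr 1); apply: st_belowB => //; exact: st_below1. Qed.
Lemma st_belowD u x y : B u -> below u x -> below u y -> below u (x + y).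
Proof.
move=> Bu bx by_; rewrite -(opprK y) -[- y]sub0r; apply: st_belowB => //.
by apply: st_belowB => //; exact: st_below0.
Qed.

Lemma st_seq_max (L : seq H) : L != [::] -> {subset L <= B} ->
  exists2 u, u \in L & forall v, v \in L -> v = u \/ slt le v u.
Proof.
elim: L => // x L IHL _ LB; have Bx : B x by rewrite -in_setE; apply: LB; exact: mem_head.
have LB' : {subset L <= B} by move=> v vL; apply: LB; rewrite in_cons vL orbT.
have [->|L0] := eqVneq L [::].
  by exists x; [exact: mem_head|move=> v; rewrite mem_seq1 => /eqP ->; left].
have [u uL umax] := IHL L0 LB'; have Bu : B u by rewrite -in_setE; exact: LB'.
have xu0 := wo_total wo Bx Bu.
have [xu|ux] : (x = u \/ slt le x u) \/ slt le u x.
  by case: xu0 => [?|?|?]; [left; right|left; left|right].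
  exists u; first by rewrite in_cons uL orbT.
  by move=> v; rewrite in_cons => /orP[/eqP->|/umax].
exists x; first exact: mem_head.
move=> v; rewrite in_cons => /orP[/eqP->|vL]; first by left.
have Bv : B v by rewrite -in_setE; exact: LB'.
right; have [->//|vu] := umax v vL; exact: (wo_trans wo Bv Bu Bx).
Qed.

End SeriesTower.

(** * Polynomials in finitely many letters *)

Section Polynomials.
Variables (k : fieldType) (H : lmodType k) (K S : algType k) (iota : {lrmorphism K -> S}).
Variables (bar : {linear H -> S}) (le : rel H).
Local Notation sp L := (spanned iota bar [set x | x \in L] le).
Implicit Types L : seq H.

Lemma spanned_subset (E E' : set H) s : E `<=` E' ->
  spanned iota bar E le s -> spanned iota bar E' le s.
Proof.
move=> EE' [n]; elim=> [|a w y [wE ws] wn _ [m IH]]; first exact: spanned_zero.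
apply: spanned_add; last by exists m.
exists n; apply: span_mon => //; split=> // x /wE; rewrite !in_setE; exact: EE'.
Qed.

Lemma spanned_finite (E : set H) s : spanned iota bar E le s ->
  exists2 L : seq H, {subset L <= E} & sp L s.
Proof.
move=> [n]; elim=> [|a w y [wE ws] wn _ [L LE Ly]].
  by exists [::] => //; exact: spanned_zero.
exists (w ++ L); first by move=> x; rewrite mem_cat => /orP[/wE|/LE].
apply: spanned_add.
  exists n; apply: span_mon => //; split=> // x xw.
  by rewrite in_setE /mkset mem_cat xw.
by apply: spanned_subset Ly => x /= xL; rewrite mem_cat xL orbT.
Qed.

Lemma path_top u w : (forall v, v \in w -> le u v -> v = u) -> path le u w ->
  w = nseq (size w) u.
Proof.
elim: w => //= y w IHw top /andP[uy yw].
have yu : y = u by apply: top => //; exact: mem_head.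
rewrite yu in yw *; congr (_ :: _); apply: IHw => // v vw; apply: top.
by rewrite in_cons vw orbT.
Qed.

(** In a sorted word the copies of the largest letter stand together at the end. *)
Lemma standard_split L u w : (forall v, v \in L -> le u v -> v = u) ->
    standard_monomial [set x | x \in L] le w ->
  exists i w', w = w' ++ nseq i u /\
    standard_monomial [set x | x \in [seq v <- L | v != u]] le w'.
Proof.
move=> top; elim: w => [|y w IHw] sw; first by exists 0%N, [::].
have [/= yL sw'] := standard_behead sw; have [wL ws] := sw.
have [yu|yu] := eqVneq y u.
  exists (size w).+1, [::]; split; last by split.
  rewrite yu /=; congr (_ :: _); apply: path_top; last by rewrite -yu.
  move=> v vw; apply: top; suff : v \in [set x | x \in L] by rewrite in_setE.
  by apply: wL; rewrite in_cons vw orbT.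
have [i [w' [we [w'L w's]]]] := IHw sw'.
exists i, (y :: w'); split; first by rewrite we.
split.
  move=> v; rewrite in_cons => /orP[/eqP->|/w'L//].
  by rewrite in_setE /mkset mem_filter yu.
by move: ws; rewrite we /= cat_path => /andP[].
Qed.

Lemma mon_top w i u :
  monomial bar (w ++ nseq i u) = monomial bar w * bar u ^+ i.
Proof.
rewrite /monomial big_cat /=; congr (_ * _).
by elim: i => [|i IHi]; rewrite ?big_nil // big_cons IHi -exprS.
Qed.

(** Coefficients are put to the left of the powers of the largest letter, as in a Laurent series in
    its inverse. *)
Lemma spanned_top L u s : (forall v, v \in L -> le u v -> v = u) -> sp L s ->
  exists (d : nat) (p : nat -> S), [/\ forall i, sp [seq v <- L | v != u] (p i),
    forall i, (d <= i)%N -> p i = 0 & s = \sum_(i < d) p i * bar u ^+ i].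
Proof.
move=> top [n]; elim=> [|a w y sw _ _ [d [p [pL pd ye]]]].
  by exists 0%N, (fun=> 0); split=> //; [move=> i; exact: spanned_zero|rewrite big_ord0].
have [j [w' [-> sw']]] := standard_split top sw; rewrite mon_top mulrA.
pose q := iota a * monomial bar w'.
exists (maxn d j.+1), (fun i => (if i == j then q else 0) + p i); split.
- move=> i; apply: spanned_add => //; case: ifP => _; last exact: spanned_zero.
  by exists (size w'); apply: span_mon.
- move=> i; rewrite geq_max => /andP[di ji]; rewrite pd // ifF ?addr0 //.
  by rewrite gtn_eqF.
under [RHS]eq_bigr do rewrite mulrDl.
rewrite big_split /=; congr (_ + _).
  have jm : (j < maxn d j.+1)%N by rewrite leq_max leqnn orbT.
  rewrite (bigD1 (Ordinal jm)) //= eqxx big1 ?addr0 // => i ij.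
  by rewrite ifF ?mul0r //; apply: negbTE; exact: ij.
rewrite ye -!(big_mkord xpredT (fun i => p i * bar u ^+ i)).
rewrite (@big_cat_nat _ _ _ d 0 (maxn d j.+1)) ?leq_maxl //= [X in _ + X]big_nat.
by rewrite [X in _ + X]big1 ?addr0 // => i /andP[di _]; rewrite pd // mul0r.
Qed.

Variables (T : nzRingType) (Phi : {rmorphism S -> T}) (A : set T) (B : set H).
Variables (F : H -> set T) (c : H -> T -> int -> T).
Hypothesis tw : series_tower A B le (Phi \o bar) F c.
Hypotheses (wo : well_ordered B (slt le)) (AK : forall a, A (Phi (iota a))).
Hypothesis divK : division_ring K.

Lemma le_top u v : B u -> B v -> slt le v u -> le u v -> v = u.
Proof.
move=> Bu Bv vu luv; apply/eqP/negPn/negP => nvu.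
have uv : slt le u v by split=> //; rewrite eq_sym.
exact: (wo_irr wo (wo_trans wo Bu Bv Bu uv vu)).
Qed.

Lemma spanned_below L u s : B u -> (forall v, v \in L -> B v /\ slt le v u) ->
  sp L s -> stage_below A B le F u (Phi s).
Proof.
move=> Bu Lu [n]; elim=> [|a w y [wL _] _ _ IH].
  by rewrite rmorph0; exact: (st_below0 tw wo).
rewrite rmorphD rmorphM; apply: (st_belowD tw wo) => //.
apply: (st_belowM tw wo) => //; first by left.
elim: w wL => [|x w IHw] wL.
  by rewrite /monomial big_nil rmorph1; exact: (st_below1 tw).
rewrite mon_cons rmorphM; apply: (st_belowM tw wo) => //.
  have : x \in [set x | x \in L] by apply: wL; exact: mem_head.
  rewrite in_setE => /Lu[Bx [xu lxu]]; right; exists x => //.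
  exact: (st_Fvar tw).
by apply: IHw => v vw; apply: wL; rewrite in_cons vw orbT.
Qed.

(* The leading coefficient of a polynomial in the largest letter [u] is a nonzero polynomial in
   smaller letters. *)
Lemma spanned_left_inverse L s : {subset L <= B} -> sp L s -> s != 0 ->
  exists2 q, q * Phi s = 1 & A q \/ exists2 v, v \in L & F v q.
Proof.
move: {2}(size L).+1 (ltnSn (size L)) => n; elim: n L s => // n IHn L s Ln LB Ls s0.
have [L0|L0] := eqVneq L [::].
  have [a sa] : exists a, s = iota a.
    move: Ls; rewrite L0 => -[m]; elim=> [|a w y [wE _] _ _ [b ->]].
      by exists 0; rewrite rmorph0.
    exists (a + b); rewrite rmorphD; congr (_ + _).
    case: w wE => [_|x w wE]; first by rewrite /monomial big_nil mulr1.
    by have := wE x (mem_head _ _); rewrite in_setE.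
  have [b [ba _]] : exists b, b * a = 1 /\ a * b = 1.
    by apply: divK; apply: contraNneq s0 => a0; rewrite sa a0 rmorph0.
  by exists (Phi (iota b)); [rewrite sa -!rmorphM ba !rmorph1|left].
have [u uL umax] := st_seq_max wo L0 LB.
have Bu : B u by rewrite -in_setE; exact: LB.
have top v : v \in L -> le u v -> v = u.
  move=> vL luv; have [//|vu] := umax v vL.
  by apply: le_top => //; rewrite -in_setE; exact: LB.
have [d [p [pL pd se]]] := spanned_top top Ls.
pose L' := [seq v <- L | v != u].
have L'u v : v \in L' -> B v /\ slt le v u.
  rewrite mem_filter => /andP[vu vL]; split; first by rewrite -in_setE; exact: LB.
  by have [e|] := umax v vL; first by rewrite e eqxx in vu.
have L'n : (size L' < n)%N.
  rewrite -ltnS; apply: leq_trans Ln; rewrite ltnS size_filter.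
  rewrite -(count_predC (pred1 u) L) -[X in (X < _)%N]add0n ltn_add2r.
  by rewrite -has_count has_pred1.
have pb i : stage_below A B le F u (Phi (p i)) by exact: (spanned_below Bu L'u).
have ex : exists i, (i < d)%N && (p i != 0).
  apply: contrapT => nex; case/eqP: s0; rewrite se big1 // => i _.
  have [->|pi] := eqVneq (p i) 0; first by rewrite mul0r.
  by case: nex; exists i; rewrite ltn_ord.
(* Since $u^i=z_u^{-i}$, the highest power of [u] gives the lowest term of the Laurent series. *)
have [|i0 /andP[i0d pi0] i0max] := ex_maxnP ex (m := d).
  by move=> i /andP[/ltnW].
have [|q' q'p q'F] := IHn L' (p i0) L'n _ (pL i0) pi0.
  by move=> v /L'u[Bv _]; rewrite in_setE.
have [z Lr] := tower_step tw Bu.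
have UX i : ((Phi \o bar) u) ^+ i = zpow ((Phi \o bar) u) z (- i%:Z).
  by case: i => [|i] //=; rewrite ?expr0.
have A1 := st_below1 tw u.
(* The inverse of the leading coefficient is found at a stage below [u], so it is an admissible
   coefficient for the variable of [u]. *)
have q'b : stage_below A B le F u q'.
  case: q'F => [|[v vL' vq']]; first by left.
  by have [Bv [vu lvu]] := L'u v vL'; right; exists v.
have Phis : Phi s = \sum_(i < d) Phi (p i) * zpow ((Phi \o bar) u) z (- i%:Z).
  by rewrite se rmorph_sum; apply: eq_bigr => i _; rewrite rmorphM rmorphXn -UX.
have AMu x y : stage_below A B le F u x -> stage_below A B le F u y ->
  stage_below A B le F u (x * y) by exact: (st_belowM tw wo).
have cs m : c u (Phi s) m = \sum_(i < d) (if m == - i%:Z then Phi (p i) else 0).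
  rewrite Phis (lr_csum Lr); last by move=> i; exact: (lr_mon Lr).
  by apply: eq_bigr => i _; rewrite (lr_c_mon Lr).
have [||||g Fg gs] := @lr_left_inverse _ _ _ _ _ _ Lr AMu A1 (Phi s) (- i0%:Z) q'.
- by rewrite Phis; apply: (lr_sum Lr) => i _; exact: (lr_mon Lr).
- move=> m mlt; rewrite cs big1 // => i _; case: eqP => // mi.
  have [->|pi] := eqVneq (p i) 0; first exact: rmorph0.
  have : (i <= i0)%N by apply: i0max; rewrite ltn_ord.
  by move: mlt; rewrite mi; lia.
- by [].
- rewrite cs (bigD1 (Ordinal i0d)) //= eqxx big1 ?addr0 // => i ii0.
  rewrite ifF //; apply/eqP => /oppr_inj [e]; move: ii0.
  by rewrite -val_eqE /= -e eqxx.
by exists g => //; right; exists u.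
Qed.

End Polynomials.

(** * Left inverses in the series ring *)

Section SeriesRings.
Variables (k : fieldType) (H : lmodType k) (br : {bilinear H -> H -> H}).
Variables (Hs C : nat -> set H) (rnH : rn_series br Hs) (qC : q_basis Hs C).
Variables (le : rel H) (canC : canonical_order C le).
Variables (K S : algType k) (iota : {lrmorphism K -> S}) (bar : {linear H -> S}).
Hypotheses (cpS : crossed_product br iota bar) (divK : division_ring K).
Local Notation A m := (cp_sub iota bar (Hs m)).

Definition tail_layers (m : nat) : set H := \bigcup_(i in [set i | (m <= i)%N]) C i.

Lemma tail_span m x : Hs m x -> exists (s : seq H) (a : H -> k),
  {subset s <= tail_layers m} /\ x = \sum_(b <- s) a b *: b.
Proof.
move=> /(Hs_coord rnH qC) Hx; pose s := [seq b <- qsupp qC x | qcoord qC x b != 0].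
exists s, (qcoord qC x); split.
  move=> b; rewrite mem_filter => /andP[xb bs]; have [i _ Cib] := set_mem (supp_sub bs).
  rewrite in_setE; exists i => //=; rewrite leqNgt; apply: contra xb => im.
  by rewrite (Hx i b im Cib).
rewrite {1}(coordE qC x) (bigID (fun b => qcoord qC x b != 0)) /= [X in _ + X]big1.
  by rewrite addr0 big_filter.
by move=> b /negPn/eqP ->; rewrite scale0r.
Qed.

(** The basis given with the crossed product is arbitrary and not adapted to [Hs m]. The rewriting
    of words yields spanning by standard monomials in the letters of the Q-basis that lie in
    [Hs m]. *)
Lemma cp_sub_spanned m s : A m s -> spanned iota bar (tail_layers m) le s.
Proof.
have [delta [t [_ _ bi bb]]] := cp_mul cpS.
have jl a x y : bar (a *: x + y) = iota a%:A * bar x + bar y.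
  by rewrite linearP linearZ /= rmorph1 mulr_algl.
have i1 : iota 1 = 1 by exact: rmorph1.
have iB a b : iota (a - b) = iota a - iota b by exact: rmorphB.
have iM a b : iota (a * b) = iota a * iota b by exact: rmorphM.
have Nbr x y : Hs m x -> Hs m y -> Hs m (br x y).
  by move=> _ Hy; apply: (lie_ideal_br (rn_ideal rnH m)).
have EN : tail_layers m `<=` Hs m.
  by move=> x [i mi Cix]; apply: (Hs_leq rnH mi); exact: (layer_sub qC).
have tot : {in tail_layers m &, total le}.
  have up x : x \in tail_layers m -> x \in all_layers C.
    by rewrite !in_setE => -[i _ Cix]; exists i.
  by move=> x y /up Ex /up Ey; exact: (all_layers_total canC).
move: s; apply: gen_subring_ind.
- exact: spanned_one.
- by move=> x y; exact: spanned_sub.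
- by move=> x y; apply: (spanned_mul i1 iM jl bi bb Nbr EN (@tail_span m) tot).
- move=> _ [[a _ <-]|[x Hx <-]]; first exact: spanned_coef.
  exact: (spanned_lie i1 iM jl bi bb Nbr EN (@tail_span m) tot).
Qed.

Lemma cp_sub0 s : A 0 s.
Proof.
have [E [leE [_ _ _ _ [Sspan _]]]] := cp_basis cpS.
have [ws [r [_ ->]]] := Sspan s; rewrite (rn_first rnH).
have G0 : cp_sub iota bar setT 0 by exact: gen_subring0.
apply: big_ind => // [x y Gx Gy|w _].
  rewrite -(opprK y) -[- y]sub0r; apply: gen_subringB => //; exact: gen_subringB.
apply: gen_subringM; first by apply: gen_subring_sub; left; exists (r w).
apply: big_ind => [|x y|x _]; [exact: gen_subring1|exact: gen_subringM|].
by apply: gen_subring_sub; right; exists x.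
Qed.

Lemma tail_finite m (L : seq H) : {subset L <= tail_layers m} ->
  exists2 n, (m <= n)%N & {subset L <= layers C n}.
Proof.
elim: L => [|x L IHL] LE; first by exists m.
have [|n mn nL] := IHL; first by move=> y yL; apply: LE; rewrite in_cons yL orbT.
have [i mi Cix] := set_mem (LE x (mem_head _ _)).
exists (maxn n i.+1); first by rewrite leq_max mn.
move=> y; rewrite in_cons in_setE => /orP[/eqP->|/nL].
  by exists i => //=; rewrite leq_max leqnn orbT.
by rewrite in_setE => -[j jn Cjy]; exists j => //=; rewrite leq_max jn.
Qed.

(** Raising the level adds variables only below the old ones: an element of an old stage keeps its
    variable and its coefficients, while the ring of admissible coefficients grows. *)
Lemma tail_slt m u v : layers C m u -> tail_layers m v -> slt le v u.
Proof.
move=> [i im Ciu] [j mj Cjv]; apply/(sltP rnH qC canC Cjv Ciu); left.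
exact: leq_trans im mj.
Qed.

Section Division.
Variables (T : nzRingType) (phi : {rmorphism S -> T}).
Variables (F : nat -> H -> set T) (c : H -> T -> int -> T).
Hypothesis sd : series_data Hs C le iota bar phi F c.

Let tw m : series_tower (phi @` A m) (layers C m) le (phi \o bar) (F m) c.
Proof. exact: series_towers sd m. Qed.
Let wo m := layers_well_ordered rnH qC canC m.

Lemma series_AK m a : (phi @` A m) (phi (iota a)).
Proof. by exists (iota a) => //; apply: gen_subring_sub; left; exists a. Qed.

(** The inverse is located at a letter of [Hs m], below every variable of level [m], so that it can
    serve as a coefficient there. *)
Lemma base_left_inverse m s : A m s -> s != 0 -> exists n q, [/\ (m <= n)%N,
  q * phi s = 1 & (phi @` A n) q \/ exists v, [/\ layers C n v, tail_layers m v & F n v q]].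
Proof.
move=> /cp_sub_spanned/spanned_finite[L LE Ls] s0.
have [n mn Ln] := tail_finite LE.
have [q qs qF] := spanned_left_inverse (tw n) (wo n) (@series_AK n) divK Ln Ls s0.
exists n, q; split=> //; case: qF => [|[v vL vq]]; [by left|right; exists v].
by split=> //; [have := Ln v vL|have := LE v vL]; rewrite in_setE.
Qed.

Lemma stage_left_inverse m u f : layers C m u -> F m u f -> f != 0 ->
  exists n q, [/\ (m <= n)%N, q * f = 1 & F n u q].
Proof.
move=> Bu; move: u Bu f; apply: (wo_wf (wo m)) => u Bu IHu f uf f0.
have [z Lr] := tower_step (tw m) Bu.
have [l fl] := lr_bound Lr uf.
have [i cfi] : exists i : nat, c u f (l + i%:Z) != 0.
  apply: contrapT => nc; case/eqP: f0; apply: (lr_eq0 Lr) => // n.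
  have [/fl//|ln] := ltP n l; apply/eqP/negPn/negP => cn; apply: nc.
  by exists (absz (n - l)%R); rewrite (_ : l + _ = n) //; lia.
have ex : exists i : nat, c u f (l + i%:Z) != 0 by exists i.
case: (ex_minnP ex) => i0 ci0 i0min {i cfi ex}; pose l0 := l + i0%:Z.
have fl0 : order_ge (c u) f l0.
  move=> n nl0; have [/fl//|ln] := ltP n l; apply/eqP/negPn/negP => cn.
  have : (i0 <= absz (n - l)%R)%N by apply: i0min; rewrite (_ : l + _ = n) //; lia.
  by move: nl0; rewrite /l0; lia.
(* At level [n] the element [f] has the same leading coefficient, as the maps [c] do not depend on
   the level; a left inverse of it found there suffices. *)
suff [n [b [mn bl bB]]] : exists n b, [/\ (m <= n)%N, b * c u f l0 = 1 &
    stage_below (phi @` A n) (layers C n) le (F n) u b].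
  have Bnu : layers C n u.
    by have [i im Ciu] := Bu; exists i => //=; exact: leq_trans im mn.
  have [z' Lr'] := tower_step (tw n) Bnu.
  have AM x y : stage_below (phi @` A n) (layers C n) le (F n) u x ->
      stage_below (phi @` A n) (layers C n) le (F n) u y ->
      stage_below (phi @` A n) (layers C n) le (F n) u (x * y).
    exact: (st_belowM (tw n) (wo n)).
  have [g ug gf] := lr_left_inverse Lr' AM (st_below1 (tw n) u)
    (series_incl sd mn Bu uf) fl0 bB bl.
  by exists n, g.
have [[s As es]|[v [Bv vu lvu] vc]] := lr_coefA Lr l0 uf.
  have s0 : s != 0 by apply: contraNneq ci0 => s0; rewrite -/l0 -es s0 rmorph0.
  have [n [q [mn qs qF]]] := base_left_inverse As s0.
  exists n, q; split=> //; first by rewrite -es.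
  case: qF => [|[v [Bv tv vq]]]; first by left.
  by have [vu lvu] := tail_slt Bu tv; right; exists v.
have [|n [q [mn qs vq]]] := IHu v Bv (conj vu lvu) _ vc; first exact: ci0.
exists n, q; split=> //; right; exists v => //; split=> //.
by have [i im Civ] := Bv; exists i => //=; exact: leq_trans im mn.
Qed.

Lemma series_left_inverse (f : T) : f != 0 -> exists q, q * f = 1.
Proof.
move=> f0; have [m [[s As es]|[u Bu uf]]] := series_limit sd f.
  have s0 : s != 0 by apply: contraNneq f0 => s0; rewrite -es s0 rmorph0.
  have [n [q [_ qs _]]] := base_left_inverse As s0.
  by exists q; rewrite -es.
by have [n [q [_ qf _]]] := stage_left_inverse Bu uf f0; exists q.
Qed.

Lemma series_division_ring : division_ring T.
Proof.
move=> x x0; have [y yx] := series_left_inverse x0.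
have y0 : y != 0 by apply: contra_eqN yx => /eqP ->; rewrite mul0r eq_sym oner_neq0.
have [w wy] := series_left_inverse y0.
have wx : w = x by rewrite -[w]mulr1 -yx mulrA wy mul1r.
by exists y; split=> //; rewrite -wx.
Qed.

Lemma series_map_injective : injective phi.
Proof.
apply: raddf_inj => s ps; apply/eqP/negPn/negP => s0.
have [n [q [_ qs _]]] := base_left_inverse (cp_sub0 s) s0.
by move: qs; rewrite ps mulr0 => /eqP; rewrite eq_sym oner_eq0.
Qed.

End Division.
End SeriesRings.

(** * The direct limit *)

Section Limit.
Variables (k : fieldType) (H : lmodType k) (br : {bilinear H -> H -> H}).
Variables (Hs C : nat -> set H) (rnH : rn_series br Hs) (qC : q_basis Hs C).
Variables (le : rel H) (canC : canonical_order C le).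
Variables (K S : algType k) (iota : {lrmorphism K -> S}) (bar : {linear H -> S}).
Hypotheses (cpS : crossed_product br iota bar) (divK : division_ring K).
Variables (delta : {bilinear H -> K -> K}) (t : {bilinear H -> H -> K}).
Hypotheses (bar_iota : forall x a, bar x * iota a = iota a * bar x + iota (delta x a))
  (bar_bar : forall x y, bar x * bar y - bar y * bar x = bar (br x y) + iota (t x y)).
Local Notation A m := (cp_sub iota bar (Hs m)).
Variables (Q : nat -> nzRingType) (Phi : forall n, {rmorphism S -> Q n}).
Variables (F : forall n, H -> set (Q n)) (c : forall n, H -> Q n -> int -> Q n).
Hypothesis tw : forall n,
  series_tower (Phi n @` A n) (layers C n) le (Phi n \o bar) (@F n) (@c n).

Local Notation W := (forall n, Q n).
Local Notation slt := (slt le).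
Implicit Types (g h : W) (m n : nat) (u v : H).
Let wo m := layers_well_ordered rnH qC canC m.

Definition seq_of (s : S) : W := fun n => Phi n s.
Definition wsub g h : W := fun n => g n - h n.
Definition wadd g h : W := fun n => g n + h n.
Definition wmul g h : W := fun n => g n * h n.
Definition wder (x : H) g : W := fun n => inner_der (Phi n (bar x)) (g n).
Definition wcoef u g (j : int) : W := fun n => c u (g n) j.

Lemma wsumE (N : nat) (g : 'I_N -> W) :
  (fun n => \sum_(i < N) g i n) = \big[wadd/(fun=> 0)]_(i < N) g i.
Proof.
apply: functional_extensionality_dep => n.
by apply: (big_ind2 (fun (a : Q n) (b : W) => a = b n)) => // a b a' b' -> ->.
Qed.

Definition base_seq m : set W :=
  [set g | exists2 s, A m s & forall n, (m <= n)%N -> g n = Phi n s].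

(* The elements of the stage of [u] in $R_m((H/H_m))$, as sequences of their images in the rings
   [Q n], [m <= n]; the values for [n < m] are irrelevant. *)
Inductive stage_seq m u g : Prop := StageSeq l of layers C m u
  & (forall n, (m <= n)%N -> F u (g n))
  & (forall n, (m <= n)%N -> order_ge (@c n u) (g n) l)
  & (forall j : int, base_seq m (wcoef u g j) \/
       exists v, [/\ layers C m v, slt v u & stage_seq m v (wcoef u g j)]).

Definition union_seq m (D : set H) : set W :=
  [set g | base_seq m g \/ exists v, [/\ layers C m v, D v & stage_seq m v g]].
Local Notation below_seq m u := (union_seq m (slt^~ u)).

Lemma stage_seqP m u g : stage_seq m u g <-> [/\ layers C m u,
  forall n, (m <= n)%N -> F u (g n),
  exists l, forall n, (m <= n)%N -> order_ge (@c n u) (g n) l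
  & forall j, below_seq m u (wcoef u g j)].
Proof.
by split=> [[l *]|[? ? [l ?] ?]]; [split=> //; exists l|exact: (@StageSeq _ _ _ l)].
Qed.

Lemma layers_leq m n u : (m <= n)%N -> layers C m u -> layers C n u.
Proof. by move=> mn [i im Ciu]; exists i => //=; exact: leq_trans im mn. Qed.

(** The inverse of the image of [bar u] in each [Q n] where [u] is a variable; elsewhere the value
    is arbitrary. *)
Definition wvar_inv u : W := fun n => xget 0 [set z |
  laurent_ring (stage_below (Phi n @` A n) (layers C n) le (@F n) u) (@F n u)
    (Phi n (bar u)) z (@c n u)].

Lemma limit_laurent n u : layers C n u ->
  laurent_ring (stage_below (Phi n @` A n) (layers C n) le (@F n) u) (@F n u)
    (Phi n (bar u)) (wvar_inv u n) (@c n u).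
Proof.
move=> Bu; apply: (@xgetPex _ _ [set z | laurent_ring _ _ _ z _]).
by have [z Lr] := tower_step (tw n) Bu; exists z.
Qed.
Local Notation below n u := (stage_below (Phi n @` A n) (layers C n) le (@F n) u).

Lemma below_mul n u x y : layers C n u -> below n u x -> below n u y -> below n u (x * y).
Proof. exact: (st_belowM (tw n) (wo n)). Qed.
Let below1 n u : below n u 1 := st_below1 (tw n) u.

(* [R_m] is generated by [K] and the elements of the Q-basis lying in $H_m$. *)
Lemma cp_sub_ind m (P : set S) : P 1 -> (forall x y, P x -> P y -> P (x - y)) ->
  (forall x y, P x -> P y -> P (x * y)) -> (forall a, P (iota a)) ->
  (forall b, tail_layers C m b -> P (bar b)) -> A m `<=` P.
Proof.
move=> P1 PB PM Pi Pb; apply: gen_subring_ind => // _ [[a _ <-]//|[x Hx <-]].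
have P0 : P 0 by rewrite -(subrr 1); exact: PB.
have PD x' y' : P x' -> P y' -> P (x' + y').
  by move=> Px Py; rewrite -(opprK y') -[- y']sub0r; do 2![apply: (PB) => //].
have [s [a [sE ->]]] := tail_span rnH qC Hx.
rewrite linear_sum big_seq; apply: big_ind => // b bs.
rewrite linearZ /= -mulr_algl; apply: PM.
  by have := Pi (a b *: 1); rewrite linearZ /= rmorph1.
by apply: Pb; rewrite -in_setE; exact: sE.
Qed.

(** A letter generating $R_m$ either lies in [Hs n], hence in the base ring of level [n], or is a
    variable of level [n] smaller than [u]. *)
Lemma base_below m n u s : (m <= n)%N -> layers C m u -> A m s -> below n u (Phi n s).
Proof.
move=> mn Bmu; have Bu := layers_leq mn Bmu; move: s.
apply: (@cp_sub_ind m [set s | below n u (Phi n s)]); rewrite /mkset.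
- by rewrite rmorph1; exact: below1.
- by move=> x y bx by_; rewrite rmorphB; exact: (st_belowB (tw n) (wo n)).
- by move=> x y bx by_; rewrite rmorphM; exact: below_mul.
- by move=> a; left; exists (iota a) => //; exact: cp_sub_iota.
- move=> b tb; have [bu lbu] := tail_slt rnH qC canC Bmu tb; have [i mi Cib] := tb.
  have [ni|ni] := leqP n i.
    left; exists (bar b) => //; apply: cp_sub_bar.
    by apply: (Hs_leq rnH ni); exact: (layer_sub qC).
  have Bb : layers C n b by exists i.
  by right; exists b => //; exact: (st_Fvar (tw n) Bb).
Qed.

Lemma below_seq_at m u g n : layers C m u -> below_seq m u g -> (m <= n)%N -> below n u (g n).
Proof.
move=> Bu [[s As gs]|[v [Bv [vu lvu] /stage_seqP[_ vg _ _]]]] mn.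
  by rewrite gs //; exact: base_below As.
right; exists v; last exact: vg.
by split=> //; exact: layers_leq Bv.
Qed.

Definition agree m g h := forall n, (m <= n)%N -> g n = h n.

Lemma base_seq_agree m g h : agree m g h -> base_seq m g -> base_seq m h.
Proof. by move=> gh [s As gs]; exists s => // n mn; rewrite -gh // gs. Qed.

Lemma stage_seq_agree m u g h : layers C m u -> agree m g h ->
  stage_seq m u g -> stage_seq m u h.
Proof.
move=> Bu; move: u Bu g h; apply: (wo_wf (wo m)) => u Bu IHu g h gh.
move=> /stage_seqP[_ gF [l gl] gc]; apply/stage_seqP; split=> //.
- by move=> n mn; rewrite -gh //; exact: gF.
- by exists l => n mn; rewrite -gh //; exact: gl.
move=> j; have ghj : agree m (wcoef u g j) (wcoef u h j).
  by move=> n mn; rewrite /wcoef gh.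
have [gb|[v [Bv vu vg]]] := gc j; first by left; exact: base_seq_agree gb.
by right; exists v; split=> //; exact: IHu vg.
Qed.

Lemma union_seq_agree m D g h : agree m g h -> union_seq m D g -> union_seq m D h.
Proof.
move=> gh [gb|[v [Bv Dv vg]]]; first by left; exact: base_seq_agree gb.
by right; exists v; split=> //; exact: stage_seq_agree vg.
Qed.

Lemma base_seqB m g h : base_seq m g -> base_seq m h -> base_seq m (wsub g h).
Proof.
move=> [s As gs] [s' As' hs]; exists (s - s'); first exact: gen_subringB.
by move=> n mn; rewrite /wsub gs // hs // rmorphB.
Qed.
Lemma base_seqM m g h : base_seq m g -> base_seq m h -> base_seq m (wmul g h).
Proof.
move=> [s As gs] [s' As' hs]; exists (s * s'); first exact: gen_subringM.
by move=> n mn; rewrite /wmul gs // hs // rmorphM.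
Qed.
Lemma base_seqD m x g : base_seq m g -> base_seq m (wder x g).
Proof.
move=> [s As gs]; exists (inner_der (bar x) s).
  by have := cp_sub_der rnH bar_iota bar_bar (x, 0) As; rewrite /mu rmorph0 addr0.
by move=> n mn; rewrite /wder gs // /inner_der rmorphB !rmorphM.
Qed.
Lemma base_seq_const m s : A m s -> base_seq m (seq_of s).
Proof. by move=> As; exists s. Qed.
Lemma base_seq1 m : base_seq m (fun=> 1).
Proof. by exists 1; [exact: gen_subring1|move=> n _; rewrite rmorph1]. Qed.
Lemma base_seq0 m : base_seq m (fun=> 0).
Proof. by exists 0; [exact: gen_subring0|move=> n _; rewrite rmorph0]. Qed.

Lemma below_stage_seq m u g : layers C m u -> below_seq m u g -> stage_seq m u g.
Proof.
move=> Bu gb; have gn n := below_seq_at (n := n) Bu gb.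
apply/stage_seqP; split=> //.
- move=> n mn; exact: (st_below_F (tw n) (layers_leq mn Bu) (gn n mn)).
- exists 0 => n mn; apply: (lr_ge_A (limit_laurent (layers_leq mn Bu))).
  exact: gn.
move=> j; have E : agree m (if j == 0 then g else fun=> 0) (wcoef u g j).
  move=> n mn; rewrite /wcoef.
  rewrite (lr_c_A (limit_laurent (layers_leq mn Bu)) j (gn n mn)).
  by case: ifP.
apply: union_seq_agree E _; case: ifP => // _; left; exact: base_seq0.
Qed.

Lemma stage_seq_mono m u v g : layers C m v -> slt u v -> stage_seq m u g -> stage_seq m v g.
Proof.
move=> Bv uv ug; apply: below_stage_seq => //; right; exists u; split=> //.
by case/stage_seqP: ug.
Qed.

(** These properties are proved together by induction along the variables: coefficients of a product
    at [u] are built from products and derivatives of coefficients, which live at smaller stages. *)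
Definition stage_closed m u := [/\
  forall g h, stage_seq m u g -> stage_seq m u h -> stage_seq m u (wsub g h),
  forall g h, stage_seq m u g -> stage_seq m u h -> stage_seq m u (wmul g h),
  forall x g, stage_seq m u g -> stage_seq m u (wder x g),
  stage_seq m u (seq_of (bar u)) & stage_seq m u (wvar_inv u)].

(** * Closure of the stages of sequences under the operations *)

Section UnionClosure.
Variables (m : nat) (D : set H).
Hypothesis Dclosed : forall v, layers C m v -> D v -> stage_closed m v.

Lemma union_seq_max g h : union_seq m D g -> union_seq m D h ->
  (base_seq m g /\ base_seq m h) \/
  exists v, [/\ layers C m v, D v, stage_seq m v g & stage_seq m v h].
Proof.
move=> [gb|[v [Bv Dv vg]]] [hb|[w [Bw Dw wh]]].
- by left.
- by right; exists w; split=> //; apply: below_stage_seq => //; left.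
- by right; exists v; split=> //; apply: below_stage_seq => //; left.
- right; have [vw|vw|wv] := wo_total (wo m) Bv Bw.
  + by exists w; split=> //; exact: stage_seq_mono vg.
  + by exists v; split=> //; rewrite vw.
  + by exists v; split=> //; exact: stage_seq_mono wh.
Qed.

Lemma union_seqB g h : union_seq m D g -> union_seq m D h -> union_seq m D (wsub g h).
Proof.
move=> gb hb; have [[gb' hb']|[v [Bv Dv vg vh]]] := union_seq_max gb hb.
  by left; exact: base_seqB.
by right; exists v; split=> //; have [cB _ _ _ _] := Dclosed Bv Dv; exact: cB.
Qed.
Lemma union_seqM g h : union_seq m D g -> union_seq m D h -> union_seq m D (wmul g h).
Proof.
move=> gb hb; have [[gb' hb']|[v [Bv Dv vg vh]]] := union_seq_max gb hb.
  by left; exact: base_seqM.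
by right; exists v; split=> //; have [_ cM _ _ _] := Dclosed Bv Dv; exact: cM.
Qed.
Lemma union_seq_der x g : union_seq m D g -> union_seq m D (wder x g).
Proof.
move=> [gb|[v [Bv Dv vg]]]; first by left; exact: base_seqD.
by right; exists v; split=> //; have [_ _ cD _ _] := Dclosed Bv Dv; exact: cD.
Qed.
Lemma union_seq0 : union_seq m D (fun=> 0). Proof. by left; exact: base_seq0. Qed.
Lemma union_seqD g h : union_seq m D g -> union_seq m D h -> union_seq m D (wadd g h).
Proof.
move=> gb hb; have := union_seqB gb (union_seqB union_seq0 hb).
by apply: union_seq_agree => n mn; rewrite /wsub sub0r opprK.
Qed.
Lemma union_seq_sum (N : nat) (g : 'I_N -> W) : (forall i, union_seq m D (g i)) ->
  union_seq m D (fun n => \sum_(i < N) g i n).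
Proof.
move=> gb; rewrite wsumE; apply: big_ind => //; [exact: union_seq0|exact: union_seqD].
Qed.

(* [R_m] contains [R * U(H_j)] for [j >= m], and its remaining generators are variables. *)
Lemma union_seq_const j s : (forall b, tail_layers C j b -> layers C m b -> D b) ->
  A j s -> union_seq m D (seq_of s).
Proof.
move=> jD; move: s; apply: (@cp_sub_ind j [set s | union_seq m D (seq_of s)]); rewrite /mkset.
- by left; exists 1; [exact: gen_subring1|].
- move=> a b ab bb; apply: union_seq_agree (union_seqB ab bb) => n mn.
  by rewrite /wsub /seq_of rmorphB.
- move=> a b ab bb; apply: union_seq_agree (union_seqM ab bb) => n mn.
  by rewrite /wmul /seq_of rmorphM.
- by move=> a; left; apply: base_seq_const; exact: cp_sub_iota.
move=> b tb; have [i /= ji Cib] := tb; have [mi|im] := leqP m i.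
  left; apply: base_seq_const; apply: cp_sub_bar.
  apply: (Hs_leq rnH mi); exact: (layer_sub qC).
have Bb : layers C m b by exists i.
by right; exists b; split=> //; [exact: jD|have [] := Dclosed Bb (jD b tb Bb)].
Qed.

End UnionClosure.

Section Closure.
Variables (m : nat) (u : H).
Hypotheses (Bu : layers C m u)
  (IHu : forall v, layers C m v -> slt v u -> stage_closed m v).
Let Lr n (mn : (m <= n)%N) := limit_laurent (layers_leq mn Bu).
Let AM n (mn : (m <= n)%N) x y := @below_mul n u x y (layers_leq mn Bu).

Let below_seqB g h := @union_seqB m (slt^~ u) IHu g h.
Let below_seqM g h := @union_seqM m (slt^~ u) IHu g h.
Let below_seqD x g := @union_seq_der m (slt^~ u) IHu x g.
Let below_seq0 : below_seq m u (fun=> 0) := union_seq0 m (slt^~ u).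

Lemma stage_seqI g l : (forall n, (m <= n)%N -> F u (g n)) ->
  (forall n, (m <= n)%N -> order_ge (@c n u) (g n) l) ->
  (forall j, below_seq m u (wcoef u g j)) -> stage_seq m u g.
Proof. by move=> gF gl gc; apply/stage_seqP; split=> //; exists l. Qed.

Lemma stage_seq_sub g h : stage_seq m u g -> stage_seq m u h -> stage_seq m u (wsub g h).
Proof.
move=> /stage_seqP[_ gF [l gl] gc] /stage_seqP[_ hF [l' hl] hc].
apply: (@stage_seqI _ (Num.min l l')).
- by move=> n mn; apply: (lrB (Lr mn)); [exact: gF|exact: hF].
- move=> n mn i il; rewrite /wsub (lr_cB (Lr mn)) ?gF ?hF //; try by [exact: gF|exact: hF].
  by rewrite (gl n mn) ?(hl n mn) ?subr0 //; lia.
- move=> j; apply: union_seq_agree (below_seqB (gc j) (hc j)) => n mn.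
  by rewrite /wcoef /wsub (lr_cB (Lr mn)) //; [exact: gF|exact: hF].
Qed.

Lemma stage_seq_var_mul g : stage_seq m u g -> stage_seq m u (wmul (seq_of (bar u)) g).
Proof.
move=> /stage_seqP[_ gF [l gl] gc]; apply: (@stage_seqI _ (-1 + l)).
- by move=> n mn; apply: (lrM (Lr mn)); [exact: (lr_u (Lr mn))|exact: gF].
- move=> n mn; apply: (lr_ge_mul (Lr mn)); [exact: (lr_u (Lr mn))|exact: gF| |exact: gl].
  by have := @lr_ge_zpow _ _ _ _ _ _ (Lr mn) (below1 n u) (-1); rewrite /= expr1.
- move=> j; have := below_seqB (gc (j + 1)) (below_seqB below_seq0 (below_seqD u (gc j))).
  apply: union_seq_agree => n mn; rewrite /wcoef /wmul /wsub /wder sub0r opprK.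
  by rewrite (lr_c_u (Lr mn) (below1 n u)) //; exact: gF.
Qed.

(** By [lr_c_z] the coefficient of degree [j] of the product is determined by the one of degree
    [j - 1]. The recursion starts below the order, whose bound is the same for all [n]. *)
Lemma stage_seq_inv_mul g : stage_seq m u g -> stage_seq m u (wmul (wvar_inv u) g).
Proof.
move=> /stage_seqP[_ gF [l gl] gc].
have zF n : (m <= n)%N -> F u (wvar_inv u n) by move=> mn; exact: (lr_z (Lr mn)).
have zg n (mn : (m <= n)%N) := lr_ge_z (Lr mn) (below1 n u) (gF n mn) (gl n mn).
apply: (@stage_seqI _ (l + 1)) => //.
  by move=> n mn; apply: (lrM (Lr mn)); [exact: zF|exact: gF].
suff low N j : j < l + 1 + N%:Z -> below_seq m u (wcoef u (wmul (wvar_inv u) g) j).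
  by move=> j; apply: (low (absz (j - l)%R)); lia.
elim: N j => [|N IHN] j jN.
  apply: union_seq_agree below_seq0 => n mn; rewrite /wcoef /wmul zg //; lia.
have [|jN'] := ltP j (l + 1 + N%:Z); first exact: IHN.
have j1 : j - 1 < l + 1 + N%:Z by lia.
have := below_seqB (gc (j - 1)) (below_seqD u (IHN _ j1)).
apply: union_seq_agree => n mn; rewrite /wcoef /wmul /wsub /wder.
have := lr_c_z (Lr mn) (below1 n u) (j - 1) (gF n mn).
by rewrite subrK.
Qed.

Definition wpow (i : int) : W := fun n => zpow (Phi n (bar u)) (wvar_inv u n) i.

Lemma stage_seq1 : stage_seq m u (fun=> 1).
Proof. by apply: below_stage_seq => //; left; exact: base_seq1. Qed.

Lemma stage_seq_pow_mul i g : stage_seq m u g -> stage_seq m u (wmul (wpow i) g).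
Proof.
move=> ug; case: i => i; elim: i => [|i IHi].
- by apply: (stage_seq_agree Bu _ ug) => n mn; rewrite /wmul /wpow /= mul1r.
- have := stage_seq_inv_mul IHi; apply: (stage_seq_agree Bu) => n mn.
  by rewrite /wmul /wpow /= exprS mulrA.
- have := stage_seq_var_mul ug; apply: (stage_seq_agree Bu) => n mn.
  by rewrite /wmul /wpow.
- have := stage_seq_var_mul IHi; apply: (stage_seq_agree Bu) => n mn.
  by rewrite /wmul /wpow /= [in RHS]exprS -mulrA.
Qed.

Lemma stage_seq_pow i : stage_seq m u (wpow i).
Proof.
have := stage_seq_pow_mul i stage_seq1; apply: (stage_seq_agree Bu) => n mn.
by rewrite /wmul mulr1.
Qed.

(** The coefficient of degree [j] is the finite sum of [lr_c_mul]. The number of terms does not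
    depend on [n], because the order bounds of the factors are uniform in [n]. *)
Lemma stage_seq_mul g h : stage_seq m u g -> stage_seq m u h -> stage_seq m u (wmul g h).
Proof.
move=> ug uh; case/stage_seqP: (ug) => _ gF [l gl] gc.
case/stage_seqP: (uh) => _ hF [l' hl] hc; apply: (@stage_seqI _ (l + l')).
- by move=> n mn; apply: (lrM (Lr mn)); [exact: gF|exact: hF].
- move=> n mn; apply: (lr_ge_mul (Lr mn)); [exact: gF|exact: hF|exact: gl|exact: hl].
move=> j; pose N := (absz (j - l - l')%R).+1.
have sb : below_seq m u (fun n => \sum_(i < N)
    wmul (wcoef u g (l + i%:Z)) (wcoef u (wmul (wpow (l + i%:Z)) h) j) n).
  apply: (union_seq_sum IHu) => i; apply: below_seqM => //.
  by have /stage_seqP[] := stage_seq_pow_mul (l + i%:Z) uh.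
apply: union_seq_agree sb => n mn; rewrite /wcoef /wmul /wpow.
have jN : j < l + N%:Z + l' by rewrite /N; lia.
rewrite (lr_c_mul (Lr mn) (AM mn) _ _ (gl n mn) (hl n mn) jN) //.
  exact: gF.
exact: hF.
Qed.

(** The commutator is $\overline{[x,u]}+t(x,u)$, and by centrality $[x,u]$ lies in the next term of
    the RN-series, all of whose letters are smaller than [u]. *)
Lemma below_der_var x : below_seq m u (wder x (seq_of (bar u))).
Proof.
have [i im Ciu] := Bu.
have bx : below_seq m u (seq_of (bar (br x u))).
  apply: (union_seq_const IHu (j := i.+1)).
    move=> b [j /= ij Cjb] _; apply/(sltP rnH qC canC Cjb Ciu); left; exact: ij.
  by apply: cp_sub_bar; apply: (rn_central rnH); exact: (layer_sub qC).
have ix : below_seq m u (seq_of (iota (- t x u))).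
  by left; apply: base_seq_const; exact: cp_sub_iota.
apply: union_seq_agree (below_seqB bx ix) => n mn; rewrite /wsub /wder /seq_of.
by rewrite rmorphN rmorphN opprK -rmorphD -bar_bar /inner_der rmorphB !rmorphM.
Qed.

(** Differentiating $uz=1$ gives $D(z)=-zD(u)z$. *)
Lemma stage_seq_der_var_inv x : stage_seq m u (wder x (wvar_inv u)).
Proof.
have zu := stage_seq_pow 1; have z : stage_seq m u (wvar_inv u).
  by apply: (stage_seq_agree Bu _ zu) => n mn; rewrite /wpow /= expr1.
have Du := below_stage_seq Bu (below_der_var x).
have := stage_seq_sub (below_stage_seq Bu below_seq0)
  (stage_seq_mul z (stage_seq_mul Du z)).
apply: (stage_seq_agree Bu) => n mn; rewrite /wsub /wmul /wder /seq_of sub0r.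
set zn := wvar_inv u n; set un := Phi n (bar u); set D := inner_der _.
have uz : un * zn = 1 := lr_uz (Lr mn); have zun : zn * un = 1 := lr_zu (Lr mn).
have D1 : D 1 = 0 by rewrite /D /inner_der mulr1 mul1r subrr.
have /eqP : D un * zn + un * D zn = 0 by rewrite -D1 -uz /D inner_derM.
rewrite addrC addr_eq0 => /eqP e.
by rewrite -[RHS]mul1r -zun -mulrA e mulrN.
Qed.

Lemma stage_seq_add g h : stage_seq m u g -> stage_seq m u h ->
  stage_seq m u (wadd g h).
Proof.
move=> ug uh; have u0 := below_stage_seq Bu below_seq0.
have := stage_seq_sub ug (stage_seq_sub u0 uh).
by apply: (stage_seq_agree Bu) => n mn; rewrite /wsub sub0r opprK.
Qed.

Lemma stage_seq_der_pow x i : stage_seq m u (wder x (wpow i)).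
Proof.
have Du := below_stage_seq Bu (below_der_var x).
have Dz := stage_seq_der_var_inv x.
have U : stage_seq m u (seq_of (bar u)).
  by apply: (stage_seq_agree Bu _ (stage_seq_pow (-1))) => n mn; rewrite /wpow /= expr1.
have Z : stage_seq m u (wvar_inv u).
  by apply: (stage_seq_agree Bu _ (stage_seq_pow 1)) => n mn; rewrite /wpow /= expr1.
have step (y w : W) : stage_seq m u y -> stage_seq m u (wder x y) ->
    stage_seq m u w -> stage_seq m u (wder x w) -> stage_seq m u (wder x (wmul y w)).
  move=> uy uDy uw uDw; have := stage_seq_add (stage_seq_mul uDy uw) (stage_seq_mul uy uDw).
  by apply: (stage_seq_agree Bu) => n mn; rewrite /wder /wmul inner_derM.
case: i => i; elim: i => [|i IHi].
- apply: (stage_seq_agree Bu _ (below_stage_seq Bu below_seq0)) => n mn.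
  by rewrite /wder /wpow /= /inner_der expr0 mulr1 mul1r subrr.
- have := step _ _ Z Dz (stage_seq_pow i) IHi.
  by apply: (stage_seq_agree Bu) => n mn; rewrite /wder /wmul /wpow /= exprS.
- apply: (stage_seq_agree Bu _ Du) => n mn.
  by rewrite /wder /wpow /= expr1.
- have := step _ _ U Du (stage_seq_pow (Negz i)) IHi.
  by apply: (stage_seq_agree Bu) => n mn; rewrite /wder /wmul /wpow /= [in RHS]exprS.
Qed.

Lemma stage_seq_sum (N : nat) (g : 'I_N -> W) : (forall i, stage_seq m u (g i)) ->
  stage_seq m u (fun n => \sum_(i < N) g i n).
Proof.
move=> ug; rewrite wsumE; apply: big_ind => //; last exact: stage_seq_add.
exact: (below_stage_seq Bu below_seq0).
Qed.

(** The derivation preserves the order, so the coefficient of degree [j] depends only on a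
    truncation of [g], a finite sum of terms $a z^i$ to which the product rule applies. *)
Lemma stage_seq_der x g : stage_seq m u g -> stage_seq m u (wder x g).
Proof.
move=> ug; case/stage_seqP: (ug) => _ gF [l gl] gc; apply: (@stage_seqI _ l).
- by move=> n mn; apply: (tower_der (tw n)); [exact: layers_leq Bu|exact: gF].
- move=> n mn; apply: (tower_der_order (tw n)); [exact: layers_leq Bu|exact: gF|exact: gl].
move=> j; pose N := (absz (j - l)%R).+1.
have := @stage_seq_sum N (fun i n =>
  wmul (wder x (wcoef u g (l + i%:Z))) (wpow (l + i%:Z)) n +
  wmul (wcoef u g (l + i%:Z)) (wder x (wpow (l + i%:Z))) n).
case=> [i|_ _ _ _ /(_ j)]; last first.
  apply: union_seq_agree => n mn; rewrite /wcoef /wder /wmul.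
  set D := inner_der _; pose p := lr_trunc (Phi n (bar u)) (wvar_inv u n) (c u) (g n) l N.
  have pF : F u p by apply: (lr_truncA (Lr mn)); exact: gF.
  have Bnu := layers_leq mn Bu.
  have DF y : F u y -> F u (D y) by exact: (tower_der (tw n)).
  have DB y w : D (y - w) = D y - D w by rewrite /D inner_derB.
  have rF : F u (g n - p) by apply: (lrB (Lr mn)) => //; exact: gF.
  have ro := lr_ge_trunc (Lr mn) (N := N) (gF n mn) (gl n mn).
  have -> : D (g n) = D (g n - p) + D p by rewrite DB subrK.
  rewrite (lr_cD (Lr mn)); [|exact: DF|exact: DF].
  have -> : c u (D (g n - p)) j = 0.
    by apply: (@tower_der_order _ _ _ _ _ _ _ _ (tw n) x u _ _ Bnu rF ro j); rewrite /N; lia.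
  rewrite add0r.
  congr (c u _ j); rewrite /p /lr_trunc.
  rewrite /D /inner_der mulr_sumr mulr_suml -sumrB; apply: eq_bigr => i _.
  by rewrite -[RHS]/(inner_der _ (_ * _)) inner_derM.
apply: stage_seq_add.
  apply: stage_seq_mul (stage_seq_pow _); apply: below_stage_seq => //.
  exact: below_seqD.
apply: stage_seq_mul (stage_seq_der_pow _ _).
exact: below_stage_seq.
Qed.

Lemma closure_step : stage_closed m u.
Proof.
split; [exact: stage_seq_sub|exact: stage_seq_mul|exact: stage_seq_der| |].
- by apply: (stage_seq_agree Bu _ (stage_seq_pow (-1))) => n mn; rewrite /wpow /= expr1.
- by apply: (stage_seq_agree Bu _ (stage_seq_pow 1)) => n mn; rewrite /wpow /= expr1.
Qed.

End Closure.

Lemma stage_seq_closed m u : layers C m u -> stage_closed m u.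
Proof.
move=> Bu; move: u Bu; apply: (wo_wf (wo m)) => u Bu IHu.
by apply: closure_step => // v; exact: IHu.
Qed.

Lemma top_closed m v : layers C m v -> setT v -> stage_closed m v.
Proof. by move=> Bv _; exact: stage_seq_closed. Qed.
Lemma below_closed m u v : layers C m v -> slt v u -> stage_closed m v.
Proof. by move=> Bv _; exact: stage_seq_closed. Qed.
Local Notation top_seq m := (union_seq m setT).

Lemma base_seq_incl m n D g : (m <= n)%N ->
  (forall b, tail_layers C m b -> layers C n b -> D b) -> base_seq m g -> union_seq n D g.
Proof.
move=> mn mD [s As gs].
have nD v : layers C n v -> D v -> stage_closed n v by move=> Bv _; exact: stage_seq_closed.
apply: union_seq_agree (union_seq_const nD mD As) => i ni.
by rewrite gs //; exact: leq_trans ni.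
Qed.

(** The connecting map keeps the sequence. Its coefficients in $R_m$ are expanded at level [n],
    where the new variables are all smaller than [u]. *)
Lemma stage_seq_incl m n u g : (m <= n)%N -> stage_seq m u g -> stage_seq n u g.
Proof.
move=> mn ug; have [Bu _ _ _] := (stage_seqP _ _ _).1 ug.
move: u Bu g ug; apply: (wo_wf (wo m)) => u Bu IHu g /stage_seqP[_ gF [l gl] gc].
apply/stage_seqP; split; first exact: layers_leq Bu.
- by move=> i ni; apply: gF; exact: leq_trans ni.
- by exists l => i ni; apply: gl; exact: leq_trans ni.
move=> j; have [gb|[v [Bv vu vg]]] := gc j.
  by apply: base_seq_incl gb => // b tb _; exact: (tail_slt rnH qC canC Bu tb).
by right; exists v; split=> //; [exact: layers_leq Bv|exact: IHu].
Qed.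

Lemma top_seq_incl m n g : (m <= n)%N -> top_seq m g -> top_seq n g.
Proof.
move=> mn [gb|[v [Bv _ vg]]]; first exact: base_seq_incl gb.
by right; exists v; split=> //; [exact: layers_leq Bv|exact: stage_seq_incl vg].
Qed.

Definition eventually_zero g := exists n0, forall n, (n0 <= n)%N -> g n = 0.

(** A nonzero [s] has a left invertible image in [Q i] for large [i], so its images cannot vanish
    eventually. This is the injectivity of the connecting maps. *)
Lemma base_seq_eq0 m g : base_seq m g -> eventually_zero g -> agree m g (fun=> 0).
Proof.
move=> [s As gs] [n0 g0]; suff s0 : s = 0 by move=> n mn; rewrite gs // s0 rmorph0.
apply/eqP/negPn/negP => s0.
have [L LE Ls] := spanned_finite (cp_sub_spanned rnH qC canC cpS As).
have [n mn Ln] := tail_finite LE; pose i := maxn n n0.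
have Li : {subset L <= layers C i}.
  by move=> b /Ln; rewrite !in_setE; apply: layers_leq; exact: leq_maxl.
have AK a : (Phi i @` A i) (Phi i (iota a)) by exists (iota a) => //; exact: cp_sub_iota.
have [q qs _] := spanned_left_inverse (tw i) (wo i) AK divK Li Ls s0.
move: qs; rewrite -gs; last exact: leq_trans mn (leq_maxl _ _).
by rewrite g0 ?leq_maxr // mulr0 => /eqP; rewrite eq_sym oner_eq0.
Qed.

Lemma wcoef_eventually_zero m u g j : layers C m u -> eventually_zero g ->
  eventually_zero (wcoef u g j).
Proof.
move=> Bu [n0 g0]; exists (maxn n0 m) => n; rewrite geq_max => /andP[n0n mn].
by rewrite /wcoef g0 // (lr_c0 (limit_laurent (layers_leq mn Bu))).
Qed.

Lemma stage_seq_eq0 m u g : stage_seq m u g -> eventually_zero g -> agree m g (fun=> 0).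
Proof.
move=> ug; have [Bu _ _ _] := (stage_seqP _ _ _).1 ug.
move: u Bu g ug; apply: (wo_wf (wo m)) => u Bu IHu g /stage_seqP[_ gF _ gc] g0 n mn.
apply: (lr_eq0 (limit_laurent (layers_leq mn Bu))) => [|j]; first exact: gF.
have gj0 := wcoef_eventually_zero j Bu g0.
have [gb|[v [Bv vu vg]]] := gc j; first exact: base_seq_eq0 gb gj0 n mn.
exact: (IHu v Bv vu _ vg gj0).
Qed.

Lemma union_seq_eq0 m D g : union_seq m D g -> eventually_zero g -> agree m g (fun=> 0).
Proof. by case=> [|[v [_ _]]]; [exact: base_seq_eq0|exact: stage_seq_eq0]. Qed.

Definition limit_dom : set W := [set g | exists m, top_seq m g].
Definition limit_eq g h := exists n0, agree n0 g h.

Lemma limit_dom2 (op : W -> W -> W) :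
  (forall m g h, top_seq m g -> top_seq m h -> top_seq m (op g h)) ->
  forall g h, limit_dom g -> limit_dom h -> limit_dom (op g h).
Proof.
move=> opP g h [m gm] [m' hm]; exists (maxn m m'); apply: opP.
  by apply: top_seq_incl gm; exact: leq_maxl.
by apply: top_seq_incl hm; exact: leq_maxr.
Qed.
Lemma limit_eq2 (op : W -> W -> W) :
  (forall g g' h h' n, g n = g' n -> h n = h' n -> op g h n = op g' h' n) ->
  forall g g' h h', limit_eq g g' -> limit_eq h h' -> limit_eq (op g h) (op g' h').
Proof.
move=> opP g g' h h' [m gg] [m' hh]; exists (maxn m m') => n; rewrite geq_max => /andP[mn mn'].
by apply: opP; [exact: gg|exact: hh].
Qed.
Lemma limit_eq_pointwise g h : (forall n, g n = h n) -> limit_eq g h.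
Proof. by exists 0%N. Qed.

Lemma limit_dom0 : limit_dom (fun=> 0). Proof. by exists 0%N; left; exact: base_seq0. Qed.
Lemma limit_dom1 : limit_dom (fun=> 1). Proof. by exists 0%N; left; exact: base_seq1. Qed.
Lemma limit_domD g h : limit_dom g -> limit_dom h -> limit_dom (wadd g h).
Proof. by apply: limit_dom2 => m; apply: union_seqD; exact: top_closed. Qed.
Lemma limit_domM g h : limit_dom g -> limit_dom h -> limit_dom (wmul g h).
Proof. by apply: limit_dom2 => m; apply: union_seqM; exact: top_closed. Qed.
Definition wopp g : W := fun n => - g n.
Lemma limit_domN g : limit_dom g -> limit_dom (wopp g).
Proof.
move=> [m gm]; exists m; have := union_seqB (@top_closed m) (union_seq0 m _) gm.
by apply: union_seq_agree => n _; rewrite /wsub sub0r.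
Qed.

Definition limit_pre_ring : pre_ring W.
Proof.
apply: (@PreRing W limit_dom limit_eq (fun=> 0) (fun=> 1) wopp wadd wmul).
- by move=> g; exists 0%N.
- by move=> g h [n gh]; exists n => i /gh.
- move=> f g h [n fg] [n' gh]; exists (maxn n n') => i; rewrite geq_max => /andP[ni n'i].
  by rewrite fg // gh.
- exact: limit_dom0.
- exact: limit_dom1.
- exact: limit_domN.
- exact: limit_domD.
- exact: limit_domM.
- by move=> g g' [n gg]; exists n => i ni; rewrite /wopp gg.
- by apply: limit_eq2 => g g' h h' n; rewrite /wadd => -> ->.
- by apply: limit_eq2 => g g' h h' n; rewrite /wmul => -> ->.
- by move=> *; apply: limit_eq_pointwise => n; exact: addrA.
- by move=> *; apply: limit_eq_pointwise => n; exact: addrC.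
- by move=> *; apply: limit_eq_pointwise => n; exact: add0r.
- by move=> *; apply: limit_eq_pointwise => n; exact: addNr.
- by move=> *; apply: limit_eq_pointwise => n; exact: mulrA.
- by move=> *; apply: limit_eq_pointwise => n; exact: mul1r.
- by move=> *; apply: limit_eq_pointwise => n; exact: mulr1.
- by move=> *; apply: limit_eq_pointwise => n; exact: mulrDl.
- by move=> *; apply: limit_eq_pointwise => n; exact: mulrDr.
- by move=> [n /(_ n (leqnn n))/eqP]; rewrite oner_eq0.
Defined.
Local Notation T := (pr_type limit_pre_ring).
Local Notation germ := (@pr_pi _ limit_pre_ring).

Lemma germ_eqP g h : limit_dom g -> limit_dom h -> germ g = germ h <-> limit_eq g h.
Proof. exact: (@pr_pi_eq _ limit_pre_ring). Qed.

Lemma limit_dom_agree m g h : agree m g h -> limit_dom g -> limit_dom h.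
Proof.
move=> gh [m' gm]; exists (maxn m m'); apply: union_seq_agree (top_seq_incl (leq_maxr m m') gm).
by move=> n; rewrite geq_max => /andP[mn _]; exact: gh.
Qed.

Lemma germ_agree m g h : agree m g h -> limit_dom g -> germ g = germ h.
Proof.
by move=> gh gd; apply/(germ_eqP gd (limit_dom_agree gh gd)); exists m.
Qed.
Lemma germD g h : limit_dom g -> limit_dom h -> germ (wadd g h) = germ g + germ h.
Proof. exact: (@pr_piD _ limit_pre_ring). Qed.
Lemma germN g : limit_dom g -> germ (wopp g) = - germ g.
Proof. exact: (@pr_piN _ limit_pre_ring). Qed.
Lemma germM g h : limit_dom g -> limit_dom h -> germ (wmul g h) = germ g * germ h.
Proof. exact: (@pr_piM _ limit_pre_ring). Qed.
Lemma germB g h : limit_dom g -> limit_dom h -> germ (wsub g h) = germ g - germ h.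
Proof. by move=> gd hd; rewrite -germN // -germD //; exact: limit_domN. Qed.
Lemma germ_dom_const s : limit_dom (seq_of s).
Proof. by exists 0%N; left; exists s; [exact: (cp_sub0 rnH cpS)|]. Qed.

Lemma union_dom m D g : union_seq m D g -> limit_dom g.
Proof. by move=> [gb|[v [Bv _ vg]]]; exists m; [left|right; exists v]. Qed.
Lemma stage_dom m u g : stage_seq m u g -> limit_dom g.
Proof. by move=> ug; exists m; right; exists u; split=> //; case/stage_seqP: ug. Qed.

Definition limit_map (s : S) : T := germ (seq_of s).
Lemma limit_mapB s s' : limit_map (s - s') = limit_map s - limit_map s'.
Proof.
rewrite -germB; [|exact: germ_dom_const|exact: germ_dom_const].
apply: (@germ_agree 0); last exact: germ_dom_const.
by move=> n _; rewrite /seq_of /wsub rmorphB.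
Qed.
Lemma limit_mapM : monoid_morphism limit_map.
Proof.
split=> [|s s']; first by apply: (@germ_agree 0); [move=> n _; exact: rmorph1|exact: germ_dom_const].
rewrite -germM; [|exact: germ_dom_const|exact: germ_dom_const].
apply: (@germ_agree 0); last exact: germ_dom_const.
by move=> n _; rewrite /seq_of /wmul rmorphM.
Qed.
HB.instance Definition _ := GRing.isZmodMorphism.Build S T limit_map limit_mapB.
HB.instance Definition _ := GRing.isMonoidMorphism.Build S T limit_map limit_mapM.

Definition limit_F m u : set T := germ @` stage_seq m u.
(** The coefficients must not depend on the level, so they are taken on the chosen representative;
    by [limit_cE] any sequence of the stage may replace it. *)
Definition limit_c u (f : T) (j : int) : T := germ (wcoef u (pr_val f) j).
Local Notation limit_below m u :=
  (stage_below (limit_map @` A m) (layers C m) le (limit_F m) u).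

Lemma wcoef_dom m u g j : stage_seq m u g -> limit_dom (wcoef u g j).
Proof. by case/stage_seqP => _ _ _ /(_ j); exact: union_dom. Qed.

Lemma limit_cE m u g j : stage_seq m u g -> limit_c u (germ g) j = germ (wcoef u g j).
Proof.
move=> ug; have [n0 gg] : limit_eq g (pr_val (germ g)).
  exact: (@pr_piK _ limit_pre_ring g (stage_dom ug)).
apply: esym; apply: (@germ_agree n0); last exact: wcoef_dom ug.
by move=> n ni; rewrite /wcoef gg.
Qed.

Lemma germ_der x g : limit_dom g -> inner_der (limit_map (bar x)) (germ g) = germ (wder x g).
Proof.
move=> gd; have xd := germ_dom_const (bar x).
by rewrite /inner_der -!germM // -germB //; exact: limit_domM.
Qed.

Lemma limit_belowP m u f : limit_below m u f <-> exists2 g, below_seq m u g & germ g = f.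
Proof.
split=> [[[s As <-]|[v [Bv vu lvu] [g vg <-]]]|[g [gb|[v [Bv [vu lvu] vg]]] <-]].
- by exists (seq_of s) => //; left; exact: base_seq_const.
- by exists g => //; right; exists v.
- left; have [s As gs] := gb; exists s => //; apply: esym; apply: (@germ_agree m) => //.
  by apply: (@union_dom m set0); left.
- by right; exists v => //; exists g.
Qed.

(** The difference is eventually zero, hence zero from [m] on by [union_seq_eq0]. Identities between
    germs of level [m] can therefore be read in every [Q n] with [m <= n]. *)
Lemma germ_union_eq m D g h : union_seq m D g -> union_seq m D h ->
  (forall v, layers C m v -> D v -> stage_closed m v) -> germ g = germ h -> agree m g h.
Proof.
move=> gb hb cD /(germ_eqP (union_dom gb) (union_dom hb))[n0 gh] n mn.
apply/eqP; rewrite -subr_eq0; apply/eqP.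
apply: (union_seq_eq0 (union_seqB cD gb hb)) mn.
by exists n0 => i ni; rewrite /wsub gh // subrr.
Qed.

(** * The Laurent axioms for germs *)

Section LimitStage.
Variables (m : nat) (u : H).
Hypothesis Bu : layers C m u.
Let Lr n (mn : (m <= n)%N) := limit_laurent (layers_leq mn Bu).
Let belowE := limit_belowP m u.
Let cl := stage_seq_closed Bu.
Let IHu v := @below_closed m u v.

Lemma order_germ g l : stage_seq m u g ->
  order_ge (limit_c u) (germ g) l <-> forall n, (m <= n)%N -> order_ge (@c n u) (g n) l.
Proof.
move=> ug; have [_ _ _ gc] := (stage_seqP _ _ _).1 ug.
split=> [gl n mn j jl|gl j jl].
  have := gl j jl; rewrite (limit_cE j ug) -[0]/(germ (fun=> 0)) => e.
  exact: (germ_union_eq (gc j) (union_seq0 m _) IHu e mn).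
rewrite (limit_cE j ug); apply: (@germ_agree m); last exact: wcoef_dom ug.
by move=> n mn; exact: (gl n mn j jl).
Qed.

Lemma limit_c_inj f f' : limit_F m u f -> limit_F m u f' ->
  limit_c u f =1 limit_c u f' -> f = f'.
Proof.
move=> [g ug <-] [h uh <-] gh; apply: (@germ_agree m); last exact: stage_dom ug.
have [_ gF _ gc] := (stage_seqP _ _ _).1 ug; have [_ hF _ hc] := (stage_seqP _ _ _).1 uh.
move=> n mn; apply: (lr_ext (Lr mn)) => [||j]; [exact: gF|exact: hF|].
apply: (germ_union_eq (gc j) (hc j) IHu _ mn).
by rewrite -(limit_cE j ug) -(limit_cE j uh) gh.
Qed.

Lemma limit_stage_subring : subring_closed [in limit_F m u].
Proof.
have [cB cM _ _ _] := cl; apply: subring_closedP.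
- by exists (fun=> 1) => //; apply: (below_stage_seq Bu); left; exact: base_seq1.
- move=> _ _ [g ug <-] [h uh <-]; exists (wsub g h); first exact: cB.
  by rewrite germB //; [exact: stage_dom ug|exact: stage_dom uh].
- move=> _ _ [g ug <-] [h uh <-]; exists (wmul g h); first exact: cM.
  by rewrite germM //; [exact: stage_dom ug|exact: stage_dom uh].
Qed.

(** The coefficients are represented by sequences [b j], and in each [Q n] the series with
    coefficients [b j n] is formed. Below [l] the zero sequence itself is the representative, which
    makes the order bound uniform in [n]. *)
Lemma limit_series (a : int -> T) : (forall j, limit_below m u (a j)) ->
  (exists l : int, forall j, j < l -> a j = 0) ->
  exists2 f, limit_F m u f & limit_c u f =1 a.
Proof.
move=> ab [l al].
have rep j : exists b : W, [/\ below_seq m u b, germ b = a j & j < l -> b = fun=> 0].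
  have [jl|lj] := ltP j l; first by exists (fun=> 0); rewrite (al j jl); split=> //; exact: union_seq0.
  by have [b bb ba] := (belowE _).1 (ab j); exists b.
have [b bP] := choice rep.
have fP n : exists f : Q n, (m <= n)%N -> F u f /\ c u f =1 (fun j => b j n).
  have [mn|nm] := leqP m n; last by exists 0.
  have [||f [fP _]] := @laurent_series _ _ _ _ _ _ (Lr mn) (fun j => b j n); last by exists f.
    by move=> j; apply: (below_seq_at Bu _ mn); have [] := bP j.
  by exists l => j jl; have [_ _ ->] := bP j.
pose g : W := fun n => projT1 (cid (fP n)).
have gP n : (m <= n)%N -> F u (g n) /\ c u (g n) =1 (fun j => b j n).
  exact: (projT2 (cid (fP n))).
have bg j : agree m (b j) (wcoef u g j) by move=> n mn; rewrite /wcoef (gP n mn).2.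
have ug : stage_seq m u g.
  apply: (stage_seqI Bu (l := l)) => [n mn|n mn j jl|j].
  - exact: (gP n mn).1.
  - by rewrite (gP n mn).2; have [_ _ ->] := bP j.
  - by apply: union_seq_agree (bg j) _; have [] := bP j.
exists (germ g) => [|j]; first by exists g.
have [bb <- _] := bP j; rewrite (limit_cE j ug); apply: esym.
by apply: (@germ_agree m) => //; exact: union_dom bb.
Qed.

Lemma germ_var_inv_pow i : germ (wvar_inv u) ^+ i = germ (wpow u (Posz i)).
Proof.
have [_ _ _ _ uz] := cl; elim: i => [|i IHi]; first by rewrite expr0.
rewrite exprS IHi -germM; [|exact: stage_dom uz|exact: stage_dom (stage_seq_pow Bu IHu _)].
by congr germ; apply: functional_extensionality_dep => n; rewrite /wmul /wpow /= exprS.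
Qed.
Lemma germ_var_pow i : limit_map (bar u) ^+ i = germ (wpow u (- i%:Z)).
Proof.
have ud := germ_dom_const (bar u); case: i => [|i]; first by rewrite expr0.
have -> : - Posz i.+1 = Negz i by rewrite NegzE.
elim: i => [|i IHi].
  by rewrite expr1; congr germ; apply: functional_extensionality_dep => n; rewrite /wpow /= expr1.
rewrite exprS IHi -germM; [|exact: ud|exact: stage_dom (stage_seq_pow Bu IHu _)].
by congr germ; apply: functional_extensionality_dep => n; rewrite /wmul /wpow /= [in RHS]exprS.
Qed.

Lemma limit_c_monomial g i j : below_seq m u g ->
  limit_c u (germ g * germ (wpow u i)) j = if j == i then germ g else 0.
Proof.
move=> gb; have ug := below_stage_seq Bu gb; have ui := stage_seq_pow Bu IHu i.
have [_ cM _ _ _] := cl; have uM := cM _ _ ug ui.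
rewrite -germM; [|exact: stage_dom ug|exact: stage_dom ui].
rewrite (limit_cE j uM).
have -> : (if j == i then germ g else 0) = germ (if j == i then g else fun=> 0) by case: ifP.
apply: (@germ_agree m); last exact: wcoef_dom uM.
move=> n mn; rewrite /wcoef /wmul /wpow (lr_c_mon (Lr mn)); last exact: (below_seq_at Bu gb mn).
by case: ifP.
Qed.

Lemma germ_iter_der i g : limit_dom g ->
  iter i (inner_der (limit_map (bar u))) (germ g) = germ (iter i (wder u) g) /\
  limit_dom (iter i (wder u) g).
Proof.
move=> gd; elim: i => [|i [IHi di]]; first by [].
rewrite !iterS IHi germ_der //; split=> //.
have xd := germ_dom_const (bar u).
have := limit_domD (limit_domM xd di) (limit_domN (limit_domM di xd)).
exact.
Qed.

Lemma limit_laurent_ring :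
  laurent_ring (limit_below m u) (limit_F m u) ((limit_map \o bar) u)
    (germ (wvar_inv u)) (limit_c u).
Proof.
have [cB cM cD uu uz] := cl; have ud := stage_dom uu; have zd := stage_dom uz.
have ad g : below_seq m u g -> limit_dom g by exact: union_dom.
split.
- exact: limit_stage_subring.
- by move=> f /belowE[g gb <-]; exists g => //; exact: below_stage_seq.
- split; [by exists (seq_of (bar u))|by exists (wvar_inv u)| |].
  + rewrite /= -[limit_map _]/(germ _) -germM //; apply: (@germ_agree m); last exact: limit_domM.
    by move=> n mn; rewrite /wmul /seq_of; exact: (lr_uz (Lr mn)).
  + rewrite /= -[limit_map _]/(germ _) -germM //; apply: (@germ_agree m); last exact: limit_domM.
    by move=> n mn; rewrite /wmul /seq_of; exact: (lr_zu (Lr mn)).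
- move=> f /belowE[g gb <-]; apply/belowE; exists (wder u g).
    exact: (union_seq_der (D := slt^~ u) IHu).
  by rewrite germ_der //; exact: ad.
- move=> f [g ug <-]; have [_ _ [l gl] gc] := (stage_seqP _ _ _).1 ug; split.
    by move=> j; apply/belowE; exists (wcoef u g j) => //; rewrite (limit_cE j ug).
  by exists l; apply/(order_germ _ ug).
- move=> a aA al; have [f uf fa] := limit_series aA al.
  exists f; split=> // f' [uf' fa']; apply: limit_c_inj => // j.
  by rewrite fa fa'.
- move=> _ _ [g ug <-] [h uh <-] j.
  have ugh := stage_seq_add Bu IHu ug uh.
  rewrite -germD; [|exact: stage_dom ug|exact: stage_dom uh].
  rewrite (limit_cE j ugh) (limit_cE j ug) (limit_cE j uh).
  rewrite -germD; [|exact: wcoef_dom ug|exact: wcoef_dom uh].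
  apply: (@germ_agree m); last exact: wcoef_dom ugh.
  move=> n mn; rewrite /wcoef /wadd (lr_cD (Lr mn)) //.
    by have [_ gF _ _] := (stage_seqP _ _ _).1 ug; exact: gF.
  by have [_ hF _ _] := (stage_seqP _ _ _).1 uh; exact: hF.
- move=> f i /belowE[g gb <-]; rewrite germ_var_inv_pow germ_var_pow.
  by split=> j; rewrite limit_c_monomial.
- move=> f /belowE[g gb <-]; have ug := below_stage_seq Bu gb; have uzg := cM _ _ uz ug.
  have Lc n (mn : (m <= n)%N) := laurent_commute (Lr mn) (below_seq_at Bu gb mn).
  rewrite -germM //; last exact: ad.
  split=> [|i]; first by apply/(order_germ _ uzg) => n mn; have [] := Lc n mn.
  have [e di] := germ_iter_der i (ad _ gb); rewrite (limit_cE _ uzg) e.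
  have -> : (-1) ^+ i * germ (iter i (wder u) g) =
      germ (fun n => (-1) ^+ i * iter i (wder u) g n).
    have sgn (R : nzRingType) (x : R) : (-1) ^+ i * x = if odd i then - x else x.
      by rewrite -signr_odd; case: (odd i); rewrite ?expr1 ?expr0 ?mulN1r ?mul1r.
    rewrite sgn; case: ifP => oi.
      rewrite -germN //; apply: (@germ_agree 0); last exact: limit_domN.
      by move=> n _; rewrite sgn oi.
    by apply: (@germ_agree 0) => // n _; rewrite sgn oi.
  apply: (@germ_agree m); last exact: wcoef_dom uzg.
  move=> n mn; have [_ h] := Lc n mn; rewrite /wcoef /wmul h; congr (_ * _).
  by elim: i {e di h} => //= i ->.
- move=> _ _ l l' [g ug <-] [h uh <-] /(order_germ _ ug) gl /(order_germ _ uh) hl.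
  have ugh := cM _ _ ug uh; rewrite -germM; [|exact: stage_dom ug|exact: stage_dom uh].
  apply/(order_germ _ ugh) => n mn; apply: (laurent_order_mul (Lr mn)).
  + by have [_ gF _ _] := (stage_seqP _ _ _).1 ug; exact: gF.
  + by have [_ hF _ _] := (stage_seqP _ _ _).1 uh; exact: hF.
  + exact: gl.
  + exact: hl.
Qed.

End LimitStage.

Lemma limit_series_data :
  series_data Hs C le iota bar limit_map limit_F limit_c.
Proof.
split=> [m|m n u mn Bu f [g ug <-]|f].
- split.
  + apply: subring_closedP.
    * by exists 1; [exact: gen_subring1|rewrite rmorph1].
    * by move=> _ _ [s As <-] [t' At <-]; exists (s - t'); rewrite ?rmorphB //; exact: gen_subringB.
    * by move=> _ _ [s As <-] [t' At <-]; exists (s * t'); rewrite ?rmorphM //; exact: gen_subringM.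
  + move=> x _ [s As <-]; exists (inner_der (bar x) s).
      by have := cp_sub_der rnH bar_iota bar_bar (x, 0) As; rewrite /mu rmorph0 addr0.
    by rewrite /inner_der rmorphB !rmorphM.
  + by move=> u Bu; exists (germ (wvar_inv u)); exact: limit_laurent_ring.
  + move=> x u _ Bu [g ug <-]; have [_ _ cD _ _] := stage_seq_closed Bu.
    by exists (wder x g); [exact: cD|rewrite germ_der //; exact: stage_dom ug].
  + move=> x u _ l Bu [g ug <-] /(order_germ _ ug) gl.
    have [_ _ cD _ _] := stage_seq_closed Bu.
    rewrite /= germ_der; last exact: stage_dom ug.
    apply/(order_germ _ (cD x _ ug)) => n mn.
    have [_ gF _ _] := (stage_seqP _ _ _).1 ug.
    apply: (@tower_der_order _ _ _ _ _ _ _ _ (tw n) x u _ _ (layers_leq mn Bu)); first exact: gF.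
    exact: gl.
- by exists g => //; exact: stage_seq_incl ug.
have [m [gb|[u [Bu _ ug]]]] := pr_valP f.
  exists m; left; have [s As gs] := gb; exists s => //.
  rewrite -[RHS]pr_valK; apply: esym; apply: (@germ_agree m) => //; exact: pr_valP f.
by exists m; right; exists u => //; exists (pr_val f) => //; exact: pr_valK.
Qed.

End Limit.

Theorem corollary7p8 (k : fieldType) (H : lmodType k)
    (br : {bilinear H -> H -> H}) (lieH : lie_bracket br)
    (Hs : nat -> set H) (rnH : rn_series br Hs)
    (C : nat -> set H) (qC : q_basis Hs C)
    (K : algType k) (divK : division_ring K)
    (S : algType k) (iota : {lrmorphism K -> S}) (bar : {linear H -> S})
    (cpS : crossed_product br iota bar)
    (le : rel H) (canC : canonical_order C le) :
  (exists (T : nzRingType) (phi : {rmorphism S -> T}),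
     is_series_ring Hs C le iota bar phi) /\
  (forall (T : nzRingType) (phi : {rmorphism S -> T}),
     is_series_ring Hs C le iota bar phi ->
     division_ring T /\ injective phi).
Proof.
split=> [|T phi [F [c sd]]]; last first.
  split; first exact: (series_division_ring rnH qC canC cpS divK sd).
  exact: (series_map_injective rnH qC canC cpS divK sd).
have [delta [t [_ _ bi bb]]] := cp_mul cpS.
(* The rings [Q n] are chosen separately for each [n]; only the maps from the crossed product relate
   them. *)
have tow n := cid (crossed_tower_exists rnH qC canC cpS bi bb n).
pose Q n := projT1 (tow n); have towPhi n := cid (projT2 (tow n)).
pose Phi n : {rmorphism S -> Q n} := projT1 (towPhi n).
have towF n := cid (projT2 (towPhi n)); pose F n := projT1 (towF n).
have towc n := cid (projT2 (towF n)); pose c n := projT1 (towc n).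
have tw n : series_tower (Phi n @` cp_sub iota bar (Hs n)) (layers C n) le
    (Phi n \o bar) (F n) (c n) := projT2 (towc n).
have sd := limit_series_data rnH qC canC cpS divK bi bb tw.
by eexists _, _, _, _; exact: sd.
Qed.
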